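(* Let $\kappa>0$, let $p\ge0$ be an integer, let $\Omega\subset\mathbb{R}^3$ be a domain with polyhedral boundary partitioned as $\partial\Omega=\Gamma_{\mathrm{E}}\cup\Gamma_{\mathrm{H}}\cup\Gamma_{\mathrm{I}}$, and let $\mathcal{T}_h$ be a conforming mesh of $\Omega$ by finitely many tetrahedra. Let $\mathbf{S}$ and $\boldsymbol{\Pi}$ be the global scattering and exchange operators on $\boldsymbol{G}_h^t$ (defined in the context). Then the operator $\boldsymbol{\Pi}\mathbf{S}$ is a strict contraction, i.e. $$\|\boldsymbol{\Pi}\mathbf{S}(\boldsymbol{g}_h^\ominus)\|_{\partial\mathcal{T}_h}<\|\boldsymbol{g}_h^\ominus\|_{\partial\mathcal{T}_h}\qquad\text{for all }\boldsymbol{g}_h^\ominus\in\boldsymbol{G}_h^t\setminus\{\boldsymbol{0}\}.$$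
   Context: Setting. $\Gamma_{\mathrm{E}},\Gamma_{\mathrm{H}},\Gamma_{\mathrm{I}}$ are three mutually disjoint polytopal Lipschitz subsets of $\partial\Omega$ (each possibly empty); each mesh face $F\subset\partial\Omega$ lies in exactly one of them. Every mesh face not contained in $\partial\Omega$ is shared by exactly two elements $K,K'\in\mathcal{T}_h$, and every face contained in $\partial\Omega$ belongs to exactly one element. Notation. $\imath$ is the imaginary unit. For $K\in\mathcal{T}_h$, $\mathcal{F}_K$ is the set of faces of $K$. $\boldsymbol{\mathcal{P}}_p(K)$ (resp. $\boldsymbol{\mathcal{P}}_p(F)$) is the space of $\mathbb{C}^3$-valued polynomials of degree at most $p$ on the tetrahedron $K$ (resp. on the planar face $F$). For $F\in\mathcal{F}_K$, $\boldsymbol{n}_{K,F}\in\mathbb{R}^3$ is the unit normal to $F$ outward to $K$. The tangential trace space is $\boldsymbol{\mathcal{P}}_p^t(F)=\{\boldsymbol{v}\in\boldsymbol{\mathcal{P}}_p(F) : \boldsymbol{n}_F\cdot\boldsymbol{v}=0\}$, with $\boldsymbol{n}_F$ a unit normal to $F$ (either orientation). For $\boldsymbol{v}\in\boldsymbol{\mathcal{P}}_p(K)$, its tangential trace on $F$ is $\boldsymbol{n}_{K,F}\times\boldsymbol{v}|_F$ and its tangential component trace is $\boldsymbol{\pi}^t_{K,F}(\boldsymbol{v})=-\boldsymbol{n}_{K,F}\times(\boldsymbol{n}_{K,F}\times\boldsymbol{v}|_F)$. Sesquilinear forms: $(\boldsymbol{v},\boldsymbol{w})_K=\int_K\boldsymbol{v}\cdot\overline{\boldsymbol{w}}\,d\boldsymbol{x}$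 and $\langle\boldsymbol{v},\boldsymbol{w}\rangle_F=\int_F\boldsymbol{v}\cdot\overline{\boldsymbol{w}}\,d\sigma$, where $\cdot$ is the bilinear dot product. Skeleton space: $\boldsymbol{G}_h^t=\prod_{K\in\mathcal{T}_h}\prod_{F\in\mathcal{F}_K}\boldsymbol{\mathcal{P}}_p^t(F)$ (two independent values on each interior face, one on each boundary face); the component of $\boldsymbol{g}$ associated with face $F$ of element $K$ is $\boldsymbol{g}|_{K,F}=\boldsymbol{g}_{K,F}$. Norm: $\|\boldsymbol{g}\|_{\partial\mathcal{T}_h}^2=\sum_{K\in\mathcal{T}_h}\sum_{F\in\mathcal{F}_K}\langle\boldsymbol{g}_{K,F},\boldsymbol{g}_{K,F}\rangle_F$. Local problem on $K$: given $\boldsymbol{g}^\ominus_{K,F}\in\boldsymbol{\mathcal{P}}_p^t(F)$ for all $F\in\mathcal{F}_K$, find $(\boldsymbol{e}_K,\boldsymbol{h}_K)\in\boldsymbol{\mathcal{P}}_p(K)\times\boldsymbol{\mathcal{P}}_p(K)$ such that for all $(\boldsymbol{v}_K,\boldsymbol{w}_K)\in\boldsymbol{\mathcal{P}}_p(K)\times\boldsymbol{\mathcal{P}}_p(K)$, $$\imath\kappa(\boldsymbol{e}_K,\boldsymbol{v}_K)_K-(\boldsymbol{h}_K,\nabla\times\boldsymbol{v}_K)_K+\sum_{F\in\mathcal{F}_K}\Big\langle\tfrac12\boldsymbol{g}^\oplus_{K,F}(\boldsymbol{e}_K,\boldsymbol{h}_K),\boldsymbol{\pi}^t_{K,F}(\boldsymbol{v}_K)\Big\rangle_F=\sum_{F\in\mathcal{F}_K}\Big\langle\tfrac12\boldsymbol{g}^\ominus_{K,F},\boldsymbol{\pi}^t_{K,F}(\boldsymbol{v}_K)\Big\rangle_F,$$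 $$\imath\kappa(\boldsymbol{h}_K,\boldsymbol{w}_K)_K+(\boldsymbol{e}_K,\nabla\times\boldsymbol{w}_K)_K+\sum_{F\in\mathcal{F}_K}\Big\langle\tfrac12\boldsymbol{n}_{K,F}\times\boldsymbol{g}^\oplus_{K,F}(\boldsymbol{e}_K,\boldsymbol{h}_K),\boldsymbol{\pi}^t_{K,F}(\boldsymbol{w}_K)\Big\rangle_F=-\sum_{F\in\mathcal{F}_K}\Big\langle\tfrac12\boldsymbol{n}_{K,F}\times\boldsymbol{g}^\ominus_{K,F},\boldsymbol{\pi}^t_{K,F}(\boldsymbol{w}_K)\Big\rangle_F,$$ where $\boldsymbol{g}^\oplus_{K,F}(\boldsymbol{e}_K,\boldsymbol{h}_K)=\boldsymbol{\pi}^t_{K,F}(\boldsymbol{e}_K)-\boldsymbol{n}_{K,F}\times\boldsymbol{h}_K$. This local problem has exactly one solution for any data. Global scattering operator: $\mathbf{S}:\boldsymbol{G}_h^t\to\boldsymbol{G}_h^t$ is defined, for each face $F$ of each element $K$, by $$\mathbf{S}(\boldsymbol{g}_h^\ominus)|_{K,F}=\boldsymbol{\pi}^t_{K,F}(\boldsymbol{e}_K(\boldsymbol{g}_h^\ominus))-\boldsymbol{n}_{K,F}\times\boldsymbol{h}_K(\boldsymbol{g}_h^\ominus),$$ where $(\boldsymbol{e}_K(\boldsymbol{g}_h^\ominus),\boldsymbol{h}_K(\boldsymbol{g}_h^\ominus))$ is the solution of the local problem on $K$ with data $(\boldsymbol{g}_h^\ominus|_{K,F})_{F\in\mathcal{F}_K}$.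 Global exchange operator: $\boldsymbol{\Pi}:\boldsymbol{G}_h^t\to\boldsymbol{G}_h^t$ is defined, for $\boldsymbol{g}\in\boldsymbol{G}_h^t$ and each face $F$ of each element $K$, by $$\boldsymbol{\Pi}(\boldsymbol{g})|_{K,F}=\begin{cases}\boldsymbol{g}_{K',F}&\text{if }F\not\subset\partial\Omega\text{ is shared by }K\text{ and }K',\\-\boldsymbol{g}_{K,F}&\text{if }F\subset\Gamma_{\mathrm{E}},\\ \boldsymbol{g}_{K,F}&\text{if }F\subset\Gamma_{\mathrm{H}},\\ \boldsymbol{0}&\text{if }F\subset\Gamma_{\mathrm{I}}.\end{cases}$$ *)

(* Defs.v *)
From HB Require Import structures.
From mathcomp Require Import all_boot all_order all_algebra.
From mathcomp Require Import all_classical all_reals all_analysis.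
From mathcomp Require Import complex ring.
(* The notations of mpoly clash with those of mathcomp-analysis. *)
From mathcomp Require Import (canonicals, coercions) mpoly.

Set Implicit Arguments.
Unset Strict Implicit.
Unset Printing Implicit Defensive.

Import Order.TTheory GRing.Theory Num.Theory.
Import numFieldNormedType.Exports.

Local Open Scope classical_set_scope.
Local Open Scope ring_scope.
Local Open Scope complex_scope.

(* Coordinates are indexed by 'I_3, i.e. by Z/3, so that                      *)
(* (u x v)_j = u_(j+1) v_(j+2) - u_(j+2) v_(j+1) for every j.                 *)
Section VectorAlgebra.
Variable A : comNzRingType.
Implicit Types u v : 'rV[A]_3.

Definition dotv u v : A := \sum_j u 0 j * v 0 j.

Definition crossv u v : 'rV[A]_3 :=
  \row_j (u 0 (j + 1) * v 0 (j + 2) - u 0 (j + 2) * v 0 (j + 1)).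

End VectorAlgebra.

(* `|u| is the maximum norm on 'rV[R]_3. *)
Definition enorm (R : realType) (u : 'rV[R]_3) : R := Num.sqrt (dotv u u).

Definition toC (R : realType) (u : 'rV[R]_3) : 'rV[R[i]]_3 :=
  map_mx (real_complex R) u.

Definition conjv (R : realType) (u : 'rV[R[i]]_3) : 'rV[R[i]]_3 :=
  map_mx (fun z => z^*%C) u.

Section Simplices.
Variables (R : realType) (I : finType) (v : I -> 'rV[R]_3).
Implicit Type A : {set I}.

Definition hull A : set 'rV[R]_3 :=
  [set x | exists2 w : I -> R,
     (forall i, 0 <= w i) /\ \sum_(i in A) w i = 1 &
     x = \sum_(i in A) w i *: v i].

(* the relative interior of [hull A] *)
Definition open_hull A : set 'rV[R]_3 :=
  [set x | exists2 w : I -> R,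
     (forall i, 0 < w i) /\ \sum_(i in A) w i = 1 &
     x = \sum_(i in A) w i *: v i].

Definition affinely_independent A : Prop :=
  forall w : I -> R, \sum_(i in A) w i = 0 -> \sum_(i in A) w i *: v i = 0 ->
    forall i, i \in A -> w i = 0.

End Simplices.

Section Domains.
Variable R : realType.
Implicit Types Omega Gamma X : set 'rV[R]_3.

Definition frontier X : set 'rV[R]_3 := closure X `\` interior X.

(* a finite union of nondegenerate planar triangles *)
Definition polytopal_surface X : Prop :=
  exists s : seq ('I_3 -> 'rV[R]_3),
    (forall t, t \in s -> affinely_independent t [set: 'I_3]%SET) /\
    X = \bigcup_(t in [set` s]) hull t [set: 'I_3]%SET.

Record polyhedral_domain Omega : Prop := PolyhedralDomain {
  domain_open : open Omega;
  domain_connected : connected Omega;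
  domain_neq0 : Omega !=set0;
  domain_polyhedral : polytopal_surface (frontier Omega) }.

Definition bilipschitz_on X (psi : 'rV[R]_3 -> 'rV[R]_2) : Prop :=
  exists2 M : R, 0 < M & forall x y, X x -> X y ->
    `|psi x - psi y| <= M * `|x - y| /\ `|x - y| <= M * `|psi x - psi y|.

(* Near each point of the edge of Gamma relative to the surface Sigma, a      *)
(* bi-Lipschitz chart of Sigma flattens Gamma to a half-plane.                *)
Definition lipschitz_subset Sigma Gamma : Prop :=
  forall x, closure Gamma x -> closure (Sigma `\` Gamma) x ->
  exists (V : set 'rV[R]_3) (psi : 'rV[R]_3 -> 'rV[R]_2),
    [/\ open V /\ V x, bilipschitz_on (Sigma `&` V) psi,
        open (psi @` (Sigma `&` V)) &
        closure Gamma `&` V = [set y | (Sigma `&` V) y /\ psi y 0 1 <= 0]].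

Record boundary_partition Omega GammaE GammaH GammaI : Prop :=
  BoundaryPartition {
  partition_cover : frontier Omega = GammaE `|` GammaH `|` GammaI;
  partition_disjEH : GammaE `&` GammaH = set0;
  partition_disjEI : GammaE `&` GammaI = set0;
  partition_disjHI : GammaH `&` GammaI = set0;
  (* The three sets being disjoint, at most one of them contains a given      *)
  (* interface edge, so only their closures are unions of triangles.          *)
  partition_polytopal : forall Gamma,
    [\/ Gamma = GammaE, Gamma = GammaH | Gamma = GammaI] ->
    polytopal_surface (closure Gamma) /\
    lipschitz_subset (frontier Omega) Gamma }.

End Domains.

(* An element is identified with the set of its four vertices, a face with    *)
(* the set of its three vertices.                                             *)
Definition faces n (K : {set 'I_n}) : {set {set 'I_n}} :=
  [set F : {set 'I_n} | (F \subset K) && (#|F| == 3%N)]%SET.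

Record conforming_mesh (R : realType) (Omega : set 'rV[R]_3) n
    (v : 'I_n -> 'rV[R]_3) (Th : {set {set 'I_n}}) : Prop := ConformingMesh {
  mesh_card : forall K, K \in Th -> #|K| = 4%N;
  mesh_nondegenerate : forall K, K \in Th -> affinely_independent v K;
  mesh_cover : closure Omega = \bigcup_(K in [set` Th]) hull v K;
  mesh_conforming : forall K K', K \in Th -> K' \in Th ->
    hull v K `&` hull v K' = hull v (K :&: K')%SET;
  mesh_interior_face : forall K F, K \in Th -> F \in faces K ->
    ~ (hull v F `<=` frontier Omega) ->
    #|[set K' in Th | F \in faces K']%SET| = 2%N;
  mesh_boundary_face : forall K F, K \in Th -> F \in faces K ->
    hull v F `<=` frontier Omega ->
    #|[set K' in Th | F \in faces K']%SET| = 1%N }.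

(* Closed neighbouring faces share an edge, hence the relative interiors. *)
Definition faces_fit (R : realType) (Omega GammaE GammaH GammaI : set 'rV[R]_3)
    n (v : 'I_n -> 'rV[R]_3) (Th : {set {set 'I_n}}) : Prop :=
  forall K F, K \in Th -> F \in faces K -> hull v F `<=` frontier Omega ->
    [\/ open_hull v F `<=` GammaE, open_hull v F `<=` GammaH
      | open_hull v F `<=` GammaI].

Definition Cintegral d (T : measurableType d) (R : realType)
    (mu : {measure set T -> \bar R}) (D : set T) (f : T -> R[i]) : R[i] :=
  (\int[mu]_(x in D) complex.Re (f x)) +i*
  (\int[mu]_(x in D) complex.Im (f x)).

Definition point3 (R : realType) (t : R * R * R) : 'rV[R]_3 :=
  \row_j [:: t.1.1; t.1.2; t.2]`_j.

Section Polynomials.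
Variables (R : realType) (p : nat).
Let C := R[i].

(* msize is the total degree plus one, and 0 for the zero polynomial. *)
Definition Pp : set 'rV[mpoly.mpoly 3 C]_3 :=
  [set q | forall j, (mpoly.msize (q ord0 j) <= p.+1)%N].

Definition peval (q : 'rV[mpoly.mpoly 3 C]_3) (x : 'rV[R]_3) : 'rV[C]_3 :=
  map_mx (mpoly.meval (fun i => toC x 0 i)) q.

Definition curl (q : 'rV[mpoly.mpoly 3 C]_3) : 'rV[mpoly.mpoly 3 C]_3 :=
  \row_j (mpoly.mderiv (j + 1) (q 0 (j + 2))
        - mpoly.mderiv (j + 2) (q 0 (j + 1))).

(* - n x (n x u) *)
Definition tcomp (n : 'rV[R]_3) (u : 'rV[C]_3) : 'rV[C]_3 :=
  - crossv (toC n) (crossv (toC n) u).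

End Polynomials.

Section Discretization.
Variables (R : realType) (kappa : R) (p : nat).
Variables (Omega GammaE GammaH GammaI : set 'rV[R]_3).
Variables (n : nat) (v : 'I_n -> 'rV[R]_3) (Th : {set {set 'I_n}}).
Let C := R[i].
Let poly3 := 'rV[mpoly.mpoly 3 C]_3.
Let vfield := 'rV[R]_3 -> 'rV[C]_3.
Implicit Types (K F : {set 'I_n}) (q e h : poly3) (f : vfield).

Definition fvertex F k : 'rV[R]_3 := nth 0 [seq v i | i <- enum F] k.
Definition fedge F k : 'rV[R]_3 := fvertex F k - fvertex F 0.
Definition face_cross F : 'rV[R]_3 := crossv (fedge F 1) (fedge F 2).
Definition unit_normal F : 'rV[R]_3 :=
  (enorm (face_cross F))^-1 *: face_cross F.

(* The vertex of K opposite to F lies on the negative side of the normal. *)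
Definition outward_normal K F : 'rV[R]_3 :=
  if [exists i in (K :\: F)%SET, 0 < dotv (unit_normal F) (v i - fvertex F 0)]
  then - unit_normal F else unit_normal F.

Definition innerK K (f g : vfield) : C :=
  Cintegral (lebesgue_measure \x lebesgue_measure \x lebesgue_measure)%E
    [set t : R * R * R | hull v K (point3 t)]
    (fun t => dotv (f (point3 t)) (conjv (g (point3 t)))).

(* Surface integral through the affine parametrization                        *)
(* (s, t) |-> a + s (b - a) + t (c - a) of the triangle F = abc, whose area   *)
(* element is |(b - a) x (c - a)| ds dt.                                      *)
Definition fparam F (s : R * R) : 'rV[R]_3 :=
  fvertex F 0 + s.1 *: fedge F 1 + s.2 *: fedge F 2.

Definition innerF F (f g : vfield) : C :=
  (enorm (face_cross F))%:C *
  Cintegral (lebesgue_measure \x lebesgue_measure)%E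
    [set s : R * R | [/\ 0 <= s.1, 0 <= s.2 & s.1 + s.2 <= 1]]
    (fun s => dotv (f (fparam F s)) (conjv (g (fparam F s)))).

(* Functions on F are extended by 0 outside F. *)
Definition Ppt F : set vfield :=
  [set g | (exists2 q : poly3, Pp p q &
              g = patch (fun=> 0) (hull v F) (peval q)) /\
           forall x, hull v F x -> dotv (toC (unit_normal F)) (g x) = 0].

(* The components with indices other than an element and one of its faces     *)
(* are set to 0, so that equality of functions is equality in the product     *)
(* of the spaces Ppt F.                                                       *)
Definition skeleton : set ({set 'I_n} -> {set 'I_n} -> vfield) :=
  [set g | forall K F, if (K \in Th) && (F \in faces K)
                       then Ppt F (g K F) else g K F = 0].

Definition skeleton_norm (g : {set 'I_n} -> {set 'I_n} -> vfield) : R :=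
  Num.sqrt (complex.Re
    (\sum_(K in Th) \sum_(F in faces K) innerF F (g K F) (g K F))).

Definition ttrace K F f : vfield :=
  fun x => crossv (toC (outward_normal K F)) (f x).
Definition tctrace K F f : vfield :=
  fun x => tcomp (outward_normal K F) (f x).

Definition gplus K F e h : vfield :=
  fun x => tctrace K F (peval e) x - ttrace K F (peval h) x.

Definition halved f : vfield := fun x => 2^-1 *: f x.

Definition local_solution K (gm : {set 'I_n} -> vfield) e h : Prop :=
  [/\ Pp p e, Pp p h &
  forall q r : poly3, Pp p q -> Pp p r ->
    'i%C * kappa%:C * innerK K (peval e) (peval q)
      - innerK K (peval h) (peval (curl q))
      + \sum_(F in faces K)
          innerF F (halved (gplus K F e h)) (tctrace K F (peval q))
      = \sum_(F in faces K) innerF F (halved (gm F)) (tctrace K F (peval q))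
    /\
    'i%C * kappa%:C * innerK K (peval h) (peval r)
      + innerK K (peval e) (peval (curl r))
      + \sum_(F in faces K)
          innerF F (halved (ttrace K F (gplus K F e h))) (tctrace K F (peval r))
      = - \sum_(F in faces K)
          innerF F (halved (ttrace K F (gm F))) (tctrace K F (peval r))].

(* the solution of the local problem (it exists and is unique) *)
Definition solution K (gm : {set 'I_n} -> vfield) : poly3 * poly3 :=
  xget (0, 0) [set eh | local_solution K gm eh.1 eh.2].

Definition scattering (g : {set 'I_n} -> {set 'I_n} -> vfield) :
    {set 'I_n} -> {set 'I_n} -> vfield := fun K F =>
  if (K \in Th) && (F \in faces K) then
    let: (e, h) := solution K (g K) in
    patch (fun=> 0) (hull v F) (gplus K F e h)
  else 0.

Definition neighbour K F : option {set 'I_n} :=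
  [pick K' in Th | (K' != K) && (F \in faces K')].

Definition exchange (g : {set 'I_n} -> {set 'I_n} -> vfield) :
    {set 'I_n} -> {set 'I_n} -> vfield := fun K F =>
  if (K \in Th) && (F \in faces K) then
    if ~~ `[< hull v F `<=` frontier Omega >] then
      if neighbour K F is Some K' then g K' F else 0
    else if `[< open_hull v F `<=` GammaE >] then - g K F
    else if `[< open_hull v F `<=` GammaH >] then g K F
    else 0
  else 0.

Lemma peval_crossv (a b : poly3) (x : 'rV[R]_3) :
  peval (crossv a b) x = crossv (peval a x) (peval b x).
Proof. by apply/rowP => j; rewrite !mxE mpoly.mevalB !mpoly.mevalM. Qed.

Lemma pevalN (a : poly3) (x : 'rV[R]_3) : peval (- a) x = - peval a x.
Proof. by apply/rowP => j; rewrite !mxE mpoly.mevalN. Qed.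

Lemma pevalB (a b : poly3) (x : 'rV[R]_3) :
  peval (a - b) x = peval a x - peval b x.
Proof. by apply/rowP => j; rewrite !mxE mpoly.mevalB. Qed.

Lemma dotv_crossv (a b : 'rV[C]_3) : dotv a (crossv a b) = 0.
Proof.
rewrite /dotv !big_ord_recl big_ord0 !mxE.
have E0 : (0 + 1 : 'I_3) = lift 0 0 by exact/val_inj.
have E1 : (0 + 2 : 'I_3) = lift 0 (lift 0 0) by exact/val_inj.
have E2 : (lift 0 0 + 1 : 'I_3) = lift 0 (lift 0 0) by exact/val_inj.
have E3 : (lift 0 0 + 2 : 'I_3) = 0 by exact/val_inj.
have E4 : (lift 0 (lift 0 0) + 1 : 'I_3) = 0 by exact/val_inj.
have E5 : (lift 0 (lift 0 0) + 2 : 'I_3) = lift 0 0 by exact/val_inj.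
rewrite E0 E1 E2 E3 E4 E5; ring.
Qed.

Lemma dotvN (a b : 'rV[C]_3) : dotv a (- b) = - dotv a b.
Proof. by rewrite /dotv -sumrN; apply: eq_bigr => j _; rewrite mxE mulrN. Qed.

Lemma dotNv (a b : 'rV[C]_3) : dotv (- a) b = - dotv a b.
Proof. by rewrite /dotv -sumrN; apply: eq_bigr => j _; rewrite mxE mulNr. Qed.

Lemma dotvB (a b c : 'rV[C]_3) : dotv a (b - c) = dotv a b - dotv a c.
Proof.
by rewrite /dotv -sumrB; apply: eq_bigr => j _; rewrite !mxE mulrDr mulrN.
Qed.

Lemma PpN q : Pp p q -> Pp p (- q).
Proof. by move=> qP j; rewrite mxE mpoly.mmeasureN; exact: qP. Qed.

Lemma PpD e h : Pp p e -> Pp p h -> Pp p (e + h).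
Proof.
move=> eP hP j; rewrite mxE; apply: leq_trans (mpoly.mmeasureD_le _ _ _) _.
by rewrite geq_max eP hP.
Qed.

Let nP (u : 'rV[R]_3) : poly3 := map_mx (@mpoly.mpolyC 3 C) (toC u).

Lemma Pp_crossv (u : 'rV[R]_3) q : Pp p q -> Pp p (crossv (nP u) q).
Proof.
move=> qP j; rewrite !mxE !mpoly.mul_mpolyC.
apply: leq_trans (mpoly.mmeasureD_le _ _ _) _.
rewrite mpoly.mmeasureN geq_max; apply/andP; split;
  exact: leq_trans (mpoly.mmeasureZ_le _ _ _) (qP _).
Qed.

Lemma outward_normal_pm K F :
  outward_normal K F = - unit_normal F \/
  outward_normal K F = unit_normal F.
Proof. by rewrite /outward_normal; case: ifP => _; [left|right]. Qed.

Lemma Ppt_gplus K F e h : Pp p e -> Pp p h ->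
  Ppt F (patch (fun=> 0) (hull v F) (gplus K F e h)).
Proof.
move=> eP hP; set m := outward_normal K F.
split.
- exists (- crossv (nP m) (crossv (nP m) e) - crossv (nP m) h).
    by apply/PpD/PpN/Pp_crossv => //; apply/PpN/Pp_crossv/Pp_crossv.
  congr patch; apply/funext => x; rewrite /gplus /tctrace /ttrace /tcomp -/m.
  have E : peval (nP m) x = toC m.
    by apply/rowP => j; rewrite !mxE mpoly.mevalC.
  by rewrite pevalB pevalN !peval_crossv E.
- move=> x Fx; rewrite patchT ?inE// /gplus /tctrace /ttrace /tcomp -/m.
  have dm : dotv (toC m) (- crossv (toC m) (crossv (toC m) (peval e x))
                          - crossv (toC m) (peval h x)) = 0.
    by rewrite dotvB dotvN !dotv_crossv oppr0 addr0.
  case: (outward_normal_pm K F) => mE; move: dm; rewrite -/m in mE.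
    move=> dm; have -> : unit_normal F = - m by rewrite mE opprK.
    have -> : toC (- m) = - toC m.
      by apply/rowP => j; rewrite !mxE rmorphN.
    by rewrite dotNv dm oppr0.
  by rewrite -mE.
Qed.

Lemma Ppt0 F : Ppt F 0.
Proof.
split; last first.
  move=> x _; rewrite -[(0 : vfield) x]/(0 : 'rV[C]_3).
  by rewrite -(subrr (0 : 'rV[C]_3)) dotvB subrr.
exists 0; first by move=> j; rewrite mxE mpoly.mmeasure0.
apply/funext => x; rewrite /patch; case: ifP => // _.
by apply/rowP => j; rewrite !mxE mpoly.meval0.
Qed.

Lemma PptN F g : Ppt F g -> Ppt F (- g).
Proof.
move=> [[q qP ->] gt]; split.
  exists (- q); first exact: PpN.
  apply/funext => x; rewrite fctE /patch; case: ifP => _; last exact: oppr0.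
  exact/esym/pevalN.
by move=> x /gt; rewrite fctE dotvN => ->; rewrite oppr0.
Qed.

Lemma skeleton_scattering g : skeleton g -> skeleton (scattering g).
Proof.
move=> _ K F; rewrite /scattering.
case KF: ((K \in Th) && (F \in faces K)) => //.
case E : (solution K (g K)) => [e h].
have [eP hP] : Pp p e /\ Pp p h.
  move: E; rewrite /solution.
  case: xgetP => [[e' h'] _ [? ? _] [<- <-] //|_ [<- <-]].
  by split => j; rewrite mxE mpoly.mmeasure0.
exact: Ppt_gplus.
Qed.

Lemma skeleton_exchange g : skeleton g -> skeleton (exchange g).
Proof.
move=> gP K F; rewrite /exchange.
case KF: ((K \in Th) && (F \in faces K)) => //.
have gKF : Ppt F (g K F) by have := gP K F; rewrite KF.
case: ifP => _.
  rewrite /neighbour; case: pickP => [K' /and3P[K'T _ FK']|_]; last exact: Ppt0.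
  by have := gP K' F; rewrite K'T FK'.
by case: ifP => _; [exact: PptN | case: ifP => _ //; exact: Ppt0].
Qed.

End Discretization.

(* Main.v *)
Require Import Defs.
From HB Require Import structures.
From mathcomp Require Import all_boot all_order all_algebra.
From mathcomp Require Import all_classical all_reals all_analysis measurable_realfun.
From mathcomp Require Import complex ring lra fingroup perm.
From mathcomp Require Import (canonicals, coercions) mpoly.

(** Already the scattering operator is a strict contraction, element by
    element, and the exchange operator is non-expansive.

    On an element K with data g, let (e, h) be the solution of the local
    problem, g+ = pi(e) - n x h its scattered trace and g' = pi(e) + n x h the
    other characteristic variable on the faces.  Testing the local problem with
    (e, h), taking real parts and inserting Green's formula for the curl gives
    the energy identity
      sum_F |g|^2 = sum_F |g+|^2 + sum_F |g - g'|^2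
    ([energy_identity], which integrates the pointwise identity
    [pointwise_energy]).  Hence |g+| <= |g|, and in case of equality g = g' on
    all faces.  Then the face terms of the weak form are exactly those of
    Green's formula, so that e and h satisfy i kappa e = curl h and
    i kappa h = - curl e as polynomials ([local_solution_eq0]).  A curl lowers
    the degree, so e = h = 0 ([curl_system_eq0]) and g = g' = 0.

    The exchange operator swaps the two components of an interior face and
    negates, keeps or erases the component of a boundary face, so it does not
    increase the norm ([exchange_nonexpansive]).

    The integrals need a concrete basis.  The derivative of a polynomial along
    an edge of the reference tetrahedron is integrated with Fubini's theorem
    and the fundamental theorem of calculus ([tetra_integral_deriv]); an affine
    change of variables carries this to any tetrahedron ([scales_linear],
    [simplex_integral_edge]), and Cramer's rule turns the three edge directions
    into coordinate directions, which is the divergence theorem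
    ([simplex_integral_deriv], [divergence]) and then Green's formula
    ([green]).  Definiteness comes from continuity ([face_integral_eq0],
    [element_integral_eq0]) and from the fact that a polynomial vanishing on a
    tetrahedron is zero ([pval_eq0]). *)

Set Implicit Arguments.
Unset Strict Implicit.
Unset Printing Implicit Defensive.

Import Order.TTheory GRing.Theory Num.Theory.
Import numFieldNormedType.Exports.

Local Open Scope classical_set_scope.
Local Open Scope ring_scope.

(** * Measures and maps that scale them *)

Section ProductSigmaFinite.
Context d1 d2 (X : measurableType d1) (Y : measurableType d2) (R : realType).
Variable m1 : {sigma_finite_measure set X -> \bar R}.
Variable m2 : {sigma_finite_measure set Y -> \bar R}.

Lemma sigma_finite_product_measure : sigma_finite setT (m1 \x m2)%E.
Proof.
have /sigma_finiteP[F [FT Fnd Ffin]] := sigma_finiteT m1.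
have /sigma_finiteP[G [GT Gnd Gfin]] := sigma_finiteT m2.
exists (fun n => F n `*` G n).
  apply/esym; rewrite -subTset => -[x y] _.
  have [i _ Fi] : (\bigcup_n F n) x by rewrite -FT.
  have [j _ Gj] : (\bigcup_n G n) y by rewrite -GT.
  exists (maxn i j) => //; split => /=.
    by move: Fi; apply/subsetPset/Fnd/leq_maxl.
  by move: Gj; apply/subsetPset/Gnd/leq_maxr.
move=> n; have [mF Foo] := Ffin n; have [mG Goo] := Gfin n.
split; first exact: measurableX.
rewrite product_measure1E//.
by rewrite lte_mul_pinfty// ge0_fin_numE.
Qed.

End ProductSigmaFinite.

(** The measures of the integrals over faces and elements under names of their
    own, to which the instances of sigma-finite measures can be attached. *)
Definition plane_measure (R : realType) :
    set (measurableTypeR R * measurableTypeR R) -> \bar R :=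
  (@lebesgue_measure R \x @lebesgue_measure R)%E.
HB.instance Definition _ (R : realType) := Measure.on (@plane_measure R).
HB.instance Definition _ (R : realType) :=
  Measure_isSigmaFinite.Build _ _ _ (@plane_measure R)
    (@sigma_finite_product_measure _ _ _ _ R lebesgue_measure lebesgue_measure).

Definition space_measure (R : realType) :
    set (measurableTypeR R * measurableTypeR R * measurableTypeR R) -> \bar R :=
  (@plane_measure R \x @lebesgue_measure R)%E.
HB.instance Definition _ (R : realType) := Measure.on (@space_measure R).

Section ScalingMaps.
Variable R : realType.

(** The image of mu under T is c mu. Composition multiplies the factors, so that
    linear maps can be treated one coordinate at a time. *)
Definition scales d (X : measurableType d) (mu : set X -> \bar R)
    (T : X -> X) (c : R) :=
  measurable_fun setT T /\
  forall B, measurable B -> mu (T @^-1` B) = (c%:E * mu B)%E.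

Lemma scales_comp d (X : measurableType d) (mu : set X -> \bar R)
    (S T : X -> X) (a b : R) :
  scales mu S a -> scales mu T b -> scales mu (S \o T) (a * b).
Proof.
move=> [mS hS] [mT hT]; split; first exact: measurableT_comp.
move=> B mB; rewrite comp_preimage hT; last first.
  by rewrite -[X in measurable X]setTI; exact: mS.
by rewrite hS// EFinM muleA (muleC a%:E).
Qed.

(** The measure |a| mu(T^-1 B) agrees with the Lebesgue measure mu on intervals,
    hence everywhere. *)
Lemma scales_affine (a b : R) : a != 0 ->
  scales (@lebesgue_measure R) (fun x => a * x + b) `|a|^-1.
Proof.
move=> a0; set T := fun x : R => _.
have mT : measurable_fun [set: measurableTypeR R] (T : _ -> measurableTypeR R).
  by apply: measurable_funD => //; exact: measurable_funM.
split=> // B mB.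
have a1 : 0 < `|a| by rewrite normr_gt0.
have [m mE] : exists m : {measure set (measurableTypeR R) -> \bar R},
    forall X, m X = (`|a|%:E * lebesgue_measure (T @^-1` X))%E.
  pose push :=
    measure_function_pushforward__canonical__measure_function_Measure
      (@lebesgue_measure R) mT.
  by exists (mscale (NngNum (ltW a1)) push).
suff -> : lebesgue_measure B = m B.
  rewrite mE.
  by rewrite muleA -EFinM mulVf ?mul1e// gt_eqF.
apply: lebesgue_measure_unique => // _ [[u v] _ <-].
rewrite mE.
have [a_gt0|a_lt0|/eqP] := ltgtP a 0; last by rewrite (negbTE a0).
- rewrite (_ : T @^-1` _ = `[(v - b) / a, (u - b) / a[%classic); last first.
    apply/seteqP; split=> x; rewrite /= !in_itv/= /T.
      by rewrite ler_ndivrMr// ltr_ndivlMr//; lra.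
    by rewrite ler_ndivrMr// ltr_ndivlMr//; lra.
  rewrite !lebesgue_measure_itv/= !lte_fin.
  rewrite ltr_ndivrMr// divfK// ltrD2r ltr0_norm//; case: ifP => _.
    by rewrite -EFinB -EFinB -EFinM; congr EFin; field.
  by rewrite mule0.
- rewrite (_ : T @^-1` _ = `](u - b) / a, (v - b) / a]%classic); last first.
    apply/seteqP; split=> x; rewrite /= !in_itv/= /T.
      by rewrite ltr_pdivrMr// ler_pdivlMr//; lra.
    by rewrite ltr_pdivrMr// ler_pdivlMr//; lra.
  rewrite !lebesgue_measure_itv/= !lte_fin.
  rewrite ltr_pdivrMr// divfK// ltrD2r gtr0_norm//; case: ifP => _.
    by rewrite -EFinB -EFinB -EFinM; congr EFin; field.
  by rewrite mule0.
Qed.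

Section Sections.
Context d1 d2 (X : measurableType d1) (Y : measurableType d2).
Variable m1 : {sigma_finite_measure set X -> \bar R}.
Variable m2 : {sigma_finite_measure set Y -> \bar R}.

(** Tonelli's theorem: all sections of the measured set are scaled by c. *)
Lemma scales_xsection (tau : X -> Y -> Y) (c : R) : 0 <= c ->
  measurable_fun setT (fun p : X * Y => tau p.1 p.2) ->
  (forall x, scales m2 (tau x) c) ->
  scales (m1 \x m2)%E (fun p => (p.1, tau p.1 p.2)) c.
Proof.
move=> c0 mtau htau; split; first exact/measurable_fun_pair.
move=> B mB; rewrite /product_measure1 -ge0_integralZl//.
- apply: eq_integral => x _ /=; rewrite -(htau x).2; last exact: measurable_xsection.
  congr (m2 _); apply/seteqP; split=> y; rewrite /xsection /= !inE //.
- exact: measurable_fun_xsection.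
Qed.

Lemma product_measure12 (B : set (X * Y)) : measurable B ->
  (m1 \x m2)%E B = (m1 \x^ m2)%E B.
Proof.
by move=> mB; apply: product_measure_unique => //= *; rewrite product_measure2E.
Qed.

Lemma scales_ysection (tau : Y -> X -> X) (c : R) : 0 <= c ->
  measurable_fun setT (fun p : X * Y => tau p.2 p.1) ->
  (forall y, scales m1 (tau y) c) ->
  scales (m1 \x m2)%E (fun p => (tau p.2 p.1, p.2)) c.
Proof.
move=> c0 mtau htau.
have mT : measurable_fun setT (fun p : X * Y => (tau p.2 p.1, p.2)).
  exact/measurable_fun_pair.
split=> // B mB; rewrite !product_measure12//; last first.
  by rewrite -[X in measurable X]setTI; exact: mT.
rewrite /product_measure2 -ge0_integralZl//.
- apply: eq_integral => y _ /=; rewrite -(htau y).2; last exact: measurable_ysection.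
  congr (m1 _); apply/seteqP; split=> x; rewrite /ysection /= !inE //.
- exact: measurable_fun_ysection.
Qed.

End Sections.
End ScalingMaps.

(** * Linear change of variables in space *)

Lemma sum3 (V : nmodType) (F : 'I_3 -> V) : \sum_i F i = F 0 + F 1 + F 2.
Proof.
by rewrite !big_ord_recl big_ord0 addr0 addrA; congr (_ + F _ + F _); exact/val_inj.
Qed.

Lemma prod3 (A : comNzRingType) (F : 'I_3 -> A) : \prod_i F i = F 0 * F 1 * F 2.
Proof.
by rewrite !big_ord_recl big_ord0 mulr1 mulrA; congr (_ * F _ * F _); exact/val_inj.
Qed.

Lemma forall3 (P : 'I_3 -> Prop) : P 0 -> P 1 -> P 2 -> forall i, P i.
Proof.
move=> p0 p1 p2 [[|[|[|//]]] lt3];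
  [move: p0|move: p1|move: p2]; congr P; exact/val_inj.
Qed.

Section LinearChangeOfVariables.
Variable R : realType.
Implicit Types (M N : 'M[R]_3) (t : R * R * R).

Notation Rm := (measurableTypeR R).
Notation leb := (@lebesgue_measure R).
Notation leb3 := (@space_measure R).

(** The map t |-> t *m M, on triples of coordinates because these carry the
    product measure. *)
Definition lin3 M t : R * R * R :=
  (t.1.1 * M 0 0 + t.1.2 * M 1 0 + t.2 * M 2 0,
   t.1.1 * M 0 1 + t.1.2 * M 1 1 + t.2 * M 2 1,
   t.1.1 * M 0 2 + t.1.2 * M 1 2 + t.2 * M 2 2).

Lemma lin3M M N : lin3 (M *m N) = lin3 N \o lin3 M.
Proof.
by apply/funext => -[[x y] z]; rewrite /lin3 /= !mxE !sum3; congr (_, _, _); ring.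
Qed.

Let scale_z (c : R) (g : Rm * Rm -> Rm) : c != 0 -> measurable_fun setT g ->
  scales leb3 (fun t : Rm * Rm * Rm => (t.1, c * t.2 + g t.1)) `|c|^-1.
Proof.
move=> c0 mg; apply: (@scales_xsection R _ _ (Rm * Rm)%type Rm (@plane_measure R) leb
  (fun p z => c * z + g p)).
- by rewrite invr_ge0.
- apply: measurable_funD; last exact: measurableT_comp.
  exact: measurable_funM.
- by move=> p; exact: scales_affine.
Qed.

Let scale_y (c : R) (g : Rm * Rm -> Rm) : c != 0 -> measurable_fun setT g ->
  scales leb3 (fun t : Rm * Rm * Rm =>
    (t.1.1, c * t.1.2 + g (t.1.1, t.2), t.2)) `|c|^-1.
Proof.
move=> c0 mg; apply: (@scales_ysection R _ _ (Rm * Rm)%type Rm (@plane_measure R) leb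
  (fun z (p : Rm * Rm) => (p.1, c * p.2 + g (p.1, z)))).
- by rewrite invr_ge0.
- apply: measurable_fun_pair; first exact: measurableT_comp.
  apply: measurable_funD.
    by apply: measurable_funM => //; exact: measurableT_comp.
  apply: measurableT_comp => //; apply: measurable_fun_pair => //.
  exact: measurableT_comp.
- move=> z; apply: (@scales_xsection R _ _ Rm Rm leb leb (fun x y => c * y + g (x, z))).
  + by rewrite invr_ge0.
  + apply: measurable_funD; first exact: measurable_funM.
    apply: measurableT_comp => //; exact: measurable_fun_pair.
  + by move=> x; exact: scales_affine.
Qed.

Let scale_x (c : R) (g : Rm * Rm -> Rm) : c != 0 -> measurable_fun setT g ->
  scales leb3 (fun t : Rm * Rm * Rm =>
    (c * t.1.1 + g (t.1.2, t.2), t.1.2, t.2)) `|c|^-1.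
Proof.
move=> c0 mg; apply: (@scales_ysection R _ _ (Rm * Rm)%type Rm (@plane_measure R) leb
  (fun z (p : Rm * Rm) => (c * p.1 + g (p.2, z), p.2))).
- by rewrite invr_ge0.
- apply: measurable_fun_pair; last exact: measurableT_comp.
  apply: measurable_funD.
    by apply: measurable_funM => //; exact: measurableT_comp.
  apply: measurableT_comp => //; apply: measurable_fun_pair => //.
  exact: measurableT_comp.
- move=> z; apply: (@scales_ysection R _ _ Rm Rm leb leb (fun y x => c * x + g (y, z))).
  + by rewrite invr_ge0.
  + apply: measurable_funD; first exact: measurable_funM.
    apply: measurableT_comp => //; exact: measurable_fun_pair.
  + by move=> x; exact: scales_affine.
Qed.

Let mlin (a b : R) : measurable_fun setT (fun p : Rm * Rm => a * p.1 + b * p.2).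
Proof. by apply: measurable_funD; apply: measurable_funM. Qed.

Let scales_ext (S T : Rm * Rm * Rm -> Rm * Rm * Rm) (a b : R) :
  scales leb3 S a -> S =1 T -> a = b -> scales leb3 T b.
Proof. by move=> + /funext <- <-. Qed.

Lemma scales_lower M : (forall i j : 'I_3, (i < j)%N -> M i j = 0) ->
  \det M != 0 -> scales leb3 (lin3 M) `|\det M|^-1.
Proof.
move=> Ml; rewrite det_trig; last exact/is_trig_mxP.
rewrite prod3 !mulf_eq0 !negb_or -andbA => /and3P[d0 d1 d2].
apply: (scales_ext (scales_comp (scale_z d2 (mlin 0 0))
  (scales_comp (scale_y d1 (mlin 0 (M 2 1)))
    (scale_x d0 (mlin (M 1 0) (M 2 0)))))).
  move=> [[x y] z]; rewrite /lin3 /= (Ml 0 1)// (Ml 0 2)// (Ml 1 2)//.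
  by congr (_, _, _); ring.
by rewrite !normrM !invfM; ring.
Qed.

Lemma scales_upper M : (forall i j : 'I_3, (j < i)%N -> M i j = 0) ->
  \det M != 0 -> scales leb3 (lin3 M) `|\det M|^-1.
Proof.
move=> Mu; rewrite -det_tr det_trig; last first.
  by apply/is_trig_mxP => i j ij; rewrite mxE Mu.
rewrite prod3 !mxE !mulf_eq0 !negb_or -andbA => /and3P[d0 d1 d2].
apply: (scales_ext (scales_comp (scale_x d0 (mlin 0 0))
  (scales_comp (scale_y d1 (mlin (M 0 1) 0))
    (scale_z d2 (mlin (M 0 2) (M 1 2)))))).
  move=> [[x y] z]; rewrite /lin3 /= (Mu 1 0)// (Mu 2 0)// (Mu 2 1)//.
  by congr (_, _, _); ring.
by rewrite !normrM !invfM; ring.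
Qed.

Let scalesM M N :
  scales leb3 (lin3 M) `|\det M|^-1 -> scales leb3 (lin3 N) `|\det N|^-1 ->
  scales leb3 (lin3 (M *m N)) `|\det (M *m N)|^-1.
Proof.
move=> hM hN; rewrite lin3M.
apply: (scales_ext (scales_comp hN hM)) => //.
by rewrite det_mulmx normrM invfM mulrC.
Qed.

Let scales_tperm_aux (i j : 'I_3) : (i < j)%N ->
  scales leb3 (lin3 (tperm_mx i j)) 1.
Proof.
(* The swap of x and y is (x + y, y), then (x, x - y), then (x - y, y), and each
   of these maps moves one coordinate. *)
have N1 : -1 != 0 :> R by rewrite oppr_eq0 oner_eq0.
have O1 : 1 != 0 :> R by rewrite oner_eq0.
move: i j; apply: forall3; apply: forall3 => // _.
- apply: (scales_ext (scales_comp (scale_x O1 (mlin (-1) 0))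
    (scales_comp (scale_y N1 (mlin 1 0)) (scale_x O1 (mlin 1 0))))).
    move=> [[x y] z]; rewrite /lin3 /= !mxE !permE /=.
    by congr (_, _, _); ring.
  by rewrite normrN !normr1 invr1 !mulr1.
- apply: (scales_ext (scales_comp (scale_x O1 (mlin 0 (-1)))
    (scales_comp (scale_z N1 (mlin 1 0)) (scale_x O1 (mlin 0 1))))).
    move=> [[x y] z]; rewrite /lin3 /= !mxE !permE /=.
    by congr (_, _, _); ring.
  by rewrite normrN !normr1 invr1 !mulr1.
- apply: (scales_ext (scales_comp (scale_y O1 (mlin 0 (-1)))
    (scales_comp (scale_z N1 (mlin 0 1)) (scale_y O1 (mlin 0 1))))).
    move=> [[x y] z]; rewrite /lin3 /= !mxE !permE /=.
    by congr (_, _, _); ring.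
  by rewrite normrN !normr1 invr1 !mulr1.
Qed.

Let scales_tperm (i j : 'I_3) : scales leb3 (lin3 (tperm_mx i j)) 1.
Proof.
have [ij|ji|/val_inj ->] := ltngtP i j; first exact: scales_tperm_aux.
  by rewrite /tperm_mx tpermC; exact: scales_tperm_aux.
rewrite /tperm_mx tperm1 perm_mx1.
apply: (scales_ext (scale_z (oner_neq0 R) (mlin 0 0))).
  by move=> [[x y] z]; rewrite /lin3 /= !mxE /=; congr (_, _, _); ring.
by rewrite normr1 invr1.
Qed.

Lemma scales_perm (s : 'S_3) :
  scales leb3 (lin3 (perm_mx s)) `|\det (perm_mx s : 'M[R]_3)|^-1.
Proof.
rewrite det_perm normrX normrN normr1 expr1n invr1.
have [ts -> _] := prod_tpermP s.
elim: ts => [|[i j] ts IH] /=.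
  by rewrite big_nil -(tperm1 0); exact: scales_tperm.
rewrite big_cons perm_mxM lin3M.
by apply: (scales_ext (scales_comp IH (scales_tperm _ _))); rewrite ?mulr1.
Qed.

(** By the LUP decomposition it suffices to treat triangular matrices, which
    move one coordinate at a time, and permutations, which are products of
    swaps. *)
Lemma scales_linear M : \det M != 0 -> scales leb3 (lin3 M) `|\det M|^-1.
Proof.
have /is_perm_mxP[s Ps] := cormen_lup_perm M.
have PLU : (cormen_lup M).1.1 * M = (cormen_lup M).1.2 * (cormen_lup M).2.
  pose proof (cormen_lup_correct M) as PLU.
  by case: (cormen_lup M) PLU => -[].
have := PLU; have := cormen_lup_detL M.
have := @cormen_lup_lower _ _ M; have := @cormen_lup_upper _ _ M.
case: cormen_lup Ps => [[P L] U] /= -> Uu Ll dL PM.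
have -> : M = perm_mx s^-1 *m (L *m U).
  by rewrite -[L *m U]PM mulmxA -perm_mxM mulVg perm_mx1 mul1mx.
rewrite !det_mulmx !mulf_eq0 !negb_or => /and3P[_ dL0 dU0].
rewrite -!det_mulmx.
apply: scalesM; first exact: scales_perm.
apply: scalesM; last exact: scales_upper.
apply: scales_lower => // i j ij; rewrite Ll.
  by case: eqP ij => // ->; rewrite ltnn.
exact: ltnW.
Qed.

Lemma scales_translation (a : R * R * R) :
  scales leb3 (fun t => (t.1.1 + a.1.1, t.1.2 + a.1.2, t.2 + a.2)) 1.
Proof.
have O1 : 1 != 0 :> R by rewrite oner_eq0.
have mc (c : R) : measurable_fun setT (fun _ : Rm * Rm => c : Rm) by [].
apply: (scales_ext (scales_comp (scale_x O1 (mc a.1.1))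
  (scales_comp (scale_y O1 (mc a.1.2)) (scale_z O1 (mc a.2))))).
  by move=> [[x y] z] /=; rewrite !mul1r.
by rewrite normr1 invr1 !mulr1.
Qed.

End LinearChangeOfVariables.

(** * Polynomial functions *)

Section PolynomialFunctions.
Variable R : realType.
Local Notation C := R[i].
Local Notation poly := (mpoly.mpoly 3 C).
Implicit Types (Q : poly) (x : 'rV[R]_3).

Definition pval Q x : C := mpoly.meval (fun i => toC x 0 i) Q.

(** Properties of polynomial functions follow the ring operations, whereas the
    native induction goes by monomials. *)
Lemma mpoly_ring_ind (P : poly -> Prop) :
  (forall c, P (mpoly.mpolyC 3 c)) ->
  (forall p q, P p -> P q -> P (p + q)) ->
  (forall i q, P q -> P (mpoly.mpolyX C (mpoly.mnm1 i) * q)) ->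
  forall q, P q.
Proof.
move=> hC hD hX; elim/mpoly.mpolyind => [|c m p _ _ hp].
  by rewrite -(mpoly.mpolyC0 3); exact: hC.
apply: hD => //; rewrite -mpoly.mul_mpolyC mulrC.
move En: (mpoly.mdeg m) => k.
elim: k m En => [|k IH] m En.
  move/eqP: En; rewrite mpoly.mdeg_eq0 => /eqP ->.
  by rewrite mpoly.mpolyX0 mul1r; exact: hC.
have [i mi] : exists i, (m i != 0)%N.
  apply/existsP; move: En; apply: contra_eqT => /existsPn h.
  suff -> : m = mpoly.mnm0 by rewrite mpoly.mdeg0.
  by apply/mpoly.mnmP => j; rewrite mpoly.mnm0E; apply/eqP; move: (h j); rewrite negbK.
have mE : m = mpoly.mnm_add (mpoly.mnm1 i) (mpoly.mnm_sub m (mpoly.mnm1 i)).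
  rewrite mpoly.addmC mpoly.submK//; apply/mpoly.mnm_lepP => j.
  by rewrite mpoly.mnm1E; case: eqP => [<-|//]; rewrite lt0n.
rewrite mE mpoly.mpolyXD -mulrA; apply: hX; apply: IH.
by move: En; rewrite {1}mE mpoly.mdegD mpoly.mdeg1 => -[].
Qed.

Lemma pvalC c x : pval (mpoly.mpolyC 3 c) x = c.
Proof. exact: mpoly.mevalC. Qed.
Lemma pvalX i x : pval (mpoly.mpolyX C (mpoly.mnm1 i)) x = (x 0 i)%:C%C.
Proof. by rewrite /pval mpoly.mevalXU mxE. Qed.
Lemma pval0 x : pval 0 x = 0. Proof. exact: mpoly.meval0. Qed.
Lemma pvalD p q x : pval (p + q) x = pval p x + pval q x.
Proof. exact: mpoly.mevalD. Qed.
Lemma pvalN p x : pval (- p) x = - pval p x.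
Proof. exact: mpoly.mevalN. Qed.
Lemma pvalB p q x : pval (p - q) x = pval p x - pval q x.
Proof. exact: mpoly.mevalB. Qed.
Lemma pvalM p q x : pval (p * q) x = pval p x * pval q x.
Proof. exact: mpoly.mevalM. Qed.
Lemma pval_sum (I : Type) (r : seq I) (P : pred I) (F : I -> poly) x :
  pval (\sum_(i <- r | P i) F i) x = \sum_(i <- r | P i) pval (F i) x.
Proof.
by apply: (big_ind2 (fun p c => pval p x = c)) => //;
  [exact: pval0 | move=> p c q d <- <-; exact: pvalD].
Qed.

Lemma ReM (a b : C) :
  complex.Re (a * b) = complex.Re a * complex.Re b - complex.Im a * complex.Im b.
Proof. by case: a b => [? ?] [? ?]. Qed.
Lemma ImM (a b : C) :
  complex.Im (a * b) = complex.Re a * complex.Im b + complex.Im a * complex.Re b.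
Proof. by case: a b => [? ?] [? ?]. Qed.
Lemma ReD (a b : C) : complex.Re (a + b) = complex.Re a + complex.Re b.
Proof. by case: a b => [? ?] [? ?]. Qed.
Lemma ImD (a b : C) : complex.Im (a + b) = complex.Im a + complex.Im b.
Proof. by case: a b => [? ?] [? ?]. Qed.
Lemma ReN (a : C) : complex.Re (- a) = - complex.Re a.
Proof. by case: a. Qed.

Lemma Re_rM (r : R) (a : C) : complex.Re (r%:C%C * a) = r * complex.Re a.
Proof. by rewrite ReM /= mul0r subr0. Qed.
Lemma Im_rM (r : R) (a : C) : complex.Im (r%:C%C * a) = r * complex.Im a.
Proof. by rewrite ImM /= mul0r addr0. Qed.

Definition rpval Q x : R := complex.Re (pval Q x).
Definition ipval Q x : R := complex.Im (pval Q x).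

Lemma pval_measurable Q d (X : measurableType d) (phi : X -> 'rV[R]_3) :
  (forall j, measurable_fun [set: X] (fun t => phi t 0 j)) ->
  measurable_fun [set: X] (fun t => rpval Q (phi t)) /\
  measurable_fun [set: X] (fun t => ipval Q (phi t)).
Proof.
move=> mphi; elim/mpoly_ring_ind: Q => [c|p q [rp ip] [rq iq]|i q [rq iq]].
- by split; rewrite /rpval /ipval; under eq_fun do rewrite pvalC; exact: measurable_cst.
- split; rewrite /rpval /ipval; under eq_fun do rewrite pvalD ?ReD ?ImD;
  exact: measurable_funD.
- split; rewrite /rpval /ipval; under eq_fun do rewrite pvalM pvalX ?Re_rM ?Im_rM;
  exact: measurable_funM.
Qed.

Lemma pval_continuous Q (X : topologicalType) (phi : X -> 'rV[R]_3) :
  (forall j, continuous (fun t => phi t 0 j)) ->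
  continuous (fun t => rpval Q (phi t)) /\
  continuous (fun t => ipval Q (phi t)).
Proof.
move=> cphi; elim/mpoly_ring_ind: Q => [c|p q [rp ip] [rq iq]|i q [rq iq]].
- by split; rewrite /rpval /ipval; under eq_fun do rewrite pvalC;
    move=> t; exact: cvg_cst.
- split; rewrite /rpval /ipval; under eq_fun do rewrite pvalD ?ReD ?ImD;
  by move=> t; apply: cvgD; [exact: rp || exact: ip|exact: rq || exact: iq].
- split; rewrite /rpval /ipval; under eq_fun do rewrite pvalM pvalX ?Re_rM ?Im_rM;
  by move=> t; apply: cvgM; [exact: cphi|exact: rq || exact: iq].
Qed.

Lemma pval_bounded Q (M : R) : exists N : R, forall x,
  (forall j, `|x 0 j| <= M) -> `|rpval Q x| <= N /\ `|ipval Q x| <= N.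
Proof.
elim/mpoly_ring_ind: Q => [c|p q [A hA] [B hB]|i q [B hB]].
- exists (`|complex.Re c| + `|complex.Im c|) => x _; rewrite /rpval /ipval pvalC.
  by rewrite lerDl lerDr !normr_ge0.
- exists (A + B) => x xM; have [rA iA] := hA x xM; have [rB iB] := hB x xM.
  rewrite /rpval /ipval pvalD ReD ImD.
  by split; apply: le_trans (ler_normD _ _) _; apply: lerD.
- exists (M * B) => x xM; have [rB iB] := hB x xM.
  rewrite /rpval /ipval pvalM pvalX Re_rM Im_rM !normrM.
  by split; apply: ler_pM.
Qed.

(** The derivative of Q in the direction b. *)
Definition pdir (b : 'rV[R]_3) Q : poly :=
  \sum_j mpoly.mpolyC 3 (b 0 j)%:C%C * mpoly.mderiv j Q.

Lemma pdirC b c : pdir b (mpoly.mpolyC 3 c) = 0.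
Proof. by rewrite /pdir big1// => j _; rewrite mpoly.mderivC mulr0. Qed.
Lemma pdirD b p q : pdir b (p + q) = pdir b p + pdir b q.
Proof.
by rewrite -big_split; apply: eq_bigr => j _ /=; rewrite mpoly.mderivD mulrDr.
Qed.
Lemma pdirM b p q : pdir b (p * q) = pdir b p * q + p * pdir b q.
Proof.
rewrite mulr_suml mulr_sumr -big_split; apply: eq_bigr => j _ /=.
by rewrite mpoly.mderivM; ring.
Qed.
Lemma pdirX b i : pdir b (mpoly.mpolyX C (mpoly.mnm1 i)) = mpoly.mpolyC 3 (b 0 i)%:C%C.
Proof.
rewrite /pdir (bigD1 i)//= big1 ?addr0 => [|j ji].
  rewrite mpoly.mderivX mpoly.mnm1E eqxx scale1r -[X in mpoly.mnm_sub X]mpoly.add0m.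
  by rewrite mpoly.addmK mpoly.mpolyX0 mulr1.
by rewrite mpoly.mderivX mpoly.mnm1E eq_sym (negbTE ji) scale0r mulr0.
Qed.

Lemma pval_derive Q a b (t : R) :
  is_derive t 1 (fun s : R => rpval Q (a + s *: b)) (rpval (pdir b Q) (a + t *: b)) /\
  is_derive t 1 (fun s : R => ipval Q (a + s *: b)) (ipval (pdir b Q) (a + t *: b)).
Proof.
elim/mpoly_ring_ind: Q => [c|p q [rp ip] [rq iq]|i q [rq iq]].
- rewrite pdirC /rpval /ipval; split; under eq_fun do rewrite pvalC;
  rewrite pval0 /=; exact: is_derive_cst.
- rewrite pdirD /rpval /ipval pvalD ReD ImD; split;
    under eq_fun do rewrite pvalD ?ReD ?ImD.
    exact: (is_deriveD rp rq).
  exact: (is_deriveD ip iq).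
- have dx : is_derive t 1 (fun s : R => a 0 i + s * b 0 i) (b 0 i).
    have h := is_deriveD (is_derive_cst (a 0 i) t (1 : R))
      (is_deriveM (is_derive_id t (1 : R)) (is_derive_cst (b 0 i) t (1 : R))).
    apply: is_derive_eq h _.
    by rewrite /= scaler0 !add0r /GRing.scale /= mulr1.
  rewrite pdirM pdirX /rpval /ipval pvalD !pvalM pvalX pvalC ReD ImD !Re_rM !Im_rM.
  split; under eq_fun do rewrite pvalM pvalX ?Re_rM ?Im_rM !mxE.
    apply: is_derive_eq (is_deriveM dx rq) _.
    by rewrite /= /GRing.scale /= !mxE; ring.
  apply: is_derive_eq (is_deriveM dx iq) _.
  by rewrite /= /GRing.scale /= !mxE; ring.
Qed.

End PolynomialFunctions.

(** * Integrals over the reference simplices *)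

Section ScalingIntegral.
Context d (X : measurableType d) (R : realType).
Variables (mu : {measure set X -> \bar R}) (T : X -> X) (c : R).
Hypotheses (c0 : 0 < c) (muT : scales mu T c).

Let scales_ge0_integral (f : X -> \bar R) E : measurable E ->
  measurable_fun E f -> (forall x, E x -> (0 <= f x)%E) ->
  (\int[mu]_(x in T @^-1` E) f (T x) = c%:E * \int[mu]_(x in E) f x)%E.
Proof.
move=> mE mf f0; have [mT muTE] := muT.
rewrite -(@ge0_integral_pushforward _ _ _ _ _ _ mT)//; last first.
  by move=> x /set_mem; exact: f0.
rewrite -(ge0_integral_mscale mu mE (NngNum (ltW c0)) mf f0).
by apply: eq_measure_integral => B mB _; exact: muTE.
Qed.

(** Change of variables, for nonnegative functions and then for the positive and
    negative parts. *)
Lemma scales_integral (f : X -> \bar R) E : measurable E ->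
  mu.-integrable E f ->
  mu.-integrable (T @^-1` E) (f \o T) /\
  (\int[mu]_(x in T @^-1` E) f (T x) = c%:E * \int[mu]_(x in E) f x)%E.
Proof.
move=> mE intf; have /integrableP[mf fin] := intf; have [mT muTE] := muT.
have mTE : measurable (T @^-1` E) by rewrite -[X in measurable X]setTI; exact: mT.
split.
  apply/integrableP; split.
    apply: (measurable_comp mE _ mf); last exact: measurable_funTS.
    by move=> _ [x Ex <-].
  rewrite (scales_ge0_integral (f := abse \o f))//; first last.
  - by move=> x _; exact: abse_ge0.
  - exact: measurableT_comp.
  by rewrite lte_mul_pinfty// lee_fin ltW.
rewrite integralE [X in (_ * X)%E]integralE.
have fT := @scales_ge0_integral f^\+%E E mE
  (measurable_funepos mf) (fun x _ => funepos_ge0 f x).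
have fN := @scales_ge0_integral f^\-%E E mE
  (measurable_funeneg mf) (fun x _ => funeneg_ge0 f x).
transitivity (\int[mu]_(x in T @^-1` E) f^\+ (T x) -
  \int[mu]_(x in T @^-1` E) f^\- (T x))%E.
  by congr (_ - _)%E; apply: eq_integral => x _; rewrite !unlock.
rewrite fT fN; apply/esym/muleBr => //; exact: integrable_add_def.
Qed.

Lemma scales_Rintegral (f : X -> R) E : measurable E ->
  mu.-integrable E (EFin \o f) ->
  \int[mu]_(x in T @^-1` E) f (T x) = c * \int[mu]_(x in E) f x.
Proof.
move=> mE intf; have [_] := scales_integral mE intf.
rewrite /Rintegral => -> ; rewrite fineM//.
exact: integrable_fin_num.
Qed.

End ScalingIntegral.

Section ReferenceSimplices.
Variable R : realType.

Notation Rm := (measurableTypeR R).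
Notation leb := (@lebesgue_measure R).

Definition triangle : set (R * R) :=
  [set s | [/\ 0 <= s.1, 0 <= s.2 & s.1 + s.2 <= 1]].

(** The set between the graphs of 0 and 1 - x - y over the triangle, so that the
    last coordinate can be integrated first. *)
Definition tetra : set (R * R * R) :=
  [set t | triangle t.1 /\ 0 <= t.2 <= 1 - t.1.1 - t.1.2].

Lemma measurable_triangle : measurable (triangle : set (Rm * Rm)).
Proof.
rewrite (_ : triangle = (fst @^-1` `[0, +oo[%classic `&` snd @^-1` `[0, +oo[%classic)
   `&` (fun s => s.1 + s.2) @^-1` `]-oo, 1]%classic).
  apply: measurableI; first apply: measurableI.
  - by rewrite -[X in measurable X]setTI; exact: measurable_fst.
  - by rewrite -[X in measurable X]setTI; exact: measurable_snd.
  - have mD : measurable_fun [set: Rm * Rm] (fun s : Rm * Rm => s.1 + s.2 : Rm).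
      exact: measurable_funD.
    by rewrite -[X in measurable X]setTI; exact: mD.
apply/seteqP; split=> -[x y] /=; rewrite !in_itv/= ?andbT.
  by move=> [].
by move=> [[]].
Qed.

Lemma measurable_tetra : measurable (tetra : set (Rm * Rm * Rm)).
Proof.
rewrite (_ : tetra = (fst @^-1` triangle `&` snd @^-1` `[0, +oo[%classic)
   `&` (fun s => 1 - s.1.1 - s.1.2 - s.2) @^-1` `[0, +oo[%classic).
  apply: measurableI; first apply: measurableI.
  - rewrite -[X in measurable X]setTI.
    exact: (@measurable_fst _ _ (Rm * Rm)%type Rm measurableT _
      measurable_triangle).
  - by rewrite -[X in measurable X]setTI; exact: measurable_snd.
  - have mD : measurable_fun [set: Rm * Rm * Rm]
        (fun s : Rm * Rm * Rm => 1 - s.1.1 - s.1.2 - s.2 : Rm).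
      apply: measurable_funB => //; apply: measurable_funB.
        by apply: measurable_funB => //; exact: measurableT_comp.
      exact: measurableT_comp.
    by rewrite -[X in measurable X]setTI; exact: mD.
apply/seteqP; split=> -[[x y] z] /=; rewrite !in_itv/= ?andbT.
  by move=> [h /andP[z0 z1]]; split; last rewrite subr_ge0.
by move=> [[h z0]]; rewrite subr_ge0 => z1; split => //; rewrite z0.
Qed.

Lemma triangle_fin : (plane_measure triangle < +oo)%E.
Proof.
apply: (@le_lt_trans _ _ (plane_measure
  (`[0, 1]%classic `*` `[0, 1]%classic : set (Rm * Rm)))).
  apply: le_measure; [apply/mem_set|apply/mem_set|].
  - exact: measurable_triangle.
  - by apply: measurableX; exact: measurable_itv.
  - by move=> [x y] [/= x0 y0 xy]; split; rewrite /= in_itv/=; lra.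
have -> : plane_measure (`[0, 1]%classic `*` `[0, 1]%classic : set (Rm * Rm)) =
    (leb `[0%R, 1%R]%classic * leb `[0%R, 1%R]%classic)%E.
  by apply: product_measure1E; exact: measurable_itv.
by rewrite lebesgue_measure_itv/= lte_fin ltr01 -EFinB -EFinM ltry.
Qed.

Lemma tetra_fin : (space_measure tetra < +oo)%E.
Proof.
apply: (@le_lt_trans _ _ (space_measure
  (triangle `*` `[0, 1]%classic : set (Rm * Rm * Rm)))).
  apply: le_measure; [apply/mem_set|apply/mem_set|].
  - exact: measurable_tetra.
  - by apply: measurableX; [exact: measurable_triangle|exact: measurable_itv].
  - move=> [[x y] z] [[/= x0 y0 xy] /andP[z0 z1]].
    by split => //=; rewrite in_itv/=; lra.
have -> : space_measure (triangle `*` `[0, 1]%classic : set (Rm * Rm * Rm)) =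
    (plane_measure triangle * leb `[0%R, 1%R]%classic)%E.
  by apply: product_measure1E; [exact: measurable_triangle|exact: measurable_itv].
rewrite lebesgue_measure_itv/= lte_fin ltr01 lte_mul_pinfty//.
  by rewrite ge0_fin_numE// triangle_fin.
by rewrite -EFinB ltry.
Qed.

(** Fubini's theorem, and the fundamental theorem of calculus on each vertical
    segment. *)
Lemma tetra_integral_deriv (f g : R * R * R -> R) :
  measurable_fun [set: Rm * Rm * Rm] g ->
  [bounded g t | t in tetra] ->
  (forall (p : R * R) (z : R),
    is_derive z (1 : R) (fun z : R => f (p, z)) (g (p, z))) ->
  (forall p, continuous (fun z : R => g (p, z))) ->
  \int[@space_measure R]_(t in tetra) g t =
  \int[@plane_measure R]_(s in triangle) (f (s, 1 - s.1 - s.2) - f (s, 0)).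
Proof.
move=> mg bg fg cg.
have ig : (@space_measure R).-integrable (tetra : set (Rm * Rm * Rm)) (EFin \o g).
  apply: measurable_bounded_integrable.
  - exact: measurable_tetra.
  - exact: tetra_fin.
  - exact: measurable_funTS.
  - exact: bg.
rewrite /Rintegral; congr fine.
rewrite integral_mkcond [RHS]integral_mkcond.
move: ig; rewrite integrable_mkcond; last exact: measurable_tetra.
move=> ig; rewrite -(integral12_prod_meas1 ig).
apply: eq_integral => /= -[x y] _; rewrite /fubini_F.
rewrite [RHS]patchE; case: ifPn => [|nT]; last first.
  apply: integral0_eq => z _; rewrite patchE ifF//.
  by apply/negbTE; apply: contra nT => /set_mem[h _]; exact/mem_set.
move=> /set_mem[/= x0 y0 xy].
rewrite (_ : (fun z => _) =
    (fun z => (g (x, y, z))%:E) \_ (`[0, 1 - x - y]%classic)); last first.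
  apply/funext => z; rewrite !patchE; congr (if _ then _ else _).
  apply/idP/idP => /set_mem h; apply/mem_set.
    by rewrite /= in_itv/=; case: h.
  by move: h; rewrite /= in_itv.
rewrite -integral_mkcond.
have [xy1|xy1] := ltP (x + y) 1; last first.
  have -> : 1 - x - y = 0 by lra.
  rewrite set_itv1 integral_set1 subrr//.
have fc z : {for z, continuous (fun z : R => f (x, y, z))}.
  apply: differentiable_continuous; apply/derivable1_diffP.
  by have [] := fg (x, y) z.
rewrite (@continuous_FTC2 _ (fun z => g (x, y, z)) (fun z => f (x, y, z))).
- by rewrite EFinB.
- by rewrite -addrA -opprD subr_gt0.
- by apply: continuous_subspaceT; exact: cg.
- split.
  + by move=> z _; have [] := fg (x, y) z.
  + by apply: cvg_at_right_filter; exact: fc.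
  + by apply: cvg_at_left_filter; exact: fc.
- by move=> z _; rewrite derive1E; have [_ ->] := fg (x, y) z.
Qed.

End ReferenceSimplices.
Arguments triangle {R}.
Arguments tetra {R}.

(** * Tetrahedra as affine images of the reference tetrahedron *)

Section VectorIdentities.
Variable A : comNzRingType.
Implicit Types u v w x y : 'rV[A]_3.

Lemma dotvE u v : dotv u v = u 0 0 * v 0 0 + u 0 1 * v 0 1 + u 0 2 * v 0 2.
Proof. exact: sum3. Qed.

Lemma crossv0E u v : crossv u v 0 0 = u 0 1 * v 0 2 - u 0 2 * v 0 1.
Proof.
rewrite mxE (_ : 0 + 1 = 1 :> 'I_3); last exact/val_inj.
by rewrite (_ : 0 + 2 = 2 :> 'I_3); last exact/val_inj.
Qed.
Lemma crossv1E u v : crossv u v 0 1 = u 0 2 * v 0 0 - u 0 0 * v 0 2.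
Proof.
rewrite mxE (_ : 1 + 1 = 2 :> 'I_3); last exact/val_inj.
by rewrite (_ : 1 + 2 = 0 :> 'I_3); last exact/val_inj.
Qed.
Lemma crossv2E u v : crossv u v 0 2 = u 0 0 * v 0 1 - u 0 1 * v 0 0.
Proof.
rewrite mxE (_ : 2 + 1 = 0 :> 'I_3); last exact/val_inj.
by rewrite (_ : 2 + 2 = 1 :> 'I_3); last exact/val_inj.
Qed.
Definition crossvE := (crossv0E, crossv1E, crossv2E).

Definition vol u v w := dotv u (crossv v w).

(** The cross products v x w, w x u, u x v are, up to the factor vol u v w, the
    basis dual to u, v, w. *)
Lemma vol_dual u v w (j l : 'I_3) :
  crossv v w 0 j * u 0 l + crossv w u 0 j * v 0 l + crossv u v 0 j * w 0 l =
  vol u v w * (j == l)%:R.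
Proof.
rewrite /vol dotvE; move: j l; apply: forall3; apply: forall3;
  rewrite !crossvE /= ?mulr1 ?mulr0; ring.
Qed.

Lemma cramer u v w y : vol u v w *: y =
  dotv (crossv v w) y *: u + dotv (crossv w u) y *: v + dotv (crossv u v) y *: w.
Proof.
apply/rowP => l; rewrite !mxE.
transitivity (\sum_j vol u v w * (j == l)%:R * y 0 j).
  rewrite (bigD1 l)//= big1 ?eqxx ?addr0 ?mulr1// => j /negbTE ->.
  by rewrite mulr0 mul0r.
rewrite /dotv !mulr_suml -!big_split; apply: eq_bigr => j _ /=.
by rewrite -(vol_dual u v w j l); ring.
Qed.

Lemma vol_det (M : 'M[A]_3) : \det M = vol (row 0 M) (row 1 M) (row 2 M).
Proof.
rewrite (expand_det_row _ 0) sum3 /cofactor /vol dotvE !crossvE.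
have d2 (N : 'M[A]_2) : \det N = N 0 0 * N 1 1 - N 0 1 * N 1 0.
  rewrite (expand_det_row _ 0) !big_ord_recl big_ord0 /cofactor !det_mx11 !mxE /=.
  rewrite (_ : lift 0 0 = 1)//; last exact/val_inj.
  rewrite (_ : lift 1 0 = 0)//; last exact/val_inj.
  by rewrite /= expr0 expr1; ring.
rewrite !d2 !mxE.
have E00 : lift (0 : 'I_3) (0 : 'I_2) = 1 by exact/val_inj.
have E01 : lift (0 : 'I_3) (1 : 'I_2) = 2 by exact/val_inj.
have E10 : lift (1 : 'I_3) (0 : 'I_2) = 0 by exact/val_inj.
have E11 : lift (1 : 'I_3) (1 : 'I_2) = 2 by exact/val_inj.
have E20 : lift (2 : 'I_3) (0 : 'I_2) = 0 by exact/val_inj.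
have E21 : lift (2 : 'I_3) (1 : 'I_2) = 1 by exact/val_inj.
rewrite E00 E01 E10 E11 E20 E21 /= expr0 expr1 sqrrN expr1n; ring.
Qed.

End VectorIdentities.

Section Tetrahedra.
Variable R : realType.
Implicit Types (x a b c u : 'rV[R]_3) (t : R * R * R) (s : R * R).

Notation Rm := (measurableTypeR R).
Notation mu3 := (@space_measure R).
Notation mu2 := (@plane_measure R).

Definition triangle_map a b c s : 'rV[R]_3 := a + s.1 *: (b - a) + s.2 *: (c - a).

Definition tetra_map x0 x1 x2 x3 t : 'rV[R]_3 :=
  x0 + t.1.1 *: (x1 - x0) + t.1.2 *: (x2 - x0) + t.2 *: (x3 - x0).

(** The hull of four points without an index type, because the points get
    permuted below. *)
Definition simplex4 x0 x1 x2 x3 : set 'rV[R]_3 := [set x | exists w0 w1 w2 w3,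
  [/\ [/\ 0 <= w0, 0 <= w1, 0 <= w2 & 0 <= w3], w0 + w1 + w2 + w3 = 1 &
      x = w0 *: x0 + w1 *: x1 + w2 *: x2 + w3 *: x3]].

Definition coords3 x : R * R * R := (x 0 0, x 0 1, x 0 2).

Lemma point3E t : (point3 t 0 0 = t.1.1) * (point3 t 0 1 = t.1.2) * (point3 t 0 2 = t.2).
Proof. by rewrite !mxE. Qed.

Lemma coords3K : cancel coords3 (@point3 R).
Proof. by move=> x; apply/rowP; apply: forall3; rewrite point3E. Qed.

Lemma point3K : cancel (@point3 R) coords3.
Proof. by move=> [[x y] z]; rewrite /coords3 !point3E. Qed.

Lemma measurable_point3 j : measurable_fun [set: Rm * Rm * Rm] (fun t => point3 t 0 j).
Proof.
move: j; apply: forall3; under eq_fun do rewrite point3E; exact: measurableT_comp.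
Qed.

Section Parametrization.
Variables x0 x1 x2 x3 : 'rV[R]_3.
Let D := vol (x1 - x0) (x2 - x0) (x3 - x0).
Hypothesis D0 : D != 0.

Let F := tetra_map x0 x1 x2 x3.
Let E := [set t | simplex4 x0 x1 x2 x3 (point3 t)].

(** The inverse of the parametrization, by Cramer's rule. *)
Let G t : R * R * R :=
  (dotv (crossv (x2 - x0) (x3 - x0)) (point3 t - x0) / D,
   dotv (crossv (x3 - x0) (x1 - x0)) (point3 t - x0) / D,
   dotv (crossv (x1 - x0) (x2 - x0)) (point3 t - x0) / D).

(** The edges are the rows of the linear part. *)
Lemma tetra_map_scales : scales mu3 (coords3 \o F) `|D|^-1.
Proof.
pose M : 'M[R]_3 := \matrix_(i, j) (nth 0 [:: x1 - x0; x2 - x0; x3 - x0] i) 0 j.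
have detM : \det M = D.
  rewrite vol_det; congr (vol _ _ _); apply/rowP => j; by rewrite !mxE.
have := scales_comp (scales_translation (coords3 x0)) (scales_linear (M := M) _).
rewrite detM mul1r => /(_ D0); congr scales.
apply/funext => -[[x y] z]; rewrite /coords3 /F /tetra_map /lin3 /= !mxE /=.
by congr (_, _, _); ring.
Qed.

Lemma tetra_map_coords t : F (G t) = point3 t.
Proof.
have := cramer (x1 - x0) (x2 - x0) (x3 - x0) (point3 t - x0); rewrite -/D => h.
transitivity (x0 + D^-1 *: (D *: (point3 t - x0))); last first.
  by rewrite scalerK// addrC subrK.
rewrite h /F /tetra_map !scalerDr !scalerA !addrA /=.
by rewrite -!(mulrC D^-1).
Qed.

Lemma coords_tetra_map t : G (coords3 (F t)) = t.
Proof.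
case: t => [[a b] c]; rewrite /G coords3K /F /tetra_map /=.
have -> : x0 + a *: (x1 - x0) + b *: (x2 - x0) + c *: (x3 - x0) - x0 =
  a *: (x1 - x0) + b *: (x2 - x0) + c *: (x3 - x0).
  by rewrite -!addrA [LHS]addrC !addrA subrK.
move: D0; rewrite /D /vol; move: (x1 - x0) (x2 - x0) (x3 - x0) => u v w.
rewrite !dotvE !crossvE !mxE => d0.
by congr (_, _, _); field.
Qed.

Lemma simplex4_tetra t : E t <-> tetra (G t).
Proof.
rewrite /E /=; split.
  move=> [w0 [w1 [w2 [w3 [[h0 h1 h2 h3] wsum xE]]]]].
  have -> : t = coords3 (F (w1, w2, w3)).
    apply: (can_inj point3K); rewrite coords3K xE /F /tetra_map /=.
    have -> : w0 = 1 - w1 - w2 - w3 by rewrite -wsum; ring.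
    by apply/rowP => j; rewrite !mxE; ring.
  rewrite coords_tetra_map; split => /=; first by split => //=; lra.
  by apply/andP; split => //; lra.
rewrite -(tetra_map_coords t); case: (G t) => [[a b] c] [[/= a0 b0 ab] /andP[c0 c1]].
exists (1 - a - b - c), a, b, c; split; [split => //; lra|ring|].
by rewrite /F /tetra_map /=; apply/rowP => j; rewrite !mxE; ring.
Qed.

Lemma tetra_map_preimage : (coords3 \o F) @^-1` E = tetra.
Proof.
apply/seteqP; split => t; first by move/simplex4_tetra; rewrite /= coords_tetra_map.
by move=> h; apply/simplex4_tetra; rewrite /= coords_tetra_map.
Qed.

Lemma measurable_simplex4 : measurable (E : set (Rm * Rm * Rm)).
Proof.
rewrite (_ : E = G @^-1` (tetra)); last first.
  by apply/seteqP; split => t /simplex4_tetra.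
have mdot c : measurable_fun [set: Rm * Rm * Rm]
    (fun t => dotv c (point3 t - x0) / D : Rm).
  apply: measurable_funM => //; under eq_fun do rewrite dotvE !mxE.
  by apply: measurable_funD; first apply: measurable_funD;
    apply: measurable_funM => //; apply: measurable_funB => //;
    do ?exact: measurableT_comp; exact: measurable_snd.
have mG : measurable_fun [set: Rm * Rm * Rm] (G : _ -> Rm * Rm * Rm).
  by apply: measurable_fun_pair => //; exact: measurable_fun_pair.
rewrite -[X in measurable X]setTI.
exact: (mG measurableT _ (@measurable_tetra R)).
Qed.

End Parametrization.
End Tetrahedra.

(** * Integrals over triangles and tetrahedra *)

Section SimplexIntegrals.
Variable R : realType.
Local Notation C := R[i].
Local Notation poly := (mpoly.mpoly 3 C).
Implicit Types (x a b c u : 'rV[R]_3) (t : R * R * R) (s : R * R) (Q : poly).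

Notation Rm := (measurableTypeR R).
Notation mu3 := (@space_measure R).
Notation mu2 := (@plane_measure R).

Lemma le_sum_coord (f : 'I_3 -> R) j : (forall i, 0 <= f i) -> f j <= \sum_i f i.
Proof. by move=> f0; rewrite (bigD1 j)//= lerDl sumr_ge0. Qed.

Lemma tetra_map_bounded x0 x1 x2 x3 : exists M : R, forall t, tetra t ->
  forall j, `|tetra_map x0 x1 x2 x3 t 0 j| <= M.
Proof.
exists (\sum_j (`|x0 0 j| + `|x1 0 j - x0 0 j|
  + `|x2 0 j - x0 0 j| + `|x3 0 j - x0 0 j|)).
move=> [[p q] r] [[/= p0 q0 pq] /andP[r0 r1]] j.
apply: le_trans (le_sum_coord _ _); last first.
  by move=> i; rewrite !addr_ge0.
rewrite /tetra_map !mxE /=.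
have h (w z : R) : 0 <= w <= 1 -> `|w * z| <= `|z|.
  move=> /andP[w0 w1]; rewrite normrM (ger0_norm w0).
  by rewrite ler_piMl.
do 3 (apply: le_trans (ler_normD _ _) _; apply: lerD; last by apply: h; lra).
exact: lexx.
Qed.

Lemma triangle_map_tetra_map a b c s : triangle_map a b c s = tetra_map a b c a (s, 0).
Proof. by rewrite /tetra_map /= scale0r addr0. Qed.

Lemma triangle_map_bounded a b c : exists M : R, forall s, triangle s ->
  forall j, `|triangle_map a b c s 0 j| <= M.
Proof.
have [M hM] := tetra_map_bounded a b c a; exists M => s hs j.
rewrite triangle_map_tetra_map; apply: hM; split => //=.
by case: hs => *; lra.
Qed.

Lemma measurable_tetra_map x0 x1 x2 x3 j :
  measurable_fun [set: Rm * Rm * Rm] (fun t => tetra_map x0 x1 x2 x3 t 0 j).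
Proof.
rewrite /tetra_map; under eq_fun do rewrite !mxE.
apply: measurable_funD; first apply: measurable_funD; first apply: measurable_funD => //;
  apply: measurable_funM => //; exact: measurableT_comp.
Qed.

Lemma measurable_triangle_map a b c j :
  measurable_fun [set: Rm * Rm] (fun s => triangle_map a b c s 0 j).
Proof.
rewrite /triangle_map; under eq_fun do rewrite !mxE.
by apply: measurable_funD; first apply: measurable_funD => //;
  apply: measurable_funM.
Qed.

Lemma rpval_bounded_on (X : Type) (phi : X -> 'rV[R]_3) (E : set X) Q :
  (exists M : R, forall t : X, E t -> forall j, `|phi t 0 j| <= M) ->
  [bounded rpval Q (phi y) | y in E].
Proof.
move=> [M hM]; have [N hN] := pval_bounded Q M.
exists N; split; first exact: num_real.
by move=> r Nr t Et; apply: le_trans (ltW Nr); exact: (hN _ (hM t Et)).1.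
Qed.

Lemma integrable_triangle_map Q a b c :
  mu2.-integrable (triangle) (EFin \o (fun s => rpval Q (triangle_map a b c s))).
Proof.
apply: measurable_bounded_integrable.
- exact: measurable_triangle.
- exact: triangle_fin.
- apply: measurable_funTS; apply: (pval_measurable Q _).1.
  exact: measurable_triangle_map.
- exact/rpval_bounded_on/triangle_map_bounded.
Qed.

Definition triangle_integral Q a b c : R :=
  \int[mu2]_(s in triangle) rpval Q (triangle_map a b c s).

(** The symmetry of the reference triangle that exchanges the first two vertices
    is affine in a single coordinate. *)
Lemma triangle_integralC12 Q a b c :
  triangle_integral Q b a c = triangle_integral Q a b c.
Proof.
pose T (s : Rm * Rm) : Rm * Rm := (-1 * s.1 + (1 - s.2), s.2).
have mT : scales mu2 T `|-1|^-1.
  apply: (@scales_ysection R _ _ Rm Rm lebesgue_measure lebesgue_measure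
    (fun q p => -1 * p + (1 - q))).
  - by rewrite invr_ge0.
  - apply: measurable_funD; first exact: measurable_funM.
    exact: measurable_funB.
  - by move=> y; apply: scales_affine; rewrite oppr_eq0 oner_eq0.
have := scales_Rintegral _ mT (@measurable_triangle R) (integrable_triangle_map Q a b c).
rewrite normrN normr1 invr1 mul1r => /(_ ltr01) h; apply: etrans h.
rewrite (_ : T @^-1` _ = triangle); last first.
  by apply/seteqP; split => -[p q] [/= *]; split => /=; lra.
apply: eq_Rintegral => -[p q] _; congr rpval; rewrite /triangle_map /=.
by apply/rowP => j; rewrite !mxE; ring.
Qed.

Lemma triangle_integralC13 Q a b c :
  triangle_integral Q c b a = triangle_integral Q a b c.
Proof.
pose T (s : Rm * Rm) : Rm * Rm := (s.1, -1 * s.2 + (1 - s.1)).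
have mT : scales mu2 T `|-1|^-1.
  apply: (@scales_xsection R _ _ Rm Rm lebesgue_measure lebesgue_measure
    (fun p q => -1 * q + (1 - p))).
  - by rewrite invr_ge0.
  - apply: measurable_funD; first exact: measurable_funM.
    exact: measurable_funB.
  - by move=> y; apply: scales_affine; rewrite oppr_eq0 oner_eq0.
have := scales_Rintegral _ mT (@measurable_triangle R) (integrable_triangle_map Q a b c).
rewrite normrN normr1 invr1 mul1r => /(_ ltr01) h; apply: etrans h.
rewrite (_ : T @^-1` _ = triangle); last first.
  by apply/seteqP; split => -[p q] [/= *]; split => /=; lra.
apply: eq_Rintegral => -[p q] _; congr rpval; rewrite /triangle_map /=.
by apply/rowP => j; rewrite !mxE; ring.
Qed.

Lemma triangle_integralC23 Q a b c :
  triangle_integral Q a c b = triangle_integral Q a b c.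
Proof.
by rewrite triangle_integralC12 triangle_integralC13 triangle_integralC12.
Qed.

Definition simplex_integral Q x0 x1 x2 x3 : R :=
  \int[mu3]_(t in [set t | simplex4 x0 x1 x2 x3 (point3 t)]) rpval Q (point3 t).

Section Parametrized.
Variables x0 x1 x2 x3 : 'rV[R]_3.
Let D := vol (x1 - x0) (x2 - x0) (x3 - x0).
Hypothesis D0 : D != 0.

Lemma integrable_simplex4 Q :
  mu3.-integrable [set t | simplex4 x0 x1 x2 x3 (point3 t)]
    (EFin \o (fun t => rpval Q (point3 t))).
Proof.
have hmu := tetra_map_scales D0; have [mT muT] := hmu.
have mE := measurable_simplex4 D0.
apply: measurable_bounded_integrable => //.
- have := muT _ mE; rewrite tetra_map_preimage// => h.
  have : (`|D|^-1%:E * mu3 [set t | simplex4 x0 x1 x2 x3 (point3 t)] < +oo)%E.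
    by rewrite -h; exact: tetra_fin.
  have [->|] := eqVneq (mu3 [set t | simplex4 x0 x1 x2 x3 (point3 t)]) +oo%E.
    by rewrite mulry gtr0_sg ?mul1e// invr_gt0 normr_gt0.
  by rewrite -ltey.
- apply: measurable_funTS; apply: (pval_measurable Q _).1.
  exact: measurable_point3.
- apply: rpval_bounded_on; have [M hM] := tetra_map_bounded x0 x1 x2 x3.
  exists M => t /= /(simplex4_tetra D0) ht j.
  by rewrite -(tetra_map_coords D0 t); exact: hM.
Qed.

Lemma simplex_integral_param Q :
  simplex_integral Q x0 x1 x2 x3 =
  `|D| * \int[mu3]_(t in tetra) rpval Q (tetra_map x0 x1 x2 x3 t).
Proof.
have := scales_Rintegral _ (tetra_map_scales D0) (measurable_simplex4 D0)
  (integrable_simplex4 Q).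
rewrite tetra_map_preimage// invr_gt0 normr_gt0 => /(_ D0).
under eq_Rintegral do rewrite /= coords3K.
by move=> ->; rewrite mulrA mulfV ?mul1r// normr_eq0.
Qed.

(** Seen from the reference tetrahedron, the edge from x0 to x3 is the last
    coordinate axis; the boundary terms live on the faces opposite to x0 and x3. *)
Lemma simplex_integral_edge Q :
  simplex_integral (pdir (x3 - x0) Q) x0 x1 x2 x3 =
  `|D| * (triangle_integral Q x3 x1 x2 - triangle_integral Q x0 x1 x2).
Proof.
rewrite simplex_integral_param; congr (_ * _).
have mg : measurable_fun [set: Rm * Rm * Rm]
    (fun t => rpval (pdir (x3 - x0) Q) (tetra_map x0 x1 x2 x3 t)).
  by apply: (pval_measurable _ _).1; exact: measurable_tetra_map.
have bg : [bounded rpval (pdir (x3 - x0) Q) (tetra_map x0 x1 x2 x3 t) | t in tetra].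
  exact/rpval_bounded_on/tetra_map_bounded.
have cg (p : R * R) :
    continuous (fun z : R => rpval (pdir (x3 - x0) Q) (tetra_map x0 x1 x2 x3 (p, z))).
  apply: (pval_continuous _ _).1 => j z.
  rewrite /tetra_map /=; under eq_fun do rewrite !mxE.
  by apply: cvgD; [exact: cvg_cst|apply: cvgM; [exact: cvg_id|exact: cvg_cst]].
have dg (p : R * R) (z : R) : is_derive z (1 : R)
    (fun z : R => rpval Q (tetra_map x0 x1 x2 x3 (p, z)))
    (rpval (pdir (x3 - x0) Q) (tetra_map x0 x1 x2 x3 (p, z))).
  by have [] := pval_derive Q (x0 + p.1 *: (x1 - x0) + p.2 *: (x2 - x0))
    (x3 - x0) z.
have h := @tetra_integral_deriv R (fun t => rpval Q (tetra_map x0 x1 x2 x3 t))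
  (fun t => rpval (pdir (x3 - x0) Q) (tetra_map x0 x1 x2 x3 t)) mg bg dg cg.
apply: (etrans h) => {h}.
rewrite /triangle_integral -RintegralB.
- apply: eq_Rintegral => -[p q] _; rewrite /tetra_map /triangle_map /=.
  by congr (rpval _ _ - rpval _ _); apply/rowP => j; rewrite !mxE; ring.
- exact: measurable_triangle.
- exact: integrable_triangle_map.
- exact: integrable_triangle_map.
Qed.

End Parametrized.

End SimplexIntegrals.

(** * Divergence theorem on a tetrahedron *)

Section SimplexIntegralLinear.
Variable R : realType.
Local Notation C := R[i].
Local Notation poly := (mpoly.mpoly 3 C).
Implicit Types (Q : poly).

Lemma rpvalD (P Q : poly) (y : 'rV[R]_3) : rpval (P + Q) y = rpval P y + rpval Q y.
Proof. by rewrite /rpval pvalD ReD. Qed.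

Lemma rpval_scale (r : R) Q (y : 'rV[R]_3) :
  rpval (mpoly.mpolyC 3 r%:C%C * Q) y = r * rpval Q y.
Proof. by rewrite /rpval pvalM pvalC Re_rM. Qed.

Variables x0 x1 x2 x3 : 'rV[R]_3.
Let D := vol (x1 - x0) (x2 - x0) (x3 - x0).
Hypothesis D0 : D != 0.

Lemma simplex_integralD (P Q : poly) :
  simplex_integral (P + Q) x0 x1 x2 x3 =
  simplex_integral P x0 x1 x2 x3 + simplex_integral Q x0 x1 x2 x3.
Proof.
rewrite /simplex_integral -RintegralD.
- by apply: eq_Rintegral => t _; exact: rpvalD.
- exact: measurable_simplex4.
- exact: integrable_simplex4.
- exact: integrable_simplex4.
Qed.

Lemma simplex_integralZ (r : R) Q :
  simplex_integral (mpoly.mpolyC 3 r%:C%C * Q) x0 x1 x2 x3 =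
  r * simplex_integral Q x0 x1 x2 x3.
Proof.
rewrite /simplex_integral -RintegralZl.
- by apply: eq_Rintegral => t _; exact: rpval_scale.
- exact: measurable_simplex4.
- exact: integrable_simplex4.
Qed.

Lemma simplex4_rot : simplex4 x0 x2 x3 x1 = simplex4 x0 x1 x2 x3.
Proof.
apply/seteqP; split => x [a [b [c [d [[a0 b0 c0 d0] abcd ->]]]]].
  exists a, d, b, c; split => //; first by rewrite -abcd; ring.
  by rewrite -!addrA; congr (_ + _); rewrite addrA addrC.
exists a, c, d, b; split => //; first by rewrite -abcd; ring.
by rewrite -!addrA; congr (_ + _); rewrite [RHS]addrA [RHS]addrC.
Qed.

End SimplexIntegralLinear.

Lemma vol_rot (A : comNzRingType) (u v w : 'rV[A]_3) : vol v w u = vol u v w.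
Proof. by rewrite /vol !dotvE !crossvE; ring. Qed.

Section SimplexDivergence.
Variable R : realType.
Local Notation C := R[i].
Local Notation poly := (mpoly.mpoly 3 C).
Implicit Types (Q : poly).
Variables x0 x1 x2 x3 : 'rV[R]_3.
Let D := vol (x1 - x0) (x2 - x0) (x3 - x0).
Hypothesis D0 : D != 0.

(** Twice the vector area of the triangle abc. *)
Definition area_vector (a b c : 'rV[R]_3) := crossv (b - a) (c - a).

(** Cramer's rule resolves a coordinate direction into three given directions,
    which will be the edges at a vertex. *)
Lemma mderiv_cramer (u1 u2 u3 : 'rV[R]_3) (j : 'I_3) Q :
  mpoly.mpolyC 3 (vol u1 u2 u3)%:C%C * mpoly.mderiv j Q =
  mpoly.mpolyC 3 (crossv u2 u3 0 j)%:C%C * pdir u1 Q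
  + mpoly.mpolyC 3 (crossv u3 u1 0 j)%:C%C * pdir u2 Q
  + mpoly.mpolyC 3 (crossv u1 u2 0 j)%:C%C * pdir u3 Q.
Proof.
have pdirZ c u : c * pdir u Q =
    \sum_l c * (mpoly.mpolyC 3 (u 0 l)%:C%C * mpoly.mderiv l Q).
  by rewrite /pdir mulr_sumr.
rewrite !pdirZ -!big_split /=.
rewrite [RHS](bigD1 j)//= [X in _ = _ + X]big1 ?addr0 => [|l lj].
  rewrite !mulrA -!mulrDl -!mpoly.mpolyCM -!mpoly.mpolyCD; congr (_ * _).
  by rewrite -!rmorphM -!rmorphD /= vol_dual eqxx mulr1.
rewrite !mulrA -!mulrDl -!mpoly.mpolyCM -!mpoly.mpolyCD.
rewrite -!rmorphM -!rmorphD /= vol_dual eq_sym (negbTE lj) mulr0.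
by rewrite mpoly.mpolyC0 mul0r.
Qed.

(** The edge from x0 to xk contributes the integrals over the faces opposite to
    x0 and xk. The face opposite to x0 collects three contributions, whose
    coefficients add up to its own area vector since the area vectors of a closed
    surface cancel. *)
Lemma simplex_integral_deriv (j : 'I_3) Q :
  simplex_integral (mpoly.mderiv j Q) x0 x1 x2 x3 =
  Num.sg D * (area_vector x1 x2 x3 0 j * triangle_integral Q x1 x2 x3
            - area_vector x0 x2 x3 0 j * triangle_integral Q x0 x2 x3
            + area_vector x0 x1 x3 0 j * triangle_integral Q x0 x1 x3
            - area_vector x0 x1 x2 0 j * triangle_integral Q x0 x1 x2).
Proof.
pose u1 := x1 - x0; pose u2 := x2 - x0; pose u3 := x3 - x0.
pose I P := simplex_integral P x0 x1 x2 x3.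
have I3 : I (pdir u3 Q) =
    `|D| * (triangle_integral Q x1 x2 x3 - triangle_integral Q x0 x1 x2).
  rewrite /I (simplex_integral_edge D0 Q).
  by rewrite (triangle_integralC12 Q x1 x3) (triangle_integralC23 Q x1).
have I1 : I (pdir u1 Q) =
    `|D| * (triangle_integral Q x1 x2 x3 - triangle_integral Q x0 x2 x3).
  have D1 : vol u2 u3 u1 != 0 by rewrite vol_rot.
  have := simplex_integral_edge D1 Q; rewrite vol_rot => <-.
  by rewrite /I /simplex_integral (simplex4_rot x0 x1 x2).
have I2 : I (pdir u2 Q) =
    `|D| * (triangle_integral Q x1 x2 x3 - triangle_integral Q x0 x1 x3).
  have D2 : vol u3 u1 u2 != 0 by rewrite -vol_rot.
  have := simplex_integral_edge D2 Q; rewrite -vol_rot.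
  rewrite (triangle_integralC12 Q x3 x2) (triangle_integralC23 Q x3).
  rewrite (triangle_integralC12 Q x1 x3) (triangle_integralC23 Q x1).
  rewrite (triangle_integralC23 Q x0) => <-.
  by rewrite /I /simplex_integral (simplex4_rot x0 x2 x3) (simplex4_rot x0 x1 x2).
have key : D * I (mpoly.mderiv j Q) =
    crossv u2 u3 0 j * I (pdir u1 Q) + crossv u3 u1 0 j * I (pdir u2 Q)
    + crossv u1 u2 0 j * I (pdir u3 Q).
  rewrite /I -!(simplex_integralZ D0) -!(simplex_integralD D0).
  by rewrite mderiv_cramer.
apply: (mulfI D0); rewrite [LHS]key I1 I2 I3 (normrEsg D).
have -> : crossv u3 u1 0 j = - area_vector x0 x1 x3 0 j.
  by rewrite /area_vector /u1 /u3 !mxE; ring.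
have -> : area_vector x1 x2 x3 0 j =
    area_vector x0 x2 x3 0 j - area_vector x0 x1 x3 0 j + area_vector x0 x1 x2 0 j.
  by rewrite /area_vector !mxE; ring.
rewrite -/(area_vector x0 x2 x3) -/(area_vector x0 x1 x2).
move: (triangle_integral Q x1 x2 x3) (triangle_integral Q x0 x2 x3)
  (triangle_integral Q x0 x1 x3) (triangle_integral Q x0 x1 x2) => t0 t1 t2 t3.
move: (area_vector x0 x2 x3 0 j) (area_vector x0 x1 x3 0 j)
  (area_vector x0 x1 x2 0 j) => n1 n2 n3.
ring.
Qed.

End SimplexDivergence.

(** * Geometry of elements and faces *)

Lemma enum_setD1 (T : finType) (A : {set T}) (x : T) :
  enum (A :\ x)%SET = [seq y <- enum A | y != x].
Proof.
rewrite /enum_mem -filter_predI; apply: eq_filter => y.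
exact: in_setD1.
Qed.

Section ElementGeometry.
Variables (R : realType) (n : nat) (v : 'I_n -> 'rV[R]_3).
Implicit Types (K F : {set 'I_n}).

Lemma hull_simplex4 K k0 k1 k2 k3 : enum K = [:: k0; k1; k2; k3] ->
  hull v K = simplex4 (v k0) (v k1) (v k2) (v k3).
Proof.
move=> eK; have uK : uniq [:: k0; k1; k2; k3] by rewrite -eK enum_uniq.
have sumK (V : nmodType) (f : 'I_n -> V) :
    \sum_(i in K) f i = f k0 + f k1 + f k2 + f k3.
  by rewrite -big_enum eK /= !big_cons big_nil addr0 !addrA.
apply/seteqP; split => x.
  move=> [w [w0]]; rewrite !sumK => w1 ->.
  by exists (w k0), (w k1), (w k2), (w k3); split.
move=> [w0 [w1 [w2 [w3 [[h0 h1 h2 h3] ws ->]]]]].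
pose w i := if i == k0 then w0 else if i == k1 then w1 else if i == k2 then w2 else w3.
move: uK; rewrite /= !inE !negb_or -!andbA andbT.
move=> /and5P[k01 k02 k03 k12 /andP[k13 k23]].
have e0 : w k0 = w0 by rewrite /w eqxx.
have e1 : w k1 = w1 by rewrite /w eq_sym (negbTE k01) eqxx.
have e2 : w k2 = w2.
  by rewrite /w eq_sym (negbTE k02) eq_sym (negbTE k12) eqxx.
have e3 : w k3 = w3.
  by rewrite /w eq_sym (negbTE k03) eq_sym (negbTE k13) eq_sym (negbTE k23).
exists w; rewrite !sumK e0 e1 e2 e3 //; split => // i.
by rewrite /w; do 3 case: ifP => // _.
Qed.

Lemma enum_perm K (l : seq 'I_n) : enum K = l -> perm_eq (enum K) l.
Proof. by move=> ->. Qed.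

(** Stated up to permutation, because the vertex opposite to a face has to come
    first in the application to faces. *)
Lemma vol_neq0 K k0 k1 k2 k3 : perm_eq (enum K) [:: k0; k1; k2; k3] ->
  affinely_independent v K ->
  vol (v k1 - v k0) (v k2 - v k0) (v k3 - v k0) != 0.
Proof.
move=> eK; have uK : uniq [:: k0; k1; k2; k3] by rewrite -(perm_uniq eK) enum_uniq.
have sumK (V : nmodType) (f : 'I_n -> V) :
    \sum_(i in K) f i = f k0 + f k1 + f k2 + f k3.
  by rewrite -big_enum (perm_big _ eK) /= !big_cons big_nil addr0 !addrA.
have inK i : (i \in K) = (i \in [:: k0; k1; k2; k3]) by rewrite -(perm_mem eK) mem_enum.
move: uK; rewrite /= !inE !negb_or -!andbA andbT.
move=> /and5P[k01 k02 k03 k12 /andP[k13 k23]] aff.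
pose M : 'M[R]_3 := \matrix_(i, j)
  (nth 0 [:: v k1 - v k0; v k2 - v k0; v k3 - v k0] i) 0 j.
have detM : \det M = vol (v k1 - v k0) (v k2 - v k0) (v k3 - v k0).
  by rewrite vol_det; congr (vol _ _ _); apply/rowP => j; rewrite !mxE.
rewrite -detM; apply/det0P => -[r r0 rM].
pose w i := if i == k0 then - r 0 0 - r 0 1 - r 0 2
  else if i == k1 then r 0 0 else if i == k2 then r 0 1 else r 0 2.
have e0 : w k0 = - r 0 0 - r 0 1 - r 0 2 by rewrite /w eqxx.
have e1 : w k1 = r 0 0 by rewrite /w eq_sym (negbTE k01) eqxx.
have e2 : w k2 = r 0 1.
  by rewrite /w eq_sym (negbTE k02) eq_sym (negbTE k12) eqxx.
have e3 : w k3 = r 0 2.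
  by rewrite /w eq_sym (negbTE k03) eq_sym (negbTE k13) eq_sym (negbTE k23).
have w0 : forall i, i \in K -> w i = 0.
  apply: aff; first by rewrite sumK e0 e1 e2 e3; ring.
  rewrite sumK e0 e1 e2 e3; apply/rowP => j.
  have := congr1 (fun A : 'rV[R]_3 => A 0 j) rM; rewrite !mxE sum3 !mxE /= => <-.
  ring.
move/eqP: r0; apply; apply/rowP => j; rewrite mxE; move: j.
by apply: forall3; rewrite -?e1 -?e2 -?e3 w0// inK !inE eqxx ?orbT.
Qed.

Lemma face_opposite K F : #|K| = 4%N -> affinely_independent v K ->
  F \in faces K -> exists k a b c, [/\ (K :\: F = [set k])%SET,
    enum F = [:: a; b; c] & vol (v a - v k) (v b - v k) (v c - v k) != 0].
Proof.
move=> cK aff; rewrite inE => /andP[FK /eqP cF].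
have /eqP/cards1P[k kE] : #|(K :\: F)%SET| = 1%N.
  by rewrite cardsD (finset.setIidPr FK) cK cF.
have := cF; rewrite cardE.
case eF : (enum F) => [|a [|b [|c []]]]// _.
exists k, a, b, c; split => //; apply: (vol_neq0 _ aff).
have kF i : (i == k) = (i \notin F) && (i \in K).
  by move/setP: kE => /(_ i); rewrite !inE => ->.
apply: uniq_perm; first exact: enum_uniq.
  rewrite -eF /= enum_uniq andbT mem_enum.
  by have := kF k; rewrite eqxx => /esym/andP[].
move=> i; rewrite -eF inE !mem_enum kF.
have [iF|_] /= := boolP (i \in F); last by rewrite orbF.
exact: (fintype.subsetP FK).
Qed.

Lemma sum_faces K k0 k1 k2 k3 (V : nmodType) (G : {set 'I_n} -> V) :
  enum K = [:: k0; k1; k2; k3] ->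
  \sum_(F in faces K) G F =
  G (K :\ k0)%SET + G (K :\ k1)%SET + G (K :\ k2)%SET + G (K :\ k3)%SET.
Proof.
move=> eK; have cK : #|K| = 4%N by rewrite cardE eK.
have -> : faces K = [set (K :\ k)%SET | k in K]%SET.
  apply/setP => F; rewrite inE; apply/andP/imsetP.
    move=> [FK /eqP cF].
    have /eqP/cards1P[k kE] : #|(K :\: F)%SET| = 1%N.
      by rewrite cardsD (finset.setIidPr FK) cK cF.
    have kK : k \in K by move: (set11 k); rewrite -kE inE => /andP[].
    exists k => //; apply/setP => i.
    move/setP: kE => /(_ i); rewrite !inE => <-.
    have [iF|_] /= := boolP (i \in F); last by case: (i \in K).
    exact/esym/(fintype.subsetP FK).
  move=> [k kK ->]; rewrite subD1set; split => //.
  by move: (cardsD1 k K); rewrite kK cK add1n => -[->].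
rewrite big_imset /=; last first.
  move=> a b aK bK /setP /(_ a); rewrite !inE eqxx aK andbT /=.
  by case: eqVneq.
by rewrite -big_enum eK /= !big_cons big_nil addr0 !addrA.
Qed.

End ElementGeometry.

Section DotProduct.
Variable A : comNzRingType.
Implicit Types a b c : 'rV[A]_3.

Lemma dotC a b : dotv a b = dotv b a.
Proof. by rewrite !dotvE; ring. Qed.
Lemma dotZl r a b : dotv (r *: a) b = r * dotv a b.
Proof. by rewrite !dotvE !mxE; ring. Qed.
Lemma dotDl a b c : dotv (a + b) c = dotv a c + dotv b c.
Proof. by rewrite !dotvE !mxE; ring. Qed.
Lemma dotNl a b : dotv (- a) b = - dotv a b.
Proof. by rewrite !dotvE !mxE; ring. Qed.
Lemma dotDr a b c : dotv a (b + c) = dotv a b + dotv a c.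
Proof. by rewrite !dotvE !mxE; ring. Qed.
Lemma dotNr a b : dotv a (- b) = - dotv a b.
Proof. by rewrite !dotvE !mxE; ring. Qed.

End DotProduct.

Section FaceGeometry.
Variables (R : realType) (n : nat) (v : 'I_n -> 'rV[R]_3).
Implicit Types (K F : {set 'I_n}).

Lemma dotvv_gt0 (a : 'rV[R]_3) : a != 0 -> 0 < dotv a a.
Proof.
move=> a0; rewrite lt_neqAle; apply/andP; split; last first.
  by rewrite dotvE !addr_ge0// -expr2 sqr_ge0.
apply: contra a0 => /eqP/esym; rewrite dotvE => /eqP.
rewrite -!expr2 !paddr_eq0 ?addr_ge0 ?sqr_ge0// !sqrf_eq0 -andbA.
move=> /and3P[/eqP a0 /eqP a1 /eqP a2]; apply/eqP/rowP.
by apply: forall3; rewrite mxE.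
Qed.

Lemma enorm_gt0 (a : 'rV[R]_3) : a != 0 -> 0 < enorm a.
Proof. by move=> a0; rewrite sqrtr_gt0 dotvv_gt0. Qed.

Lemma enorm_sqr (a : 'rV[R]_3) : enorm a ^+ 2 = dotv a a.
Proof. by rewrite sqr_sqrtr// dotvE !addr_ge0// -expr2 sqr_ge0. Qed.

Section Opposite.
Variables (K F : {set 'I_n}) (k a b c : 'I_n).
Hypotheses (KF : (K :\: F = [set k])%SET) (eF : enum F = [:: a; b; c]).
Let S := vol (v a - v k) (v b - v k) (v c - v k).

Lemma fparamE s : fparam v F s = triangle_map (v a) (v b) (v c) s.
Proof. by rewrite /fparam /fedge /fvertex eF. Qed.

Lemma face_crossE : face_cross v F = area_vector (v a) (v b) (v c).
Proof. by rewrite /face_cross /fedge /fvertex eF. Qed.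

Lemma vol_face : S = dotv (face_cross v F) (v a - v k).
Proof. by rewrite face_crossE /S /vol /area_vector !dotvE !crossvE !mxE; ring. Qed.

Hypothesis S0 : S != 0.

Lemma face_cross_neq0 : face_cross v F != 0.
Proof.
by apply: contra S0 => /eqP f0; rewrite vol_face f0 dotvE !mxE !mul0r !addr0.
Qed.

(** The sign of the volume based at the vertex k opposite to F tells on which
    side of F the element lies. The norm on the left is that of the surface
    element. *)
Lemma outward_normalE :
  enorm (face_cross v F) *: outward_normal v K F = Num.sg S *: face_cross v F.
Proof.
have N0 := enorm_gt0 face_cross_neq0.
rewrite /outward_normal.
have -> : [exists i in (K :\: F)%SET,
    0 < dotv (unit_normal v F) (v i - fvertex v F 0)] = (S < 0).
  rewrite KF; have -> : fvertex v F 0 = v a by rewrite /fvertex eF.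
  have kE : (0 < dotv (unit_normal v F) (v k - v a)) = (S < 0).
    rewrite /unit_normal dotZl pmulr_rgt0 ?invr_gt0//.
    by rewrite -opprB dotNr -vol_face oppr_gt0.
  apply/existsP/idP; first by move=> [i /andP[]]; rewrite inE => /eqP ->; rewrite kE.
  by move=> S1; exists k; rewrite set11 kE.
rewrite /unit_normal; case: ltrP => hS.
  by rewrite scalerN scalerA mulfV ?gt_eqF// scale1r ltr0_sg// scaleN1r.
by rewrite scalerA mulfV ?gt_eqF// gtr0_sg// lt_neqAle eq_sym S0.
Qed.

Lemma outward_normal_unit : dotv (outward_normal v K F) (outward_normal v K F) = 1.
Proof.
have N0 := enorm_gt0 face_cross_neq0.
have uu : dotv (unit_normal v F) (unit_normal v F) = 1.
  rewrite /unit_normal dotZl dotC dotZl -enorm_sqr.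
  by rewrite mulrA -invfM -expr2 mulVf// expf_neq0// gt_eqF.
by case: (outward_normal_pm v K F) => ->; rewrite // dotNr dotNl opprK.
Qed.

End Opposite.
End FaceGeometry.

(** * Complex integrals of polynomial fields *)

Section ComplexIntegral.
Context d (X : measurableType d) (R : realType).
Variables (mu : {measure set X -> \bar R}) (D : set X).
Hypothesis mD : measurable D.
Local Notation C := R[i].
Implicit Types f g : X -> C.

Definition Cintegrable f :=
  mu.-integrable D (EFin \o (fun x => complex.Re (f x))) /\
  mu.-integrable D (EFin \o (fun x => complex.Im (f x))).

Lemma eq_Cintegral f g : (forall x, D x -> f x = g x) ->
  Cintegral mu D f = Cintegral mu D g.
Proof.
move=> fg; rewrite /Cintegral.
by congr (_ +i* _)%C; apply: eq_Rintegral => x /set_mem Dx; rewrite fg.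
Qed.

Lemma CintegralD f g : Cintegrable f -> Cintegrable g ->
  Cintegral mu D (fun x => f x + g x) = Cintegral mu D f + Cintegral mu D g.
Proof.
move=> [rf If] [rg Ig]; apply/eqP; rewrite eq_complex /=; apply/andP; split; apply/eqP.
  by rewrite -RintegralD//; apply: eq_Rintegral => x _; rewrite ReD.
by rewrite -RintegralD//; apply: eq_Rintegral => x _; rewrite ImD.
Qed.

Let integrableZ (r : R) (f : X -> R) : mu.-integrable D (EFin \o f) ->
  mu.-integrable D (EFin \o (fun x => r * f x)).
Proof. by move=> h; apply: eq_integrable (integrableZl mD r h). Qed.

Lemma CintegralZ (c : C) f : Cintegrable f ->
  Cintegral mu D (fun x => c * f x) = c * Cintegral mu D f.
Proof.
move=> [rf If]; apply/eqP; rewrite eq_complex /=; apply/andP; split; apply/eqP.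
  rewrite ReM /= -!RintegralZl// -RintegralB//; try exact: integrableZ.
  by apply: eq_Rintegral => x _; rewrite ReM.
rewrite ImM /= -!RintegralZl// -RintegralD//; try exact: integrableZ.
by apply: eq_Rintegral => x _; rewrite ImM.
Qed.

Lemma Cintegral_conj f : Cintegrable f ->
  Cintegral mu D (fun x => (f x)^*%C) = (Cintegral mu D f)^*%C.
Proof.
move=> [rf If]; rewrite /Cintegral /=; congr (_ +i* _)%C.
  by apply: eq_Rintegral => x _; case: (f x).
rewrite -mulN1r -RintegralZl//; apply: eq_Rintegral => x _.
by rewrite mulN1r; case: (f x).
Qed.

End ComplexIntegral.

Section PolynomialFields.
Variable R : realType.
Local Notation C := R[i].
Local Notation poly := (mpoly.mpoly 3 C).
Implicit Types (S : set 'rV[R]_3) (f g : 'rV[R]_3 -> C) (Q : poly).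

Lemma conjCD (a b : C) : conjc (a + b) = conjc a + conjc b.
Proof. exact: rmorphD. Qed.
Lemma conjCM (a b : C) : conjc (a * b) = conjc a * conjc b.
Proof. exact: rmorphM. Qed.
Lemma conj_real (r : R) : ((r%:C)^* = r%:C)%C.
Proof. by apply/eqP; rewrite eq_complex /= oppr0 !eqxx. Qed.

(** Locked, to keep unification from unfolding the coefficients. *)
Definition pconj : poly -> poly :=
  locked (mpoly.map_mpoly (fun z : C => z^*%C)).

Lemma pconjD P Q : pconj (P + Q) = pconj P + pconj Q.
Proof. rewrite /pconj -lock; exact: raddfD. Qed.
Lemma pconjM P Q : pconj (P * Q) = pconj P * pconj Q.
Proof. rewrite /pconj -lock; exact: rmorphM. Qed.
Lemma pconjC c : pconj (mpoly.mpolyC 3 c) = mpoly.mpolyC 3 c^*%C.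
Proof. rewrite /pconj -lock; exact: mpoly.map_mpolyC. Qed.
Lemma pconjX m : pconj (mpoly.mpolyX C m) = mpoly.mpolyX C m.
Proof. rewrite /pconj -lock; exact: mpoly.map_mpolyX. Qed.

Lemma pval_conj Q x : pval (pconj Q) x = (pval Q x)^*%C.
Proof.
elim/mpoly_ring_ind: Q => [c|P Q hP hQ|i Q hQ].
- by rewrite pconjC !pvalC.
- by rewrite pconjD (pvalD (pconj P)) (pvalD P) hP hQ conjCD.
- rewrite pconjM pconjX (pvalM _ (pconj Q)) (pvalM _ Q) hQ pvalX.
  by rewrite conjCM conj_real.
Qed.

Lemma mderiv_conj j Q : mpoly.mderiv j (pconj Q) = pconj (mpoly.mderiv j Q).
Proof.
elim/mpoly_ring_ind: Q => [c|P Q hP hQ|i Q hQ].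
- by rewrite pconjC !mpoly.mderivC -(mpoly.mpolyC0 3) pconjC conjc0.
- by rewrite pconjD (mpoly.mderivD j (pconj P)) (mpoly.mderivD j P) pconjD hP hQ.
- rewrite pconjM pconjX (mpoly.mderivM j _ (pconj Q)) hQ (mpoly.mderivM j _ Q).
  rewrite pconjD !pconjM pconjX; congr (_ * _ + _).
  rewrite mpoly.mderivX -mpoly.mul_mpolyC pconjM pconjC pconjX.
  by congr (mpoly.mpolyC _ _ * _); apply/esym; exact: rmorph_nat.
Qed.

Definition poly_on S f := exists Q, forall x, S x -> f x = pval Q x.

Lemma poly_on_pval S Q : poly_on S (pval Q).
Proof. by exists Q. Qed.
Lemma poly_on_cst S c : poly_on S (fun=> c).
Proof. by exists (mpoly.mpolyC 3 c) => x _; rewrite pvalC. Qed.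
Lemma poly_onD S f g : poly_on S f -> poly_on S g -> poly_on S (fun x => f x + g x).
Proof. by move=> [P hP] [Q hQ]; exists (P + Q) => x Sx; rewrite pvalD hP// hQ. Qed.
Lemma poly_onM S f g : poly_on S f -> poly_on S g -> poly_on S (fun x => f x * g x).
Proof. by move=> [P hP] [Q hQ]; exists (P * Q) => x Sx; rewrite pvalM hP// hQ. Qed.
Lemma poly_onZ S c f : poly_on S f -> poly_on S (fun x => c * f x).
Proof. by apply: poly_onM; exact: poly_on_cst. Qed.
Lemma poly_onN S f : poly_on S f -> poly_on S (fun x => - f x).
Proof. by move=> [P hP]; exists (- P) => x Sx; rewrite pvalN hP. Qed.
Lemma poly_onB S f g : poly_on S f -> poly_on S g -> poly_on S (fun x => f x - g x).
Proof. by move=> hf /poly_onN; exact: poly_onD. Qed.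

(** What the integrals over an element and over a face have in common. *)
Record integral_on S (J : ('rV[R]_3 -> C) -> C) : Prop := IntegralOn {
  integral_on_ext : forall f g, (forall x, S x -> f x = g x) -> J f = J g;
  integral_onD : forall f g, poly_on S f -> poly_on S g ->
    J (fun x => f x + g x) = J f + J g;
  integral_onZ : forall c f, poly_on S f -> J (fun x => c * f x) = c * J f;
  integral_on_conj : forall f, poly_on S f -> J (fun x => (f x)^*%C) = (J f)^*%C;
  integral_on_ge0 : forall f, (forall x, S x -> 0 <= complex.Re (f x)) ->
    0 <= complex.Re (J f) }.

(** An imaginary part is a real part for another polynomial, so that real
    integrals of real parts suffice. *)
Lemma ipvalE Q x : ipval Q x = rpval (mpoly.mpolyC 3 (- 'i)%C * Q) x.
Proof. by rewrite /ipval /rpval pvalM pvalC ReM /= oppr0 mul0r sub0r mulN1r opprK. Qed.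

End PolynomialFields.
Arguments pconj {R}.

Section MeshIntegrals.
Variables (R : realType) (n : nat) (v : 'I_n -> 'rV[R]_3).
Local Notation C := R[i].
Local Notation poly := (mpoly.mpoly 3 C).
Implicit Types (K F : {set 'I_n}) (f g : 'rV[R]_3 -> C) (Q : poly).

Definition element_integral K f : C :=
  Cintegral (@space_measure R) [set t | hull v K (point3 t)] (fun t => f (point3 t)).

Definition face_integral F f : C :=
  (enorm (face_cross v F))%:C%C *
  Cintegral (@plane_measure R) triangle (fun s => f (fparam v F s)).

Lemma innerFE F (f g : 'rV[R]_3 -> 'rV[C]_3) :
  innerF v F f g = face_integral F (fun x => dotv (f x) (conjv (g x))).
Proof. by []. Qed.

Lemma element_integral_on K : #|K| = 4%N -> affinely_independent v K ->
  integral_on (hull v K) (element_integral K).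
Proof.
rewrite cardE => cK aff.
case eK : (enum K) cK => [|k0 [|k1 [|k2 [|k3 []]]]]// _.
have D0 := vol_neq0 (enum_perm eK) aff; have hK := hull_simplex4 v eK.
have mE : measurable ([set t | hull v K (point3 t)] :
    set (measurableTypeR R * measurableTypeR R * measurableTypeR R)).
  by rewrite hK; exact: measurable_simplex4.
have intE f : poly_on (hull v K) f ->
    Cintegrable (@space_measure R) [set t | hull v K (point3 t)] (f \o @point3 R).
  move=> [Q fQ]; split.
    apply: (@eq_integrable _ _ _ _ _ mE (EFin \o (fun t => rpval Q (point3 t)))).
      by move=> t /set_mem Et /=; rewrite fQ.
    by rewrite hK; exact: integrable_simplex4.
  apply: (@eq_integrable _ _ _ _ _ mE
    (EFin \o (fun t => rpval (mpoly.mpolyC 3 (- 'i)%C * Q) (point3 t)))).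
    by move=> t /set_mem Et /=; rewrite fQ// -ipvalE.
  by rewrite hK; exact: integrable_simplex4.
split.
- by move=> f g fg; apply: eq_Cintegral => t; exact: fg.
- by move=> f g /intE hf /intE hg; exact: CintegralD.
- by move=> c f /intE hf; exact: CintegralZ.
- by move=> f /intE hf; exact: Cintegral_conj.
- by move=> f f0; apply: Rintegral_ge0 => t; exact: f0.
Qed.

Lemma hull_triangle_map F a b c : enum F = [:: a; b; c] ->
  hull v F = [set triangle_map (v a) (v b) (v c) s | s in triangle].
Proof.
move=> eF; have uF : uniq [:: a; b; c] by rewrite -eF enum_uniq.
have sumF (V : nmodType) (f : 'I_n -> V) : \sum_(i in F) f i = f a + f b + f c.
  by rewrite -big_enum eF /= !big_cons big_nil addr0 !addrA.
apply/seteqP; split => x.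
  move=> [w [w0]]; rewrite !sumF => w1 ->; exists (w b, w c).
    by split => //=; have := w0 a; lra.
  have -> : w a = 1 - w b - w c by rewrite -w1; ring.
  by rewrite /triangle_map /=; apply/rowP => j; rewrite !mxE; ring.
move=> [[s t] [/= s0 t0 st] <-].
pose w i := if i == b then s else if i == c then t else 1 - s - t.
move: uF; rewrite /= !inE !negb_or andbT => /andP[/andP[ab ac] bc].
have wa : w a = 1 - s - t by rewrite /w (negbTE ab) (negbTE ac).
have wb : w b = s by rewrite /w eqxx.
have wc : w c = t by rewrite /w eq_sym (negbTE bc) eqxx.
exists w; rewrite !sumF wa wb wc; first split.
- by move=> i; rewrite /w; do 2 case: ifP => // _; lra.
- by ring.
- by rewrite /triangle_map /=; apply/rowP => j; rewrite !mxE; ring.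
Qed.

Lemma face_integral_on F : #|F| = 3%N -> integral_on (hull v F) (face_integral F).
Proof.
rewrite cardE => cF.
case eF : (enum F) cF => [|a [|b [|c []]]]// _.
have hF := hull_triangle_map eF; have pF s := fparamE v eF s.
have FF s : triangle s -> hull v F (fparam v F s).
  by move=> hs; rewrite hF pF; exists s.
have mE := @measurable_triangle R.
have intF f : poly_on (hull v F) f ->
    Cintegrable (@plane_measure R) triangle (f \o fparam v F).
  move=> [Q fQ]; split.
    apply: (@eq_integrable _ _ _ _ _ mE
      (EFin \o (fun s => rpval Q (triangle_map (v a) (v b) (v c) s)))).
      by move=> t /set_mem Et /=; rewrite fQ ?pF//; rewrite -pF; exact: FF.
    exact: integrable_triangle_map.
  apply: (@eq_integrable _ _ _ _ _ mE (EFin \o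
    (fun s => rpval (mpoly.mpolyC 3 (- 'i)%C * Q) (triangle_map (v a) (v b) (v c) s)))).
    by move=> t /set_mem Et /=; rewrite -ipvalE fQ ?pF//; rewrite -pF; exact: FF.
  exact: integrable_triangle_map.
split.
- move=> f g fg; congr (_ * _); apply: eq_Cintegral => s hs; exact/fg/FF.
- move=> f g /intF hf /intF hg; rewrite /face_integral -mulrDr; congr (_ * _).
  exact: CintegralD.
- move=> c0 f /intF hf; rewrite /face_integral mulrCA; congr (_ * _).
  exact: CintegralZ.
- move=> f /intF hf; rewrite /face_integral conjCM conj_real.
  by congr (_ * _); exact: Cintegral_conj.
- move=> f f0; rewrite /face_integral Re_rM mulr_ge0 ?sqrtr_ge0//.
  by apply: Rintegral_ge0 => s hs; exact/f0/FF.
Qed.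

End MeshIntegrals.

(** * Green's formula on an element *)

Section MeshDivergence.
Variables (R : realType) (n : nat) (v : 'I_n -> 'rV[R]_3).
Local Notation C := R[i].
Local Notation poly := (mpoly.mpoly 3 C).
Implicit Types (K F : {set 'I_n}) (f g : 'rV[R]_3 -> C) (Q : poly).

Let triF F Q : R :=
  \int[@plane_measure R]_(s in triangle) rpval Q (fparam v F s).

Let triF_outward K F k a b c Q (j : 'I_3) :
  (K :\: F = [set k])%SET -> enum F = [:: a; b; c] ->
  vol (v a - v k) (v b - v k) (v c - v k) != 0 ->
  outward_normal v K F 0 j * (enorm (face_cross v F) * triF F Q) =
  Num.sg (vol (v a - v k) (v b - v k) (v c - v k)) *
    (area_vector (v a) (v b) (v c) 0 j * triangle_integral Q (v a) (v b) (v c)).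
Proof.
move=> KF eF S0; have := outward_normalE KF eF S0.
have scE (r : R) (u : 'rV[R]_3) : (r *: u) 0 j = r * u 0 j by rewrite mxE.
move=> /(congr1 (fun u : 'rV[R]_3 => u 0 j)); rewrite !scE (face_crossE v eF).
move=> h; rewrite mulrCA mulrA h.
have -> : triF F Q = triangle_integral Q (v a) (v b) (v c).
  by apply: eq_Rintegral => s _; rewrite (fparamE v eF).
by rewrite mulrA.
Qed.

Let real_divergence K (j : 'I_3) Q : #|K| = 4%N -> affinely_independent v K ->
  \int[@space_measure R]_(t in [set t | hull v K (point3 t)])
    rpval (mpoly.mderiv j Q) (point3 t) =
  \sum_(F in faces K)
    outward_normal v K F 0 j * (enorm (face_cross v F) * triF F Q).
Proof.
rewrite cardE => cK aff.
case eK : (enum K) cK => [|k0 [|k1 [|k2 [|k3 []]]]]// _.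
have uK : uniq [:: k0; k1; k2; k3] by rewrite -eK enum_uniq.
have inK i : (i \in K) = (i \in [:: k0; k1; k2; k3]) by rewrite -eK mem_enum.
move: uK; rewrite /= !inE !negb_or -!andbA andbT.
move=> /and5P[k01 k02 k03 k12 /andP[k13 k23]].
have D0 := vol_neq0 (enum_perm eK) aff; have hK := hull_simplex4 v eK.
have KF k : k \in [:: k0; k1; k2; k3] -> (K :\: (K :\ k) = [set k])%SET.
  rewrite -inK => kK; apply/setP => i; rewrite !inE.
  by case: eqVneq => [->|ik]; rewrite ?kK// andNb.
have e0 : enum (K :\ k0)%SET = [:: k1; k2; k3].
  rewrite enum_setD1 eK /= eqxx /= (eq_sym k1) k01 (eq_sym k2) k02.
  by rewrite (eq_sym k3) k03.
have e1 : enum (K :\ k1)%SET = [:: k0; k2; k3].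
  rewrite enum_setD1 eK /= eqxx /= k01 (eq_sym k2) k12.
  by rewrite (eq_sym k3) k13.
have e2 : enum (K :\ k2)%SET = [:: k0; k1; k3].
  by rewrite enum_setD1 eK /= eqxx /= k02 k12 (eq_sym k3) k23.
have e3 : enum (K :\ k3)%SET = [:: k0; k1; k2].
  by rewrite enum_setD1 eK /= eqxx /= k03 k13 k23.
(* The signed volumes based at the four vertices alternate in sign. *)
have S1 : vol (v k0 - v k1) (v k2 - v k1) (v k3 - v k1) =
    - vol (v k1 - v k0) (v k2 - v k0) (v k3 - v k0).
  by rewrite /vol !dotvE !crossvE !mxE; ring.
have S2 : vol (v k0 - v k2) (v k1 - v k2) (v k3 - v k2) =
    vol (v k1 - v k0) (v k2 - v k0) (v k3 - v k0).
  by rewrite /vol !dotvE !crossvE !mxE; ring.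
have S3 : vol (v k0 - v k3) (v k1 - v k3) (v k2 - v k3) =
    - vol (v k1 - v k0) (v k2 - v k0) (v k3 - v k0).
  by rewrite /vol !dotvE !crossvE !mxE; ring.
have D1 := D0; rewrite -oppr_eq0 -S1 in D1.
have D2 := D0; rewrite -S2 in D2.
have D3 := D0; rewrite -oppr_eq0 -S3 in D3.
rewrite (sum_faces _ eK).
rewrite (triF_outward Q j (KF k0 _) e0 D0) ?inE ?eqxx//.
rewrite (triF_outward Q j (KF k1 _) e1 D1) ?inE ?eqxx ?orbT//.
rewrite (triF_outward Q j (KF k2 _) e2 D2) ?inE ?eqxx ?orbT//.
rewrite (triF_outward Q j (KF k3 _) e3 D3) ?inE ?eqxx ?orbT//.
rewrite S1 S2 S3 sgrN.
have := simplex_integral_deriv D0 j Q; rewrite /simplex_integral -hK => ->.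
move: (triangle_integral Q (v k1) (v k2) (v k3)) (triangle_integral Q (v k0) (v k2) (v k3))
  (triangle_integral Q (v k0) (v k1) (v k3)) (triangle_integral Q (v k0) (v k1) (v k2))
  (Num.sg _) => t0 t1 t2 t3 s.
move: (area_vector (v k1) (v k2) (v k3) 0 j) (area_vector (v k0) (v k2) (v k3) 0 j)
  (area_vector (v k0) (v k1) (v k3) 0 j) (area_vector (v k0) (v k1) (v k2) 0 j)
  => n0 n1 n2 n3.
ring.
Qed.

Lemma Re_sum (I : Type) (r : seq I) (P : pred I) (G : I -> C) :
  complex.Re (\sum_(i <- r | P i) G i) = \sum_(i <- r | P i) complex.Re (G i).
Proof. exact: (big_morph _ (@ReD R) erefl). Qed.
Lemma Im_sum (I : Type) (r : seq I) (P : pred I) (G : I -> C) :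
  complex.Im (\sum_(i <- r | P i) G i) = \sum_(i <- r | P i) complex.Im (G i).
Proof. exact: (big_morph _ (@ImD R) erefl). Qed.

Lemma divergence K (j : 'I_3) Q : #|K| = 4%N -> affinely_independent v K ->
  element_integral v K (pval (mpoly.mderiv j Q)) =
  \sum_(F in faces K) (outward_normal v K F 0 j)%:C%C * face_integral v F (pval Q).
Proof.
move=> cK aff; apply/eqP; rewrite eq_complex Re_sum Im_sum; apply/andP; split; apply/eqP.
  rewrite -[LHS]/(\int[@space_measure R]_(t in [set t | hull v K (point3 t)])
    rpval (mpoly.mderiv j Q) (point3 t)) real_divergence//.
  by apply: eq_bigr => F _; rewrite !Re_rM.
transitivity (\int[@space_measure R]_(t in [set t | hull v K (point3 t)])
    rpval (mpoly.mderiv j (mpoly.mpolyC 3 (- 'i)%C * Q)) (point3 t)).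
  apply: eq_Rintegral => t _; rewrite mpoly.mderiv_mulC -ipvalE//.
rewrite real_divergence//; apply: eq_bigr => F _; rewrite !Im_rM; congr (_ * (_ * _)).
by apply: eq_Rintegral => s _; rewrite -ipvalE.
Qed.

Local Notation vpoly := ('rV[poly]_3).
Implicit Types a b : vpoly.

Definition pconjv a : vpoly := map_mx pconj a.

Lemma peval_coord a x j : peval a x 0 j = pval (a 0 j) x.
Proof. by rewrite mxE. Qed.

Lemma pval_dot a b x : pval (dotv a b) x = dotv (peval a x) (peval b x).
Proof. by rewrite /dotv pval_sum; apply: eq_bigr => j _; rewrite pvalM !peval_coord. Qed.

Lemma peval_conj b x : peval (pconjv b) x = conjv (peval b x).
Proof.
by apply/rowP => j; rewrite peval_coord [RHS]mxE peval_coord -pval_conj mxE.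
Qed.

Lemma curl_conj b : curl (pconjv b) = pconjv (curl b).
Proof.
apply/rowP => j; rewrite !mxE !mderiv_conj; set P := mpoly.mderiv _ _.
set Q := mpoly.mderiv _ _.
have -> : P - Q = P + mpoly.mpolyC 3 (-1) * Q.
  by rewrite mpoly.mpolyCN mpoly.mpolyC1 mulN1r.
rewrite pconjD pconjM pconjC; congr (_ + _).
have -> : conjc (-1 : C) = -1 by apply/eqP; rewrite eq_complex /= !oppr0 !eqxx.
by rewrite mpoly.mpolyCN mpoly.mpolyC1 mulN1r.
Qed.

Lemma dot_curl a b : dotv (curl a) b =
  (mpoly.mderiv 1 (a 0 2) - mpoly.mderiv 2 (a 0 1)) * b 0 0
  + (mpoly.mderiv 2 (a 0 0) - mpoly.mderiv 0 (a 0 2)) * b 0 1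
  + (mpoly.mderiv 0 (a 0 1) - mpoly.mderiv 1 (a 0 0)) * b 0 2.
Proof.
have aux (i k i' k' : 'I_3) : i = i' -> k = k' ->
    mpoly.mderiv i (a 0 k) - mpoly.mderiv k (a 0 i) =
    mpoly.mderiv i' (a 0 k') - mpoly.mderiv k' (a 0 i') by move=> -> ->.
have c0 : curl a 0 0 = mpoly.mderiv 1 (a 0 2) - mpoly.mderiv 2 (a 0 1).
  by rewrite mxE; apply: aux; exact/val_inj.
have c1 : curl a 0 1 = mpoly.mderiv 2 (a 0 0) - mpoly.mderiv 0 (a 0 2).
  by rewrite mxE; apply: aux; exact/val_inj.
have c2 : curl a 0 2 = mpoly.mderiv 0 (a 0 1) - mpoly.mderiv 1 (a 0 0).
  by rewrite mxE; apply: aux; exact/val_inj.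
by rewrite dotvE c0 c1 c2.
Qed.

Lemma div_cross a b :
  \sum_j mpoly.mderiv j (crossv a b 0 j) = dotv (curl a) b - dotv a (curl b).
Proof.
have dB j (p q r s : poly) : mpoly.mderiv j (p * q - r * s) =
    mpoly.mderiv j p * q + p * mpoly.mderiv j q
    - (mpoly.mderiv j r * s + r * mpoly.mderiv j s).
  by rewrite mpoly.mderivB !mpoly.mderivM.
rewrite sum3 !crossvE (dB 0) (dB 1) (dB 2).
rewrite dot_curl [X in _ = _ - X]dotC dot_curl.
set a0 := a 0 0; set a1 := a 0 1; set a2 := a 0 2.
set b0 := b 0 0; set b1 := b 0 1; set b2 := b 0 2.
move: (mpoly.mderiv 0 a1) (mpoly.mderiv 0 a2) (mpoly.mderiv 1 a0)
  (mpoly.mderiv 1 a2) (mpoly.mderiv 2 a0) (mpoly.mderiv 2 a1) => a01 a02 a10 a12 a20 a21.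
move: (mpoly.mderiv 0 b1) (mpoly.mderiv 0 b2) (mpoly.mderiv 1 b0)
  (mpoly.mderiv 1 b2) (mpoly.mderiv 2 b0) (mpoly.mderiv 2 b1) => b01 b02 b10 b12 b20 b21.
ring.
Qed.

Lemma dot_cross_swap (A : comNzRingType) (u w z : 'rV[A]_3) :
  dotv u (crossv w z) = dotv (crossv u w) z.
Proof. by rewrite !dotvE !crossvE; ring. Qed.

(** The divergence theorem for the field a x conj(b). *)
Lemma green K a b : #|K| = 4%N -> affinely_independent v K ->
  element_integral v K (fun x => dotv (peval (curl a) x) (conjv (peval b x)))
  - element_integral v K (fun x => dotv (peval a x) (conjv (peval (curl b) x)))
  = \sum_(F in faces K) face_integral v F (fun x =>
      dotv (crossv (toC (outward_normal v K F)) (peval a x)) (conjv (peval b x))).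
Proof.
move=> cK aff; have IK := element_integral_on cK aff.
pose b' := pconjv b.
have lhs : element_integral v K (pval (\sum_j mpoly.mderiv j (crossv a b' 0 j))) =
  element_integral v K (fun x => dotv (peval (curl a) x) (conjv (peval b x)))
  - element_integral v K (fun x => dotv (peval a x) (conjv (peval (curl b) x))).
  rewrite div_cross -[X in _ = _ - X]mul1r -mulNr.
  rewrite -(integral_onZ IK); last first.
    by exists (dotv a (curl b')) => x _; rewrite pval_dot curl_conj peval_conj.
  rewrite -(integral_onD IK); last 2 first.
  - by exists (dotv (curl a) b') => x _; rewrite pval_dot peval_conj.
  - apply: poly_onZ; exists (dotv a (curl b')) => x _.
    by rewrite pval_dot curl_conj peval_conj.
  apply: (integral_on_ext IK) => x _.
  rewrite pvalB; apply: etrans (congr2 (fun u w => u - w)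
    (pval_dot _ _ _) (pval_dot _ _ _)) _.
  by rewrite curl_conj !peval_conj mulN1r.
rewrite -lhs.
have -> : element_integral v K (pval (\sum_j mpoly.mderiv j (crossv a b' 0 j))) =
    \sum_j element_integral v K (pval (mpoly.mderiv j (crossv a b' 0 j))).
  rewrite !sum3 -!(integral_onD IK); try exact: poly_on_pval; last first.
    by apply: poly_onD; exact: poly_on_pval.
  by apply: (integral_on_ext IK) => x _; rewrite !pvalD.
under eq_bigr do rewrite divergence//.
rewrite exchange_big /=; apply: eq_bigr => F; rewrite inE => /andP[_ /eqP cF].
have IF := face_integral_on v cF.
transitivity (\sum_i face_integral v F (fun x =>
    (outward_normal v K F 0 i)%:C%C * pval (crossv a b' 0 i) x)).
  by apply: eq_bigr => i _; apply/esym/(integral_onZ IF)/poly_on_pval.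
rewrite sum3 -!(integral_onD IF); try (by apply: poly_onZ; exact: poly_on_pval); last first.
  by apply: poly_onD; apply: poly_onZ; exact: poly_on_pval.
apply: (integral_on_ext IF) => x _.
rewrite -dot_cross_swap -(peval_conj b) -/b' -peval_crossv dotvE.
have toCE (u : 'rV[R]_3) j : toC u 0 j = (u 0 j)%:C%C by rewrite mxE.
by rewrite (toCE _ 0) (toCE _ 1) (toCE _ 2) (peval_coord _ _ 0) (peval_coord _ _ 1)
  (peval_coord _ _ 2).
Qed.

End MeshDivergence.

(** * Nonnegative functions of zero integral *)

Section NullIntegral.
Context d (X : measurableType d) (R : realType).
Variable mu : {measure set X -> \bar R}.

Lemma null_integral_subset (E B : set X) (psi : X -> R) :
  measurable E -> mu.-integrable E (EFin \o psi) ->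
  (forall x, E x -> 0 <= psi x) -> \int[mu]_(x in E) psi x = 0 ->
  measurable B -> B `<=` E -> (forall x, B x -> 0 < psi x) -> mu B = 0%E.
Proof.
move=> mE ipsi psi0 int0 mB BE Bpsi.
have i0 : (\int[mu]_(x in E) (psi x)%:E = 0)%E.
  have f := integrable_fin_num mE ipsi.
  by rewrite -(fineK f); congr EFin.
have /integrableP[mpsi _] := ipsi.
have /(ae_eq_integral_abs mu mE mpsi) [N [mN N0 hN]] :
    (\int[mu]_(x in E) `|(EFin \o psi) x| = 0)%E.
  rewrite -[RHS]i0; apply: eq_integral => x /set_mem Ex.
  by rewrite /= ger0_norm// psi0.
apply/eqP; rewrite eq_le measure_ge0 andbT -N0.
apply: le_measure; [exact/mem_set|exact/mem_set|].
move=> x Bx; apply: hN => /= /(_ (BE _ Bx)) [] px0.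
by have := Bpsi _ Bx; rewrite px0 ltxx.
Qed.

End NullIntegral.

Section OpenSimplices.
Variable R : realType.
Implicit Types (s p : R * R) (t : R * R * R).

Notation Rm := (measurableTypeR R).

Lemma plane_ball_gt0 p (r : R) : 0 < r ->
  measurable (ball p r : set (Rm * Rm)) /\ (0 < plane_measure (ball p r))%E.
Proof.
move=> r0; have -> : ball p r = ball p.1 r `*` ball p.2 r by [].
have mb (x : R) : measurable (ball x r : set Rm) by exact: measurable_ball.
split; first exact: measurableX.
have -> : plane_measure (ball p.1 r `*` ball p.2 r : set (Rm * Rm)) =
    (lebesgue_measure (ball p.1 r) * lebesgue_measure (ball p.2 r))%E.
  exact: product_measure1E.
by rewrite !lebesgue_measure_ball ?ltW// -EFinM lte_fin mulr_gt0// mulrn_wgt0.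
Qed.

Lemma space_ball_gt0 t (r : R) : 0 < r ->
  measurable (ball t r : set (Rm * Rm * Rm)) /\ (0 < space_measure (ball t r))%E.
Proof.
move=> r0; have -> : ball t r = ball t.1 r `*` ball t.2 r by [].
have mb : measurable (ball t.2 r : set Rm) by exact: measurable_ball.
have [mp pp] := plane_ball_gt0 t.1 r0.
split; first exact: measurableX.
have -> : space_measure (ball t.1 r `*` ball t.2 r : set (Rm * Rm * Rm)) =
    (plane_measure (ball t.1 r) * lebesgue_measure (ball t.2 r))%E.
  exact: product_measure1E.
by rewrite lebesgue_measure_ball ?ltW// mule_gt0// lte_fin mulrn_wgt0.
Qed.

Definition open_triangle : set (R * R) :=
  [set s | [/\ 0 < s.1, 0 < s.2 & s.1 + s.2 < 1]].

Definition open_tetra : set (R * R * R) :=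
  [set t | [/\ 0 < t.1.1, 0 < t.1.2, 0 < t.2 & t.1.1 + t.1.2 + t.2 < 1]].

(** A positive value would persist on a ball, which has positive measure. *)
Lemma triangle_integral_eq0 (psi : R * R -> R) :
  (@plane_measure R).-integrable triangle (EFin \o psi) ->
  continuous psi -> (forall s, triangle s -> 0 <= psi s) ->
  \int[@plane_measure R]_(s in triangle) psi s = 0 ->
  forall s, open_triangle s -> psi s = 0.
Proof.
move=> ipsi cpsi psi0 int0 p [p1 p2 p12].
apply/eqP; rewrite eq_le; apply/andP; split; last first.
  by apply: psi0; split; apply: ltW.
rewrite leNgt; apply/negP => psip.
have c1 : continuous (fun s : R * R => s.1) by move=> s; exact: cvg_fst.
have c2 : continuous (fun s : R * R => s.2) by move=> s; exact: cvg_snd.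
have c3 : continuous (fun s : R * R => 1 - (s.1 + s.2)).
  by move=> s; apply: cvgB; [exact: cvg_cst|apply: cvgD; [exact: c1|exact: c2]].
have : \forall s \near p, triangle s /\ 0 < psi s.
  near=> s; split; last by near: s; exact: (cvgr_gt _ (cpsi p) 0 psip).
  split; apply: ltW.
  - by near: s; exact: (cvgr_gt _ (c1 p) 0 p1).
  - by near: s; exact: (cvgr_gt _ (c2 p) 0 p2).
  - rewrite -subr_gt0; near: s; apply: (cvgr_gt _ (c3 p) 0).
    by rewrite subr_gt0.
move/nbhs_ballP => [r /= r0 hr].
have [mb] := plane_ball_gt0 p r0.
rewrite (null_integral_subset (@measurable_triangle R) ipsi psi0 int0 mb) ?ltxx//.
- by move=> s /hr[].
- by move=> s /hr[].
Unshelve. all: end_near. Qed.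

Lemma tetra_integral_eq0 (psi : R * R * R -> R) :
  (@space_measure R).-integrable tetra (EFin \o psi) ->
  continuous psi -> (forall t, tetra t -> 0 <= psi t) ->
  \int[@space_measure R]_(t in tetra) psi t = 0 ->
  forall t, open_tetra t -> psi t = 0.
Proof.
move=> ipsi cpsi psi0 int0 p [p1 p2 p3 p123].
apply/eqP; rewrite eq_le; apply/andP; split; last first.
  by apply: psi0; split; [split => /=; lra|apply/andP; split; lra].
rewrite leNgt; apply/negP => psip.
have c0 : continuous (fun t : R * R * R => t.1) by move=> s; exact: cvg_fst.
have c1 : continuous (fun t : R * R * R => t.1.1).
  by move=> s; apply: (cvg_comp _ _ (c0 s)); exact: cvg_fst.
have c2 : continuous (fun t : R * R * R => t.1.2).
  by move=> s; apply: (cvg_comp _ _ (c0 s)); exact: cvg_snd.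
have c3 : continuous (fun t : R * R * R => t.2) by move=> s; exact: cvg_snd.
have c4 : continuous (fun t : R * R * R => 1 - (t.1.1 + t.1.2 + t.2)).
  move=> s; apply: cvgB; first exact: cvg_cst.
  by apply: cvgD; [apply: cvgD; [exact: c1|exact: c2]|exact: c3].
have : \forall t \near p, tetra t /\ 0 < psi t.
  near=> t; split; last by near: t; exact: (cvgr_gt _ (cpsi p) 0 psip).
  have t1 : 0 < t.1.1 by near: t; exact: (cvgr_gt _ (c1 p) 0 p1).
  have t2 : 0 < t.1.2 by near: t; exact: (cvgr_gt _ (c2 p) 0 p2).
  have t3 : 0 < t.2 by near: t; exact: (cvgr_gt _ (c3 p) 0 p3).
  have t4 : 0 < 1 - (t.1.1 + t.1.2 + t.2).
    by near: t; apply: (cvgr_gt _ (c4 p) 0); rewrite subr_gt0.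
  by split; [split => /=; lra|apply/andP; split; lra].
move/nbhs_ballP => [r /= r0 hr].
have [mb] := space_ball_gt0 p r0.
rewrite (null_integral_subset (@measurable_tetra R) ipsi psi0 int0 mb) ?ltxx//.
- by move=> s /hr[].
- by move=> s /hr[].
Unshelve. all: end_near. Qed.

Lemma eq0_at_right (phi : R -> R) : continuous phi ->
  (forall z : R, 0 < z < 1 -> phi z = 0) -> phi 0 = 0.
Proof.
move=> cphi phi0; have h1 : phi z @[z --> 0^'+] --> phi 0.
  by apply: cvg_at_right_filter; exact: cphi.
have h2 : phi z @[z --> 0^'+] --> 0.
  apply: (@cvg_near_cst _ _ _ _ _ (at_right_proper_filter 0)) => //.
  near=> z; apply: phi0; apply/andP; split; near: z.
    exact: nbhs_right_gt.
  exact: nbhs_right_lt.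
exact: (cvg_unique _ h1 h2).
Unshelve. all: end_near. Qed.

(** The segment from s to the interior point (1/4, 1/4). *)
Lemma open_triangle_dense (s : R * R) (t : R) : triangle s -> 0 < t < 1 ->
  open_triangle (s.1 + t * (4^-1 - s.1), s.2 + t * (4^-1 - s.2)).
Proof. by move=> [h1 h2 h3] /andP[t0 t1]; split => /=; nra. Qed.

End OpenSimplices.
Arguments open_triangle {R}.
Arguments open_tetra {R}.

(** * Zeros of polynomials *)

Section PolynomialZeros.
Variable R : realType.
Local Notation C := R[i].
Local Notation poly := (mpoly.mpoly 3 C).
Implicit Types (Q : poly).

Lemma msize_mderiv (j : 'I_3) Q k :
  (mpoly.msize Q <= k.+1)%N -> (mpoly.msize (mpoly.mderiv j Q) <= k)%N.
Proof.
move=> Qk; rewrite mpoly.msizeE; apply/bigmax_leqP_seq => m mQ _.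
move: mQ; rewrite mpoly.mcoeff_msupp mpoly.mcoeff_deriv => h.
have : mpoly.mnm_add m (mpoly.mnm1 j) \in mpoly.msupp Q.
  by rewrite mpoly.mcoeff_msupp; apply: contra h => /eqP ->; rewrite mul0rn.
move=> /mpoly.msize_mdeg_lt; rewrite mpoly.mdegD mpoly.mdeg1 addn1 => h2.
by rewrite -ltnS; exact: leq_trans h2 Qk.
Qed.

(** A monomial other than 1 survives some derivation, in characteristic 0. *)
Lemma mderiv_eq0 Q : (forall j, mpoly.mderiv j Q = 0) ->
  Q = mpoly.mpolyC 3 (mpoly.mcoeff (mpoly.mnm0) Q).
Proof.
move=> dQ; apply/mpoly.mpolyP => m; rewrite mpoly.mcoeffC.
case: eqVneq => [->|m0]; first by rewrite mulr1.
rewrite mulr0; have [i mi] : exists i, (m i != 0)%N.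
  apply/existsP; apply: contra_neqT m0 => /existsPn h.
  by apply/mpoly.mnmP => l; rewrite mpoly.mnm0E; apply/eqP; move: (h l); rewrite negbK.
have mE : m = mpoly.mnm_add (mpoly.mnm_sub m (mpoly.mnm1 i)) (mpoly.mnm1 i).
  rewrite mpoly.submK//; apply/mpoly.mnm_lepP => l.
  by rewrite mpoly.mnm1E; case: eqP => [<-|//]; rewrite lt0n.
have := congr1 (mpoly.mcoeff (mpoly.mnm_sub m (mpoly.mnm1 i))) (dQ i).
rewrite mpoly.mcoeff_deriv -mE mpoly.mcoeff0 => /eqP.
by rewrite mulrn_eq0 /= => /eqP.
Qed.

Lemma pval_pdir_eq0 Q (a b : 'rV[R]_3) :
  (\forall h \near (0 : R), pval Q (a + h *: b) = 0) -> pval (pdir b Q) a = 0.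
Proof.
move=> nQ; have [dr di] := pval_derive Q a b 0.
have cst0 (f : R -> R) (l : R) : (\forall h \near (0 : R), f h = 0) ->
    is_derive (0 : R) (1 : R) f l -> l = 0.
  move=> nf [_ <-].
  rewrite (@near_eq_derive _ _ _ f (fun=> 0) 0 1)//.
  exact: derive_cst.
rewrite scale0r addr0 in dr di.
apply/eqP; rewrite eq_complex; apply/andP; split; apply/eqP.
- by apply: (cst0 _ _ _ dr); near=> h; rewrite /rpval (near nQ h).
- by apply: (cst0 _ _ _ di); near=> h; rewrite /ipval (near nQ h).
Unshelve. all: end_near. Qed.

Lemma near_tetra_map x0 x1 x2 x3 t (d1 d2 d3 : R) : open_tetra t ->
  \forall h \near (0 : R), open_tetra (t.1.1 + h * d1, t.1.2 + h * d2, t.2 + h * d3) /\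
    tetra_map x0 x1 x2 x3 (t.1.1 + h * d1, t.1.2 + h * d2, t.2 + h * d3) =
    tetra_map x0 x1 x2 x3 t + h *: (d1 *: (x1 - x0) + d2 *: (x2 - x0) + d3 *: (x3 - x0)).
Proof.
move=> [t1 t2 t3 t4].
have near_gt0 (a b : R) : 0 < a -> \forall h \near (0 : R), 0 < a + h * b.
  move=> a0; have c : continuous (fun h : R => a + h * b).
    move=> h; apply: cvgD; first exact: cvg_cst.
    by apply: cvgM; [exact: cvg_id|exact: cvg_cst].
  by apply: (cvgr_gt _ (c 0)); rewrite mul0r addr0.
near=> h; split; last first.
  by rewrite /tetra_map /=; apply/rowP => j; rewrite !mxE; ring.
split => /=.
- by near: h; exact: near_gt0.
- by near: h; exact: near_gt0.
- by near: h; exact: near_gt0.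
- rewrite -subr_gt0.
  have -> : 1 - (t.1.1 + h * d1 + (t.1.2 + h * d2) + (t.2 + h * d3)) =
    (1 - (t.1.1 + t.1.2 + t.2)) + h * (- d1 - d2 - d3) by ring.
  by near: h; apply: near_gt0; rewrite subr_gt0.
Unshelve. all: end_near. Qed.

(** Derivatives in the edge directions vanish on the same open set, so that all
    partial derivatives are zero by induction on the degree and Cramer's rule. *)
Lemma pval_eq0 x0 x1 x2 x3 Q : vol (x1 - x0) (x2 - x0) (x3 - x0) != 0 ->
  (forall t, open_tetra t -> pval Q (tetra_map x0 x1 x2 x3 t) = 0) -> Q = 0.
Proof.
move=> D0; move: {2}(mpoly.msize Q) (leqnn (mpoly.msize Q)) => k.
elim: k Q => [|k IH] Q Qk Q0.
  by apply/eqP; rewrite -mpoly.msize_poly_eq0 -leqn0.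
have dQ j : mpoly.mderiv j Q = 0.
  apply: IH; first exact: msize_mderiv.
  move=> t ot.
  have dir (d1 d2 d3 : R) u : u = d1 *: (x1 - x0) + d2 *: (x2 - x0) + d3 *: (x3 - x0) ->
      pval (pdir u Q) (tetra_map x0 x1 x2 x3 t) = 0.
    move=> ->; apply: pval_pdir_eq0.
    have := near_tetra_map x0 x1 x2 x3 d1 d2 d3 ot.
    by apply: filterS => h [oh <-]; exact: Q0.
  have := congr1 (fun P => pval P (tetra_map x0 x1 x2 x3 t))
    (mderiv_cramer (x1 - x0) (x2 - x0) (x3 - x0) j Q).
  rewrite /= 2!(pvalD _ (_ * pdir _ _)) !pvalM.
  rewrite (dir 1 0 0) ?scale1r ?scale0r ?addr0//.
  rewrite (dir 0 1 0) ?scale1r ?scale0r ?addr0 ?add0r//.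
  rewrite (dir 0 0 1) ?scale1r ?scale0r ?addr0 ?add0r//.
  rewrite !mulr0 !addr0 pvalC => /eqP; rewrite mulf_eq0 => /orP[/eqP|/eqP//].
  move=> /(congr1 (@complex.Re R)) /= h.
  by move: D0; rewrite h eqxx.
rewrite (mderiv_eq0 dQ).
have ot : open_tetra (8^-1, 8^-1, 8^-1 : R).
  by split => /=; lra.
have := Q0 _ ot; rewrite {1}(mderiv_eq0 dQ) pvalC => ->.
by rewrite mpoly.mpolyC0.
Qed.

End PolynomialZeros.

(** * Definiteness of the inner products *)

Section Definiteness.
Variables (R : realType) (n : nat) (v : 'I_n -> 'rV[R]_3).
Local Notation C := R[i].
Local Notation poly := (mpoly.mpoly 3 C).
Implicit Types (K F : {set 'I_n}) (f : 'rV[R]_3 -> C) (Q : poly).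

(** The zeros in the relative interior extend to the closed face by continuity
    along segments. *)
Lemma face_integral_eq0 F f : #|F| = 3%N -> face_cross v F != 0 ->
  poly_on (hull v F) f -> (forall x, hull v F x -> 0 <= complex.Re (f x)) ->
  complex.Re (face_integral v F f) = 0 ->
  forall x, hull v F x -> complex.Re (f x) = 0.
Proof.
rewrite cardE => cF f0 [Q fQ] fge0.
case eF : (enum F) cF => [|a [|b [|c []]]]// _.
have hF := hull_triangle_map v eF; have pF s := fparamE v eF s.
have FF s : triangle s -> hull v F (triangle_map (v a) (v b) (v c) s).
  by move=> hs; rewrite hF; exists s.
rewrite /face_integral Re_rM => /eqP; rewrite mulf_eq0 gt_eqF ?enorm_gt0//= => /eqP int0.
pose psi s := rpval Q (triangle_map (v a) (v b) (v c) s).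
have psi0 s : triangle s -> 0 <= psi s.
  by move=> hs; rewrite /psi /rpval -fQ; [exact/fge0/FF|exact: FF].
have cpsi : continuous psi.
  apply: (pval_continuous Q _).1 => j s; rewrite /triangle_map; under eq_fun do rewrite !mxE.
  apply: cvgD; first apply: cvgD; first exact: cvg_cst.
    by apply: cvgM; [exact: cvg_fst|exact: cvg_cst].
  by apply: cvgM; [exact: cvg_snd|exact: cvg_cst].
have psi_int : \int[@plane_measure R]_(s in triangle) psi s = 0.
  rewrite -[RHS]int0; apply: eq_Rintegral => s /set_mem hs.
  by rewrite pF fQ//; exact: FF.
have psi_open := triangle_integral_eq0 (integrable_triangle_map Q _ _ _) cpsi psi0 psi_int.
move=> x; rewrite hF => -[s hs <-].
rewrite fQ; last exact: FF.
pose phi (z : R) := psi (s.1 + z * (4^-1 - s.1), s.2 + z * (4^-1 - s.2)).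
have -> : complex.Re (pval Q (triangle_map (v a) (v b) (v c) s)) = phi 0.
  by rewrite /phi /psi /rpval !mul0r !addr0; congr (complex.Re (pval _ _)); case: (s).
apply: eq0_at_right.
  apply: (pval_continuous Q _).1 => j z; rewrite /triangle_map /=; under eq_fun do rewrite !mxE.
  have cz (p q : R) : y * p + q @[y --> z] --> z * p + q.
    by apply: cvgD; [apply: cvgM; [exact: cvg_id|exact: cvg_cst]|exact: cvg_cst].
  have cz' (p q : R) : q + y * p @[y --> z] --> q + z * p.
    by apply: cvgD; [exact: cvg_cst|apply: cvgM; [exact: cvg_id|exact: cvg_cst]].
  apply: cvgD; first apply: cvgD; first exact: cvg_cst.
    by apply: cvgM; [exact: cz'|exact: cvg_cst].
  by apply: cvgM; [exact: cz'|exact: cvg_cst].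
by move=> z hz; exact/psi_open/open_triangle_dense.
Qed.

Lemma dot_conj_ge0 (u : 'rV[C]_3) : 0 <= complex.Re (dotv u (conjv u)).
Proof.
rewrite dotvE !mxE !ReD.
have h (z : C) : 0 <= complex.Re (z * z^*%C).
  by case: z => a b; rewrite /= mulrN opprK addr_ge0// -expr2 sqr_ge0.
by rewrite !addr_ge0.
Qed.

Lemma dot_conj_eq0 (u : 'rV[C]_3) : complex.Re (dotv u (conjv u)) = 0 -> u = 0.
Proof.
have h (z : C) : 0 <= complex.Re (z * z^*%C).
  by case: z => a b; rewrite /= mulrN opprK addr_ge0// -expr2 sqr_ge0.
have h0 (z : C) : complex.Re (z * z^*%C) = 0 -> z = 0.
  case: z => a b; rewrite /= mulrN opprK => /eqP.
  rewrite -!expr2 paddr_eq0 ?sqr_ge0// !sqrf_eq0 => /andP[/eqP -> /eqP ->] //.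
rewrite dotvE !mxE !ReD => /eqP; rewrite !paddr_eq0 ?addr_ge0// -andbA.
move=> /and3P[/eqP /h0 u0 /eqP /h0 u1 /eqP /h0 u2].
by apply/rowP; apply: forall3; rewrite mxE.
Qed.

Lemma element_integral_eq0 K (q : 'rV[poly]_3) :
  #|K| = 4%N -> affinely_independent v K ->
  complex.Re (element_integral v K (fun x => dotv (peval q x) (conjv (peval q x)))) = 0 ->
  q = 0.
Proof.
rewrite cardE => cK aff.
case eK : (enum K) cK => [|k0 [|k1 [|k2 [|k3 []]]]]// _.
have D0 := vol_neq0 (enum_perm eK) aff; have hK := hull_simplex4 v eK.
pose P := dotv q (pconjv q).
have PE x : pval P x = dotv (peval q x) (conjv (peval q x)).
  by rewrite pval_dot peval_conj.
move=> int0.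
have : simplex_integral P (v k0) (v k1) (v k2) (v k3) = 0.
  rewrite -[RHS]int0 /simplex_integral -hK.
  by apply: eq_Rintegral => t _; rewrite /rpval PE.
rewrite simplex_integral_param// => /eqP; rewrite mulf_eq0 normr_eq0 (negbTE D0) /=.
move=> /eqP int1.
pose psi t := rpval P (tetra_map (v k0) (v k1) (v k2) (v k3) t).
have psi0 t : tetra t -> 0 <= psi t by rewrite /psi /rpval PE dot_conj_ge0.
have cpsi : continuous psi.
  apply: (pval_continuous P _).1 => j t; rewrite /tetra_map; under eq_fun do rewrite !mxE.
  have c0 : y.1 @[y --> t] --> t.1 by exact: cvg_fst.
  have c1 : y.1.1 @[y --> t] --> t.1.1 by apply: (cvg_comp _ _ c0); exact: cvg_fst.
  have c2 : y.1.2 @[y --> t] --> t.1.2 by apply: (cvg_comp _ _ c0); exact: cvg_snd.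
  have c3 : y.2 @[y --> t] --> t.2 by exact: cvg_snd.
  have cm (g : R * R * R -> R) (l r : R) : g y @[y --> t] --> l -> g y * r @[y --> t] --> l * r.
    by move=> cg; apply: cvgM; [exact: cg|exact: cvg_cst].
  apply: cvgD; [apply: cvgD; [apply: cvgD; [exact: cvg_cst|]|]|]; exact: cm.
have ipsi : (@space_measure R).-integrable tetra (EFin \o psi).
  apply: measurable_bounded_integrable.
  - exact: measurable_tetra.
  - exact: tetra_fin.
  - apply: measurable_funTS; apply: (pval_measurable P _).1; exact: measurable_tetra_map.
  - exact/rpval_bounded_on/tetra_map_bounded.
have psi_open := tetra_integral_eq0 ipsi cpsi psi0 int1.
have q0 t : open_tetra t -> peval q (tetra_map (v k0) (v k1) (v k2) (v k3) t) = 0.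
  by move=> /psi_open; rewrite /psi /rpval PE => /dot_conj_eq0.
apply/rowP => j; rewrite [RHS]mxE; apply: (pval_eq0 D0) => t /q0.
by move=> /(congr1 (fun u : 'rV[C]_3 => u 0 j)); rewrite peval_coord mxE.
Qed.

End Definiteness.

(** * Hermitian algebra at a point of a face *)

Section CrossProducts.
Variable A : comNzRingType.
Implicit Types a b c N : 'rV[A]_3.

Lemma crossDr N a b : crossv N (a + b) = crossv N a + crossv N b.
Proof. by apply/rowP => j; rewrite !mxE; ring. Qed.
Lemma crossNr N a : crossv N (- a) = - crossv N a.
Proof. by apply/rowP => j; rewrite !mxE; ring. Qed.
Lemma crossZr N r a : crossv N (r *: a) = r *: crossv N a.
Proof. by apply/rowP => j; rewrite !mxE; ring. Qed.
Lemma cross_skew N a b : dotv (crossv N a) b = - dotv a (crossv N b).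
Proof. by rewrite !dotvE !crossvE; ring. Qed.

Lemma cross_cross N a : crossv N (crossv N a) = dotv N a *: N - dotv N N *: a.
Proof.
by apply/rowP; apply: forall3; rewrite !crossvE !mxE !dotvE; ring.
Qed.
End CrossProducts.

Section Hermitian.
Variable R : realType.
Local Notation C := R[i].
Implicit Types (a b c : 'rV[C]_3) (m : 'rV[R]_3).

Definition herm a b : C := dotv a (conjv b).

Lemma conjvD a b : conjv (a + b) = conjv a + conjv b.
Proof. by apply/rowP => j; rewrite !mxE conjCD. Qed.
Lemma conjCN (z : C) : conjc (- z) = - conjc z.
Proof. by case: z. Qed.
Lemma conjvN a : conjv (- a) = - conjv a.
Proof. by apply/rowP => j; rewrite !mxE conjCN. Qed.
Lemma conjv_toC m : conjv (toC m) = toC m.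
Proof. by apply/rowP => j; rewrite !mxE conj_real. Qed.
Lemma conjv_cross a b : conjv (crossv a b) = crossv (conjv a) (conjv b).
Proof. by apply/rowP => j; rewrite !mxE conjCD conjCN !conjCM. Qed.

Lemma hermDl a b c : herm (a + b) c = herm a c + herm b c.
Proof. exact: dotDl. Qed.
Lemma hermNl a b : herm (- a) b = - herm a b.
Proof. exact: dotNl. Qed.
Lemma hermZl r a b : herm (r *: a) b = r * herm a b.
Proof. exact: dotZl. Qed.
Lemma hermDr a b c : herm a (b + c) = herm a b + herm a c.
Proof. by rewrite /herm conjvD dotDr. Qed.
Lemma hermNr a b : herm a (- b) = - herm a b.
Proof. by rewrite /herm conjvN dotNr. Qed.
Lemma hermC a b : herm b a = conjc (herm a b).
Proof.
have cK (z : C) : conjc (conjc z) = z by case: z => x y; rewrite /= opprK.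
rewrite /herm !dotvE !conjCD !conjCM !mxE !cK.
by congr (_ + _ + _); rewrite mulrC.
Qed.
Lemma Re_hermC a b : complex.Re (herm b a) = complex.Re (herm a b).
Proof. by rewrite hermC; case: (herm a b). Qed.

Section UnitNormal.
Variable m : 'rV[R]_3.
Hypothesis mm : dotv m m = 1.
Let N := toC m.
Local Notation tc := (tcomp m).

Let NN : dotv N N = 1.
Proof.
have := congr1 (real_complex R) mm; rewrite !dotvE !mxE !rmorphD !rmorphM.
by move=> ->.
Qed.

Lemma herm_cross a b : herm (crossv N a) b = - herm a (crossv N b).
Proof. by rewrite /herm cross_skew conjv_cross conjv_toC. Qed.

Lemma tcompE a : tc a = a - dotv N a *: N.
Proof. by rewrite /tcomp -/N cross_cross NN scale1r opprB. Qed.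

Lemma cross_tcomp a : crossv N (tc a) = crossv N a.
Proof.
rewrite tcompE crossDr crossNr crossZr.
have -> : crossv N N = 0 by apply/rowP => j; rewrite !mxE; ring.
by rewrite scaler0 subr0.
Qed.

Lemma herm_cross_tcomp a b : herm (crossv N a) (tc b) = herm (crossv N a) b.
Proof. by rewrite !herm_cross cross_tcomp. Qed.

Lemma herm_tcomp a b : herm (tc a) (tc b) = herm (crossv N a) (crossv N b).
Proof.
by rewrite {1}/tcomp -/N hermNl herm_cross opprK cross_tcomp.
Qed.

(** Testing both equations of the local problem with (e, h) and subtracting the
    boundary term of Green's formula leaves this expression on a face. It is a
    combination of squares because crossing with m is skew-Hermitian, and an
    isometry of the plane orthogonal to m. *)
Lemma pointwise_energy e h g :
  complex.Re (herm (2^-1 *: (tc e - crossv N h)) (tc e)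
    + herm (2^-1 *: crossv N (tc e - crossv N h)) (tc h)
    - herm (2^-1 *: g) (tc e) + herm (2^-1 *: crossv N g) (tc h)
    - herm (crossv N e) h) =
  - 4^-1 * (complex.Re (herm g g)
    - complex.Re (herm (g - (tc e + crossv N h)) (g - (tc e + crossv N h)))
    - complex.Re (herm (tc e - crossv N h) (tc e - crossv N h))).
Proof.
have half : (2^-1 : C) = (2^-1 : R)%:C%C by rewrite fmorphV rmorph_nat.
have F1 : herm (crossv N e) (tc h) = herm (crossv N e) h.
  exact: herm_cross_tcomp.
have F2 : herm (crossv N g) (tc h) = - herm g (crossv N h).
  by rewrite herm_cross_tcomp herm_cross.
have F3 : complex.Re (herm (crossv N h) (tc e)) =
    - complex.Re (herm (crossv N e) h).
  by rewrite herm_cross_tcomp herm_cross ReN Re_hermC.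
have F4 := herm_tcomp h h.
have crossgp : crossv N (tc e - crossv N h) = crossv N e + tc h.
  by rewrite crossDr crossNr cross_tcomp.
rewrite crossgp !hermZl F2.
move: (tc e) (tc h) (crossv N e) (crossv N h) F1 F3 F4 => a b p q F1 F3 F4.
rewrite !(hermDl, hermNl) !(hermDr, hermNr) F1 F4 half.
rewrite !(ReD, ReN, Re_rM).
rewrite F3 (Re_hermC q a) F3 (Re_hermC g a) (Re_hermC g q).
lra.
Qed.

End UnitNormal.
End Hermitian.

(** * Energy identity of the local problem *)

Section RealIntegral.
Variables (R : realType) (S : set 'rV[R]_3) (J : ('rV[R]_3 -> R[i]) -> R[i]).
Hypothesis HJ : integral_on S J.
Implicit Types f g : 'rV[R]_3 -> R[i].

Lemma integral_onN f : poly_on S f -> J (fun x => - f x) = - J f.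
Proof.
move=> pf; rewrite -[RHS]mulN1r -(integral_onZ HJ)//.
by apply: (integral_on_ext HJ) => x _; rewrite mulN1r.
Qed.

Lemma integral_onB f g : poly_on S f -> poly_on S g ->
  J (fun x => f x - g x) = J f - J g.
Proof.
move=> pf pg; rewrite -integral_onN// -(integral_onD HJ)//.
exact: poly_onN.
Qed.

Lemma integral_on_Re f g : poly_on S f -> poly_on S g ->
  (forall x, S x -> complex.Re (f x) = complex.Re (g x)) ->
  complex.Re (J f) = complex.Re (J g).
Proof.
move=> pf pg fg.
have le f1 f2 : poly_on S f1 -> poly_on S f2 ->
    (forall x, S x -> complex.Re (f1 x) = complex.Re (f2 x)) ->
    complex.Re (J f1) <= complex.Re (J f2).
  move=> p1 p2 f12; rewrite -subr_ge0 -ReN -ReD -(integral_onB p2 p1).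
  by apply: (integral_on_ge0 HJ) => x Sx; rewrite ReD ReN f12// subrr.
by apply: le_anti; rewrite !le// => x Sx; rewrite fg.
Qed.

(** The functions are variables here to keep integrands folded in rewriting. *)
Lemma Re_integral_balance (r : R) fA fB fC fE fG f g k :
  poly_on S fA -> poly_on S fB -> poly_on S fC -> poly_on S fE -> poly_on S fG ->
  poly_on S f -> poly_on S g -> poly_on S k ->
  (forall x, S x -> complex.Re (fA x + fB x - fC x + fE x - fG x) =
    r * (complex.Re (f x) - complex.Re (g x) - complex.Re (k x))) ->
  complex.Re (J fA) + complex.Re (J fB) - complex.Re (J fC) + complex.Re (J fE)
    - complex.Re (J fG) =
  r * (complex.Re (J f) - complex.Re (J g) - complex.Re (J k)).
Proof.
move=> pA pB pC pE pG pf pg pk bal.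
have pAB := poly_onD pA pB; have pABC := poly_onB pAB pC.
have pABCE := poly_onD pABC pE; have pfg := poly_onB pf pg.
have pfgk := poly_onB pfg pk.
transitivity (complex.Re (J (fun x => fA x + fB x - fC x + fE x - fG x))).
  rewrite (integral_onB pABCE pG) (integral_onD HJ pABC pE) (integral_onB pAB pC).
  by rewrite (integral_onD HJ pA pB) !(ReD, ReN).
transitivity (complex.Re (J (fun x => r%:C%C * (f x - g x - k x)))).
  apply: integral_on_Re; [exact: poly_onB|exact: poly_onZ|].
  by move=> x Sx; rewrite bal// Re_rM !(ReD, ReN).
rewrite (integral_onZ HJ _ pfgk) (integral_onB pfg pk) (integral_onB pf pg).
by rewrite Re_rM !(ReD, ReN).
Qed.

End RealIntegral.

(** The real part of the local problem tested with its own solution: T1 and T2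
    are the mass terms, c1 and c2 the curl terms, and the last equation is Green's
    formula. *)
Lemma Re_energy_sum (R : realType) (I : finType) (P : {pred I})
    (T1 T2 c1 c2 c3 : R[i]) (SA SB SC SE SG : I -> R[i]) :
  complex.Re T1 = 0 -> complex.Re T2 = 0 -> complex.Re c1 = complex.Re c3 ->
  T1 - c1 + \sum_(i in P) SA i = \sum_(i in P) SC i ->
  T2 + c2 + \sum_(i in P) SB i = - \sum_(i in P) SE i ->
  c3 - c2 = \sum_(i in P) SG i ->
  \sum_(i in P) (complex.Re (SA i) + complex.Re (SB i) - complex.Re (SC i)
    + complex.Re (SE i) - complex.Re (SG i)) = 0.
Proof.
move=> t1 t2 c13 /(congr1 (@complex.Re R)) + /(congr1 (@complex.Re R)) +
  /(congr1 (@complex.Re R)).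
rewrite !(ReD, ReN) t1 t2 c13 !Re_sum => h1 h2 h3.
rewrite sumrB big_split sumrB big_split /=; lra.
Qed.

Lemma sum_balance (R : realType) (I : finType) (P : {pred I}) (f g k : I -> R) :
  \sum_(i in P) - 4^-1 * (f i - g i - k i) = 0 ->
  \sum_(i in P) f i = \sum_(i in P) k i + \sum_(i in P) g i.
Proof. by rewrite -mulr_sumr !sumrB; lra. Qed.

(** Volume terms T and d of the weak and the strong form of an equation agree if
    the face terms of the weak form are those of Green's formula. *)
Lemma weak_to_strong (C : zmodType) (I : finType) (P : {pred I}) (T c d : C)
    (SA SC SG : I -> C) :
  T - c + \sum_(i in P) SA i = \sum_(i in P) SC i ->
  d - c = \sum_(i in P) SG i ->
  (forall i, i \in P -> SC i - SA i = SG i) -> T = d.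
Proof.
move=> h1 h2 h3.
have : \sum_(i in P) (SC i - SA i) = \sum_(i in P) SG i by exact: eq_bigr.
rewrite sumrB -h2 -h1 addrK.
by move/(congr1 (fun z => z + c)); rewrite !subrK.
Qed.

Lemma weak_to_strongN (C : zmodType) (I : finType) (P : {pred I}) (T c d : C)
    (SB SE SG : I -> C) :
  T + c + \sum_(i in P) SB i = - \sum_(i in P) SE i ->
  d - c = \sum_(i in P) SG i ->
  (forall i, i \in P -> SG i = SE i + SB i) -> T = - d.
Proof.
move=> h1 h2 h3.
have : \sum_(i in P) SG i = \sum_(i in P) (SE i + SB i) by exact: eq_bigr.
rewrite big_split /= -h2 -[\sum_(i in P) SE i]opprK -h1 !opprD subrK.
by move=> /addIr ->; rewrite opprK.
Qed.

Section VectorFields.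
Variable R : realType.
Local Notation C := R[i].
Local Notation poly := (mpoly.mpoly 3 C).
Implicit Types (S : set 'rV[R]_3) (f g : 'rV[R]_3 -> 'rV[C]_3) (m : 'rV[R]_3).

Definition vpoly_on S f := exists q : 'rV[poly]_3, forall x, S x -> f x = peval q x.

Lemma vpoly_on_peval S (q : 'rV[poly]_3) : vpoly_on S (peval q).
Proof. by exists q. Qed.

Lemma pevalD (a b : 'rV[poly]_3) (x : 'rV[R]_3) :
  peval (a + b) x = peval a x + peval b x.
Proof. by apply/rowP => j; rewrite !mxE; exact: mpoly.mevalD. Qed.

Lemma pevalZ (c : C) (a : 'rV[poly]_3) (x : 'rV[R]_3) :
  peval (mpoly.mpolyC 3 c *: a) x = c *: peval a x.
Proof. by apply/rowP => j; rewrite !mxE mpoly.mevalM mpoly.mevalC. Qed.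

Lemma peval_const (m : 'rV[R]_3) (x : 'rV[R]_3) :
  peval (map_mx (@mpoly.mpolyC 3 C) (toC m)) x = toC m.
Proof. by apply/rowP => j; rewrite !mxE mpoly.mevalC. Qed.

Lemma vpoly_onD S f g : vpoly_on S f -> vpoly_on S g -> vpoly_on S (fun x => f x + g x).
Proof. by move=> [p hp] [q hq]; exists (p + q) => x Sx; rewrite pevalD hp// hq. Qed.

Lemma vpoly_onZ S c f : vpoly_on S f -> vpoly_on S (fun x => c *: f x).
Proof.
by move=> [p hp]; exists (mpoly.mpolyC 3 c *: p) => x Sx; rewrite pevalZ hp.
Qed.

Lemma vpoly_onN S f : vpoly_on S f -> vpoly_on S (fun x => - f x).
Proof. by move=> [p hp]; exists (- p) => x Sx; rewrite pevalN hp. Qed.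

Lemma vpoly_onB S f g : vpoly_on S f -> vpoly_on S g -> vpoly_on S (fun x => f x - g x).
Proof. by move=> hf /vpoly_onN; exact: vpoly_onD. Qed.

Lemma vpoly_on_cross S m f : vpoly_on S f -> vpoly_on S (fun x => crossv (toC m) (f x)).
Proof.
move=> [p hp]; exists (crossv (map_mx (@mpoly.mpolyC 3 C) (toC m)) p) => x Sx.
by rewrite peval_crossv peval_const hp.
Qed.

Lemma vpoly_on_tcomp S m f : vpoly_on S f -> vpoly_on S (fun x => tcomp m (f x)).
Proof. by move=> hf; apply/vpoly_onN/vpoly_on_cross/vpoly_on_cross. Qed.

Lemma poly_on_herm S f g : vpoly_on S f -> vpoly_on S g ->
  poly_on S (fun x => herm (f x) (g x)).
Proof.
move=> [p hp] [q hq]; exists (dotv p (pconjv q)) => x Sx.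
by rewrite pval_dot peval_conj hp// hq.
Qed.

End VectorFields.

Section CurlSystem.
Variable R : realType.
Local Notation C := R[i].
Local Notation poly := (mpoly.mpoly 3 C).
Implicit Types (e h : 'rV[poly]_3).

Lemma msize_curl e k : (forall j, mpoly.msize (e 0%R j) <= k.+1)%N ->
  forall j, (mpoly.msize (curl e 0%R j) <= k)%N.
Proof.
move=> ek j; rewrite mxE; apply: leq_trans (mpoly.mmeasureD_le _ _ _) _.
by rewrite mpoly.mmeasureN geq_max; apply/andP; split; apply: msize_mderiv.
Qed.

(** Each curl lowers the degree, so that e and h, which are curls of each other
    up to a factor, have arbitrarily low degree. *)
Lemma curl_system_eq0 (c : C) e h : c != 0 ->
  mpoly.mpolyC 3 c *: e = curl h -> mpoly.mpolyC 3 c *: h = - curl e ->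
  e = 0 /\ h = 0.
Proof.
move=> c0 eE hE.
have eEj j : c *: e 0 j = curl h 0 j by rewrite -eE mxE mpoly.mul_mpolyC.
have hEj j : c *: h 0 j = - curl e 0 j.
  have := congr1 (fun u : 'rV[poly]_3 => u 0 j) hE.
  by rewrite [LHS]mxE [RHS]mxE mpoly.mul_mpolyC.
suff H k : (forall j, mpoly.msize (e 0%R j) <= k)%N /\
    (forall j, mpoly.msize (h 0%R j) <= k)%N -> e = 0 /\ h = 0.
  pose k := (\max_j mpoly.msize (e 0%R j) + \max_j mpoly.msize (h 0%R j))%N.
  apply: (H k); split => j; rewrite /k.
    exact: leq_trans (leq_bigmax j) (leq_addr _ _).
  exact: leq_trans (leq_bigmax j) (leq_addl _ _).
elim: k => [[ek hk]|k IH [ek hk]].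
  by split; apply/rowP => j; rewrite mxE; apply/eqP;
    rewrite -mpoly.msize_poly_eq0 -leqn0.
apply: IH; split => j.
  by rewrite -(mpoly.msizeZ _ c0) eEj; exact: msize_curl.
by rewrite -(mpoly.msizeZ _ c0) hEj mpoly.mmeasureN; exact: msize_curl.
Qed.

End CurlSystem.

Section LocalProblem.
Variables (R : realType) (kappa : R) (p n : nat) (v : 'I_n -> 'rV[R]_3).
Variable K : {set 'I_n}.
Hypotheses (kappa_gt0 : 0 < kappa) (cK : #|K| = 4%N) (aff : affinely_independent v K).
Local Notation C := R[i].
Local Notation poly := (mpoly.mpoly 3 C).
Variables (gm : {set 'I_n} -> 'rV[R]_3 -> 'rV[C]_3) (e h : 'rV[poly]_3).
Hypothesis gmP : forall F, F \in faces K -> vpoly_on (hull v F) (gm F).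
Hypothesis sol : local_solution kappa p v K gm e h.

Let N F := toC (outward_normal v K F).
Let tc F := tcomp (outward_normal v K F).
Let IF F := face_integral v F.
Let IK := element_integral v K.

(** The other characteristic variable, which is gplus for the reversed normal; the
    local problem makes it match the data weakly. *)
Definition gminus F x := tctrace v K F (peval e) x + ttrace v K F (peval h) x.

Lemma face_card F : F \in faces K -> #|F| = 3%N.
Proof. by rewrite inE => /andP[_ /eqP]. Qed.

Lemma face_nondegenerate F : F \in faces K ->
  face_cross v F != 0 /\ dotv (outward_normal v K F) (outward_normal v K F) = 1.
Proof.
move=> FK; have [k [a [b [c [KF eF S0]]]]] := face_opposite cK aff FK.
by split; [exact: (face_cross_neq0 eF S0)|exact: (outward_normal_unit _ eF S0)].
Qed.

Let HIF F : F \in faces K -> integral_on (hull v F) (IF F).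
Proof. by move=> /face_card cF; exact: face_integral_on. Qed.
Let HIK : integral_on (hull v K) IK.
Proof. exact: element_integral_on. Qed.

(** The local problem is tested with its own solution. *)
Lemma energy_identity :
  \sum_(F in faces K) complex.Re (IF F (fun x => herm (gm F x) (gm F x))) =
  \sum_(F in faces K)
    complex.Re (IF F (fun x => herm (gplus v K F e h x) (gplus v K F e h x)))
  + \sum_(F in faces K)
    complex.Re (IF F (fun x => herm (gm F x - gminus F x) (gm F x - gminus F x))).
Proof.
have [eP hP eq] := sol; have [eq1 eq2] := eq e h eP hP.
have pe S : vpoly_on S (peval e) by exact: vpoly_on_peval.
have ph S : vpoly_on S (peval h) by exact: vpoly_on_peval.
pose fA F x := herm (2^-1 *: (tc F (peval e x) - crossv (N F) (peval h x)))
  (tc F (peval e x)).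
pose fB F x := herm (2^-1 *: crossv (N F) (tc F (peval e x) - crossv (N F) (peval h x)))
  (tc F (peval h x)).
pose fC F x := herm (2^-1 *: gm F x) (tc F (peval e x)).
pose fE F x := herm (2^-1 *: crossv (N F) (gm F x)) (tc F (peval h x)).
pose fG F x := herm (crossv (N F) (peval e x)) (peval h x).
have ptc F S f : vpoly_on S f -> vpoly_on S (fun x => tc F (f x)).
  exact: vpoly_on_tcomp.
have pN F S f : vpoly_on S f -> vpoly_on S (fun x => crossv (N F) (f x)).
  exact: vpoly_on_cross.
have pA F S : poly_on S (fA F).
  by apply: poly_on_herm; [apply/vpoly_onZ/vpoly_onB|]; auto.
have pB F S : poly_on S (fB F).
  by apply: poly_on_herm; [apply/vpoly_onZ/pN/vpoly_onB|]; auto.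
have pC F : F \in faces K -> poly_on (hull v F) (fC F).
  by move=> FK; apply: poly_on_herm; [exact/vpoly_onZ/gmP|]; auto.
have pE F : F \in faces K -> poly_on (hull v F) (fE F).
  by move=> FK; apply: poly_on_herm; [exact/vpoly_onZ/pN/gmP|]; auto.
have pG F S : poly_on S (fG F) by apply: poly_on_herm; auto.
have green_eh : IK (fun x => herm (peval (curl e) x) (peval h x))
    - IK (fun x => herm (peval e x) (peval (curl h) x)) =
    \sum_(F in faces K) IF F (fG F) := green e h cK aff.
have real_self (q : 'rV[poly]_3) :
    complex.Re ('i%C * kappa%:C%C * IK (fun x => herm (peval q x) (peval q x))) = 0.
  have : IK (fun x => herm (peval q x) (peval q x)) =
      conjc (IK (fun x => herm (peval q x) (peval q x))).
    rewrite -(integral_on_conj HIK); last by apply: poly_on_herm; exact: vpoly_on_peval.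
    by apply: (integral_on_ext HIK) => x _; exact: hermC.
  case: (IK _) => a b [] /eqP.
  rewrite -subr_eq0 opprK -mulr2n mulrn_eq0 /= => /eqP ->.
  ring.
have curl_swap : complex.Re (IK (fun x => herm (peval h x) (peval (curl e) x))) =
    complex.Re (IK (fun x => herm (peval (curl e) x) (peval h x))).
  apply: (integral_on_Re HIK); try (by apply: poly_on_herm; exact: vpoly_on_peval).
  by move=> x _; exact: Re_hermC.
have sum0 : \sum_(F in faces K) (complex.Re (IF F (fA F)) + complex.Re (IF F (fB F))
    - complex.Re (IF F (fC F)) + complex.Re (IF F (fE F))
    - complex.Re (IF F (fG F))) = 0.
  have eq1' : 'i%C * kappa%:C%C * IK (fun x => herm (peval e x) (peval e x))
      - IK (fun x => herm (peval h x) (peval (curl e) x))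
      + \sum_(F in faces K) IF F (fA F) = \sum_(F in faces K) IF F (fC F) := eq1.
  have eq2' : 'i%C * kappa%:C%C * IK (fun x => herm (peval h x) (peval h x))
      + IK (fun x => herm (peval e x) (peval (curl h) x))
      + \sum_(F in faces K) IF F (fB F) = - \sum_(F in faces K) IF F (fE F) := eq2.
  exact: (Re_energy_sum (real_self e) (real_self h) curl_swap eq1' eq2' green_eh).
pose Gg F := complex.Re (IF F (fun x => herm (gm F x) (gm F x))).
pose Gd F := complex.Re (IF F (fun x =>
  herm (gm F x - gminus F x) (gm F x - gminus F x))).
pose Gp F := complex.Re (IF F (fun x =>
  herm (gplus v K F e h x) (gplus v K F e h x))).
have face F : F \in faces K -> complex.Re (IF F (fA F)) + complex.Re (IF F (fB F))
    - complex.Re (IF F (fC F)) + complex.Re (IF F (fE F)) - complex.Re (IF F (fG F))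
    = - 4^-1 * (Gg F - Gd F - Gp F).
  move=> FK; have [_ NN] := face_nondegenerate FK.
  have pg : poly_on (hull v F) (fun x => herm (gm F x) (gm F x)).
    by apply: poly_on_herm; exact: gmP.
  have pgm : vpoly_on (hull v F) (gminus F).
    exact: (vpoly_onD (ptc F _ _ (pe _)) (pN F _ _ (ph _))).
  have pd : poly_on (hull v F) (fun x => herm (gm F x - gminus F x) (gm F x - gminus F x)).
    have pdv := vpoly_onB (gmP FK) pgm; exact: (poly_on_herm pdv pdv).
  have pp : poly_on (hull v F)
      (fun x => herm (gplus v K F e h x) (gplus v K F e h x)).
    have ppv := vpoly_onB (ptc F _ _ (pe (hull v F))) (pN F _ _ (ph _)).
    exact: (poly_on_herm ppv ppv).
  have JF := HIF FK.
  apply: (Re_integral_balance JF (pA F _) (pB F _) (pC F FK) (pE F FK) (pG F _)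
    pg pd pp) => x _.
  exact: (pointwise_energy NN).
exact: (sum_balance (etrans (esym (eq_bigr _ face)) sum0)).
Qed.

Lemma Pp_curl (q : 'rV[poly]_3) : Pp p q -> Pp p (curl q).
Proof.
move=> qP j; apply: leq_trans _ (leqnSn p); exact: (@msize_curl R q p qP j).
Qed.

Lemma Pp_scale c (q : 'rV[poly]_3) : Pp p q -> Pp p (mpoly.mpolyC 3 c *: q).
Proof.
move=> qP j; rewrite mxE mpoly.mul_mpolyC.
exact: leq_trans (mpoly.mmeasureZ_le _ _ _) (qP j).
Qed.

(** If g = g' on the faces, the face terms of the weak form are those of Green's
    formula. What is left are weak forms of i kappa e = curl h and
    i kappa h = - curl e; tested with their own residuals, which have degree at
    most p, they give these equations strongly. *)
Lemma local_solution_eq0 :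
  (forall F x, F \in faces K -> hull v F x -> gm F x = gminus F x) ->
  e = 0 /\ h = 0.
Proof.
move=> gE; have [eP hP eq] := sol.
have pe (q : 'rV[poly]_3) S : vpoly_on S (peval q) by exact: vpoly_on_peval.
have ptc F S f : vpoly_on S f -> vpoly_on S (fun x => tc F (f x)).
  exact: vpoly_on_tcomp.
have pN F S f : vpoly_on S f -> vpoly_on S (fun x => crossv (N F) (f x)).
  exact: vpoly_on_cross.
pose k : C := 'i%C * kappa%:C%C.
have k0 : k != 0.
  by rewrite mulf_neq0//; rewrite eq_complex /= ?eqxx ?oner_eq0 ?andbF ?andbT ?gt_eqF.
have two : (2 : C) != 0 by rewrite pnatr_eq0.
have strong1 (q : 'rV[poly]_3) : Pp p q ->
    k * IK (fun x => herm (peval e x) (peval q x)) =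
    IK (fun x => herm (peval (curl h) x) (peval q x)).
  move=> qP; have [eq1 _] := eq q q qP qP.
  pose fA F x := herm (2^-1 *: (tc F (peval e x) - crossv (N F) (peval h x)))
    (tc F (peval q x)).
  pose fC F x := herm (2^-1 *: gm F x) (tc F (peval q x)).
  pose fG F x := herm (crossv (N F) (peval h x)) (peval q x).
  have eq1' : k * IK (fun x => herm (peval e x) (peval q x))
      - IK (fun x => herm (peval h x) (peval (curl q) x))
      + \sum_(F in faces K) IF F (fA F) = \sum_(F in faces K) IF F (fC F) := eq1.
  apply: (weak_to_strong eq1' (green h q cK aff)) => F FK.
  have [_ NN] := face_nondegenerate FK; have JF := HIF FK.
  have pC : poly_on (hull v F) (fC F).
    exact: (poly_on_herm (vpoly_onZ _ (gmP FK)) (ptc F _ _ (pe q _))).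
  have pA : poly_on (hull v F) (fA F).
    exact: (poly_on_herm (vpoly_onZ _ (vpoly_onB (ptc F _ _ (pe e _))
      (pN F _ _ (pe h _)))) (ptc F _ _ (pe q _))).
  rewrite -(integral_onB JF pC pA) -[RHS]/(IF F (fG F)).
  apply: (integral_on_ext JF) => x Fx.
  rewrite /fC /fA /fG gE// -[gminus F x]/(tc F (peval e x) + crossv (N F) (peval h x)).
  have := herm_cross_tcomp NN (peval h x) (peval q x); rewrite -/(N F) -/(tc F).
  move: (tc F (peval e x)) (crossv (N F) (peval h x)) (tc F (peval q x)) => a s t st.
  rewrite !hermZl !(hermDl, hermNl) -[RHS]st.
  by field.
have strong2 (r : 'rV[poly]_3) : Pp p r ->
    k * IK (fun x => herm (peval h x) (peval r x)) =
    - IK (fun x => herm (peval (curl e) x) (peval r x)).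
  move=> rP; have [_ eq2] := eq r r rP rP.
  pose fB F x := herm (2^-1 *: crossv (N F) (tc F (peval e x) - crossv (N F) (peval h x)))
    (tc F (peval r x)).
  pose fE F x := herm (2^-1 *: crossv (N F) (gm F x)) (tc F (peval r x)).
  have eq2' : k * IK (fun x => herm (peval h x) (peval r x))
      + IK (fun x => herm (peval e x) (peval (curl r) x))
      + \sum_(F in faces K) IF F (fB F) = - \sum_(F in faces K) IF F (fE F) := eq2.
  have eq3 := green e r cK aff.
  have face F : F \in faces K -> IF F (fun x =>
      herm (crossv (N F) (peval e x)) (peval r x)) = IF F (fE F) + IF F (fB F).
    move=> FK; have [_ NN] := face_nondegenerate FK; have JF := HIF FK.
    have pE : poly_on (hull v F) (fE F).
      exact: (poly_on_herm (vpoly_onZ _ (pN F _ _ (gmP FK))) (ptc F _ _ (pe r _))).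
    have pB : poly_on (hull v F) (fB F).
      exact: (poly_on_herm (vpoly_onZ _ (pN F _ _ (vpoly_onB (ptc F _ _ (pe e _))
        (pN F _ _ (pe h _))))) (ptc F _ _ (pe r _))).
    rewrite -(integral_onD JF pE pB); apply: (integral_on_ext JF) => x Fx.
    rewrite /fE /fB gE// -[gminus F x]/(tc F (peval e x) + crossv (N F) (peval h x)).
    have st := herm_cross_tcomp NN (peval e x) (peval r x).
    have ca := cross_tcomp NN (peval e x).
    move: (crossv (N F) (peval h x)) => s.
    rewrite (crossDr (N F) _ s) (crossDr (N F) _ (- s)) (crossNr (N F) s) ca.
    rewrite -/(tc F) -/(N F) in st; rewrite -st.
    move: (crossv (N F) (peval e x)) (crossv (N F) s) (tc F (peval r x)) => a u t.
    by rewrite !hermZl !hermDl hermNl; field.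
  exact: (weak_to_strongN eq2' eq3 face).
pose q := mpoly.mpolyC 3 k *: e - curl h.
pose r := mpoly.mpolyC 3 k *: h + curl e.
have qP : Pp p q by apply: PpD; [exact: Pp_scale|apply: PpN; exact: Pp_curl].
have rP : Pp p r by apply: PpD; [exact: Pp_scale|exact: Pp_curl].
have pherm (a b : 'rV[poly]_3) : poly_on (hull v K) (fun x => herm (peval a x) (peval b x)).
  exact: poly_on_herm (pe a _) (pe b _).
have q0 : q = 0.
  apply: (element_integral_eq0 cK aff).
  rewrite [X in complex.Re X](_ : _ = k * IK (fun x => herm (peval e x) (peval q x)) -
    IK (fun x => herm (peval (curl h) x) (peval q x))); last first.
    rewrite -(integral_onZ HIK _ (pherm e q)).
    rewrite -(integral_onB HIK (poly_onZ _ (pherm e q)) (pherm (curl h) q)).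
    rewrite -[LHS]/(IK (fun x => herm (peval q x) (peval q x))).
    apply: (integral_on_ext HIK) => x _.
    by rewrite {1}/q pevalB pevalZ hermDl hermNl hermZl.
  by rewrite strong1// subrr.
have r0 : r = 0.
  apply: (element_integral_eq0 cK aff).
  rewrite [X in complex.Re X](_ : _ = k * IK (fun x => herm (peval h x) (peval r x)) +
    IK (fun x => herm (peval (curl e) x) (peval r x))); last first.
    rewrite -(integral_onZ HIK _ (pherm h r)).
    rewrite -(integral_onD HIK (poly_onZ _ (pherm h r)) (pherm (curl e) r)).
    rewrite -[LHS]/(IK (fun x => herm (peval r x) (peval r x))).
    apply: (integral_on_ext HIK) => x _.
    by rewrite {1}/r pevalD pevalZ hermDl hermZl.
  by rewrite strong2// addNr.
apply: (curl_system_eq0 k0).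
  by apply/eqP; rewrite -subr_eq0; apply/eqP.
by apply/eqP; rewrite -subr_eq0 opprK; apply/eqP.
Qed.

End LocalProblem.

(** * Strict contraction on an element *)

Section ElementContraction.
Variables (R : realType) (kappa : R) (p n : nat) (v : 'I_n -> 'rV[R]_3).
Variable K : {set 'I_n}.
Hypotheses (kappa_gt0 : 0 < kappa) (cK : #|K| = 4%N) (aff : affinely_independent v K).
Local Notation C := R[i].
Local Notation poly := (mpoly.mpoly 3 C).

Definition face_energy F (f : 'rV[R]_3 -> 'rV[C]_3) : R :=
  complex.Re (innerF v F f f).

Lemma face_energy_ge0 F f : F \in faces K -> 0 <= face_energy F f.
Proof.
move=> /face_card cF; rewrite /face_energy innerFE.
apply: (integral_on_ge0 (face_integral_on v cF)) => x _; exact: dot_conj_ge0.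
Qed.

Lemma eq_face_energy F f g : F \in faces K ->
  (forall x, hull v F x -> f x = g x) -> face_energy F f = face_energy F g.
Proof.
move=> /face_card cF fg; rewrite /face_energy !innerFE; apply: (congr1 (@complex.Re R)).
by apply: (integral_on_ext (face_integral_on v cF)) => x Fx; rewrite fg.
Qed.

Lemma face_energy0 F : F \in faces K -> face_energy F (fun=> 0) = 0.
Proof.
move=> FK; rewrite /face_energy innerFE.
have pz : poly_on (hull v F) (fun=> 0 : C) by exact: poly_on_cst.
have JF := face_integral_on v (face_card FK).
have <- : complex.Re (face_integral v F (fun x => 0 * (0 : C))) = 0.
  by rewrite (integral_onZ JF 0 pz) mul0r.
apply: (congr1 (@complex.Re R)); apply: (integral_on_ext JF) => x _.
by rewrite mul0r /dotv big1// => j _; rewrite mxE mul0r.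
Qed.

Lemma face_energyN F f : F \in faces K ->
  face_energy F (fun x => - f x) = face_energy F f.
Proof.
move=> FK; rewrite /face_energy !innerFE; apply: (congr1 (@complex.Re R)).
apply: (integral_on_ext (face_integral_on v (face_card FK))) => x _.
by rewrite conjvN dotNv dotvN opprK.
Qed.

Lemma face_energy_eq0 F f : F \in faces K -> vpoly_on (hull v F) f ->
  face_energy F f = 0 -> forall x, hull v F x -> f x = 0.
Proof.
move=> FK pf f0 x Fx; have [N0 _] := face_nondegenerate cK aff FK.
apply: dot_conj_eq0.
apply: (face_integral_eq0 (face_card FK) N0 (poly_on_herm pf pf) _ f0 Fx) => y _.
exact: dot_conj_ge0.
Qed.

Lemma Ppt_vpoly_on F g : Ppt p v F g -> vpoly_on (hull v F) g.
Proof. by move=> [[q _ ->] _]; exists q => x Fx; rewrite patchT; last exact: mem_set. Qed.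

Lemma Ppt_eq0 F g : Ppt p v F g -> (forall x, hull v F x -> g x = 0) -> g = 0.
Proof.
move=> [[q _ gE] _] g0; apply/funext => x.
have [Fx|nFx] := pselect (hull v F x); first exact: g0.
by rewrite gE patchC; last exact: mem_set.
Qed.

Lemma gplus0 F (x : 'rV[R]_3) : gplus v K F 0 0 x = 0.
Proof.
have p0 : peval (0 : 'rV[poly]_3) x = 0.
  by apply/rowP => j; rewrite !mxE mpoly.meval0.
have c0 (u : 'rV[C]_3) : crossv u 0 = 0 by apply/rowP => j; rewrite !mxE; ring.
by rewrite /gplus /tctrace /ttrace /tcomp p0 !c0 !oppr0 addr0.
Qed.

Lemma sumr_eq0_in (I : finType) (P : {pred I}) (G : I -> R) :
  (forall i, i \in P -> 0 <= G i) -> \sum_(i in P) G i = 0 ->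
  forall i, i \in P -> G i = 0.
Proof.
move=> G0 /eqP; rewrite psumr_eq0// => /allP h i iP.
by apply/eqP; move: (h i); rewrite mem_index_enum iP => /(_ isT).
Qed.

Lemma le_sum_balance (I : finType) (P : {pred I}) (f g k : I -> R) :
  (forall i, i \in P -> 0 <= k i) ->
  \sum_(i in P) f i = \sum_(i in P) g i + \sum_(i in P) k i ->
  \sum_(i in P) g i <= \sum_(i in P) f i /\
  (\sum_(i in P) g i = \sum_(i in P) f i -> forall i, i \in P -> k i = 0).
Proof.
move=> k0 ->; split; first by rewrite lerDl sumr_ge0.
move=> /eqP; rewrite -subr_eq0 opprD addNKr oppr_eq0 => /eqP.
exact: sumr_eq0_in.
Qed.

Variable gm : {set 'I_n} -> 'rV[R]_3 -> 'rV[C]_3.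
Hypothesis gmP : forall F, F \in faces K -> Ppt p v F (gm F).

Let gmV F : F \in faces K -> vpoly_on (hull v F) (gm F).
Proof. by move=> /gmP /Ppt_vpoly_on. Qed.

(** A predicate on a number E, because rewriting in an explicit comparison of two
    energy sums would make the two sums be matched against each other. *)
Definition energy_below (E : R) :=
  E <= \sum_(F in faces K) face_energy F (gm F) /\
  (E = \sum_(F in faces K) face_energy F (gm F) ->
   forall F, F \in faces K -> gm F = 0).
Definition contracts (f : {set 'I_n} -> 'rV[R]_3 -> 'rV[C]_3) :=
  energy_below (\sum_(F in faces K) face_energy F (f F)).

Lemma eq_contracts f g :
  (forall F x, F \in faces K -> hull v F x -> f F x = g F x) ->
  contracts g -> contracts f.
Proof.
move=> fg; have fgE F : F \in faces K -> face_energy F (f F) = face_energy F (g F).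
  by move=> FK; apply: eq_face_energy => // x; exact: fg.
have fgS : \sum_(F in faces K) face_energy F (f F) =
    \sum_(F in faces K) face_energy F (g F) := eq_bigr _ fgE.
by move=> cg; rewrite /contracts fgS; exact: cg.
Qed.

Lemma contracts_solution e h : local_solution kappa p v K gm e h ->
  contracts (fun F => gplus v K F e h).
Proof.
move=> sol.
have [le eq0] := le_sum_balance
  (fun F (FK : F \in faces K) =>
    face_energy_ge0 (fun x => gm F x - gminus v K e h F x) FK)
  (energy_identity cK aff gmV sol).
split=> [|/eq0 dF {le eq0}]; first exact: le.
have gE F x : F \in faces K -> hull v F x -> gm F x = gminus v K e h F x.
  move=> FK Fx; apply/eqP; rewrite -subr_eq0; apply/eqP.
  have pm : vpoly_on (hull v F) (gminus v K e h F).
    exact: (vpoly_onD (vpoly_on_tcomp _ (vpoly_on_peval _ e))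
                     (vpoly_on_cross _ (vpoly_on_peval _ h))).
  exact: (face_energy_eq0 FK (vpoly_onB (gmV FK) pm) (dF F FK) Fx).
have [e0 h0] := local_solution_eq0 kappa_gt0 cK aff gmV sol gE.
move=> F FK; apply: (Ppt_eq0 (gmP FK)) => x Fx; rewrite gE//.
have := gplus0 F x; rewrite /gminus /gplus e0 h0.
have -> : ttrace v K F (peval (0 : 'rV[poly]_3)) x = 0.
  by apply/rowP => j; rewrite /ttrace !mxE !mpoly.meval0 !mulr0 subr0.
by rewrite subr0 addr0.
Qed.

Lemma contracts0 : contracts (fun _ _ => 0).
Proof.
have zS : \sum_(F in faces K) face_energy F (fun=> 0) = 0.
  by apply: big1 => F; exact: face_energy0.
rewrite /contracts zS; split.
  by apply: sumr_ge0 => F FK; exact: face_energy_ge0.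
move=> /esym /(sumr_eq0_in (fun F FK => face_energy_ge0 (gm F) FK)) g0 F FK.
apply: (Ppt_eq0 (gmP FK)); exact: (face_energy_eq0 FK (gmV FK) (g0 F FK)).
Qed.

(** Both values of solution are covered: an actual solution, and the default
    (0, 0), whose traces vanish. *)
Lemma scattering_contracts :
  contracts (fun F => let: (e, h) := solution kappa p v K gm in
    patch (fun=> 0) (hull v F) (gplus v K F e h)).
Proof.
case E : (solution kappa p v K gm) => [e h].
apply: (@eq_contracts _ (fun F => gplus v K F e h)).
  by move=> F x FK Fx; rewrite patchT; last exact: mem_set.
move: E; rewrite /solution; case: xgetP => [[e' h'] _ sol [ee hh]|_ [<- <-]].
  by rewrite -ee -hh; exact: (contracts_solution sol).
by apply: eq_contracts contracts0 => F x _ _; exact: gplus0.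
Qed.

End ElementContraction.

(** * Exchange and the global contraction *)

Lemma ltr_sum_one (R : numDomainType) (I : finType) (P : {pred I}) (f g : I -> R) i :
  i \in P -> (forall j, j \in P -> f j <= g j) -> f i < g i ->
  \sum_(j in P) f j < \sum_(j in P) g j.
Proof.
move=> iP fg fgi; rewrite (bigD1 i)//= [ltRHS](bigD1 i)//=.
by apply: ltr_leD => //; apply: ler_sum => j /andP[jP _]; exact: fg.
Qed.

Section ExchangeNonExpansive.
Variables (R : realType) (Omega GammaE GammaH : set 'rV[R]_3).
Variables (n : nat) (v : 'I_n -> 'rV[R]_3) (Th : {set {set 'I_n}}).
Hypothesis mesh : conforming_mesh Omega v Th.
Local Notation field := ('rV[R]_3 -> 'rV[R[i]]_3).
Variable E : {set 'I_n} -> field -> R.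
Hypothesis E_ge0 : forall K F f, F \in faces K -> 0 <= E F f.
Hypothesis E_opp : forall K F f, F \in faces K -> E F (- f) = E F f.
Hypothesis E0 : forall K F, F \in faces K -> E F 0 = 0.
Variable g : {set 'I_n} -> {set 'I_n} -> field.
Let xg := exchange Omega GammaE GammaH v Th g.

Let owners (F : {set 'I_n}) : {set {set 'I_n}} := [set K in Th | F \in faces K]%SET.

Let ownersE F K : (K \in owners F) = (K \in Th) && (F \in faces K).
Proof. by rewrite !inE. Qed.

Lemma neighbour_owners F K K' : owners F = [set K; K']%SET -> K != K' ->
  neighbour Th K F = Some K'.
Proof.
move=> oF KK'; rewrite /neighbour.
have mem L : (L \in Th) && (F \in faces L) = (L == K) || (L == K').
  by rewrite -in_set2 -oF ownersE.
case: pickP => [L /= /and3P[LT LK LF]|].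
  by have := mem L; rewrite LT LF (negbTE LK) /= => /esym/eqP ->.
move=> /(_ K') /=; rewrite andbCA mem eqxx orbT andbT.
by rewrite eq_sym KK'.
Qed.

Lemma exchange_interior F K K' : owners F = [set K; K']%SET -> K != K' ->
  ~ (hull v F `<=` frontier Omega) -> xg K F = g K' F.
Proof.
move=> oF KK' nF; have : K \in owners F by rewrite oF !inE eqxx.
rewrite ownersE /xg /exchange => ->.
by rewrite asboolF// (neighbour_owners oF KK').
Qed.

(** The two components on an interior face are swapped; on a boundary face each
    is negated, kept or erased. *)
Lemma exchange_face F :
  \sum_(K in owners F) E F (xg K F) <= \sum_(K in owners F) E F (g K F).
Proof.
have [bF|nF] := pselect (hull v F `<=` frontier Omega).
  apply: ler_sum => K; rewrite ownersE => KF; have /andP[_ FK] := KF.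
  rewrite /xg /exchange KF asboolT//=.
  case: ifP => _; first by rewrite (E_opp _ FK).
  by case: ifP => _ //; rewrite (E0 FK); exact: E_ge0 FK.
have [->|[K]] := set_0Vmem (owners F); first by rewrite !big_set0.
rewrite ownersE => /andP[KT FK].
have := mesh_interior_face mesh KT FK nF; rewrite -/(owners F).
move=> /eqP /cards2P [K1 [K2 [K12 oF]]].
have K21 : K2 != K1 by rewrite eq_sym.
have oF' : owners F = [set K2; K1]%SET by rewrite oF finset.setUC.
have notin : K1 \notin [set K2]%SET by rewrite inE.
rewrite oF !big_setU1//= !big_set1.
by rewrite (exchange_interior oF K12 nF) (exchange_interior oF' K21 nF) addrC.
Qed.

(** The sums are rearranged face by face, so that the components that are
    exchanged come together. *)
Lemma exchange_nonexpansive :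
  \sum_(K in Th) \sum_(F in faces K) E F (xg K F) <=
  \sum_(K in Th) \sum_(F in faces K) E F (g K F).
Proof.
have swap (G : {set 'I_n} -> {set 'I_n} -> R) :
    \sum_(K in Th) \sum_(F in faces K) G K F = \sum_F \sum_(K in owners F) G K F.
  rewrite (exchange_big_dep predT)//=; apply: eq_bigr => F _.
  by apply: eq_bigl => K; rewrite ownersE.
by rewrite !swap; apply: ler_sum => F _; exact: exchange_face.
Qed.

End ExchangeNonExpansive.

Section GlobalContraction.
Variables (R : realType) (kappa : R) (p n : nat) (v : 'I_n -> 'rV[R]_3).
Variables (Omega : set 'rV[R]_3) (Th : {set {set 'I_n}}).
Hypotheses (kappa_gt0 : 0 < kappa) (mesh : conforming_mesh Omega v Th).
Local Notation field := ('rV[R]_3 -> 'rV[R[i]]_3).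
Implicit Type g : {set 'I_n} -> {set 'I_n} -> field.

Definition skeleton_energy g : R :=
  \sum_(K in Th) \sum_(F in faces K) face_energy v F (g K F).

Lemma skeleton_normE g : skeleton_norm v Th g = Num.sqrt (skeleton_energy g).
Proof.
rewrite /skeleton_norm Re_sum; apply: (congr1 Num.sqrt).
by apply: eq_bigr => K _; exact: Re_sum.
Qed.

Lemma skeleton_energy_ge0 g : 0 <= skeleton_energy g.
Proof.
apply: sumr_ge0 => K _; apply: sumr_ge0 => F FK.
exact: (face_energy_ge0 v (g K F) FK).
Qed.

Lemma skeleton_neq0 g : skeleton p v Th g -> g <> 0 ->
  exists K F, [/\ K \in Th, F \in faces K & g K F <> 0].
Proof.
move=> gP g0; apply: contrapT => none; apply: g0; apply/funext => K; apply/funext => F.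
have := gP K F; case: ifP => [/andP[KT FK] _|_ //].
by apply: contrapT => gKF; apply: none; exists K, F.
Qed.

(** Every element contracts, and one on which g does not vanish does so strictly. *)
Lemma scattering_lt g : skeleton p v Th g -> g <> 0 ->
  skeleton_energy (scattering kappa p v Th g) < skeleton_energy g.
Proof.
move=> gP /(skeleton_neq0 gP) [K [F [KT FK gKF]]].
have contr L : L \in Th -> contracts v L (g L) (scattering kappa p v Th g L).
  move=> LT; apply: (@eq_contracts _ _ _ _ _ _ (fun F =>
    let: (e, h) := solution kappa p v L (g L) in
    patch (fun=> 0) (hull v F) (gplus v L F e h))).
    by move=> G x GL _; rewrite /scattering LT GL.
  apply: scattering_contracts => //.
  - exact: mesh_card mesh _ LT.
  - exact: mesh_nondegenerate mesh _ LT.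
  - by move=> G GL; have := gP L G; rewrite LT GL.
apply: (ltr_sum_one KT) => [L /contr [] //|].
have [le eq0] := contr K KT; rewrite lt_neqAle le andbT.
by apply/eqP => /eq0 /(_ F FK).
Qed.

End GlobalContraction.

Theorem corollary3p5 (R : realType) (kappa : R) (p : nat)
    (Omega GammaE GammaH GammaI : set 'rV[R]_3)
    (n : nat) (v : 'I_n -> 'rV[R]_3) (Th : {set {set 'I_n}}) :
  0 < kappa ->
  polyhedral_domain Omega ->
  boundary_partition Omega GammaE GammaH GammaI ->
  conforming_mesh Omega v Th ->
  faces_fit Omega GammaE GammaH GammaI v Th ->
  forall g : {set 'I_n} -> {set 'I_n} -> 'rV[R]_3 -> 'rV[R[i]]_3,
    skeleton p v Th g -> g <> 0 ->
    skeleton_norm v Th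
      (exchange Omega GammaE GammaH v Th (scattering kappa p v Th g))
    < skeleton_norm v Th g.
Proof.
move=> kappa_gt0 _ _ mesh _ g gP g0; rewrite !skeleton_normE.
have lt := scattering_lt kappa_gt0 mesh gP g0.
rewrite ltr_sqrt; last exact: le_lt_trans (skeleton_energy_ge0 _ _ _) lt.
apply: le_lt_trans lt; apply: (exchange_nonexpansive _ _ mesh).
- by move=> K F f; exact: face_energy_ge0.
- by move=> K F f FK; exact: (face_energyN v f FK).
- by move=> K F FK; exact: (face_energy0 v FK).
Qed.
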